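(* Let $M$ be a connected non-binary matroid. Then $M$ is theta-orderable if and only if $M$ is (up to isomorphism) a parallel extension of a balanced series extension of $U_{2,n}$ for some $n\geq 4$.
   Context: All matroids are finite. A reversible cyclic ordering of a finite set $X$ with $|X|=n$ is an arrangement of the elements of $X$ on the vertices of an $n$-gon, one element at each vertex (considered up to rotation and reflection); two elements are adjacent in the ordering when their vertices lie on a common edge of the $n$-gon. An ordering of a matroid $M$ is a choice of a reversible cyclic ordering for each circuit of $M$. It is consistent if, for every pair $\{e,f\}$ of distinct elements of $E(M)$ and every pair $\{C,C'\}$ of circuits with $\{e,f\}\subseteq C\cap C'$, if $e$ and $f$ are adjacent in the ordering of $C$, then they are adjacent in the ordering of $C'$. A theta-graph (as a graph) consists of a pair of distinct vertices and three internally disjoint paths between them. A theta-graph in a matroid $M$ is a restriction of $M$ that is isomorphic to the cycle matroid of a theta-graph. Its series classes (the edge sets of the three paths) are its theta-arcs. A subset $B$ of a circuit $C$ is a block if there is a listing $b_1,b_2,\dots,b_k$ of the elements of $B$ such that $b_i$ and $b_{i+1}$ are adjacent (in the ordering of $C$) for all $i\in\{1,\dots,k-1\}$. A consistent ordering of $M$ is a theta-ordering if every theta-arc of every theta-graph of $M$ is a block in the ordering; $M$ is theta-orderable if it has a theta-ordering. A matroid $N$ is a parallel extension of $M$ if it is obtained from $M$ by a (possibly empty) sequence of single-element parallel extensions. For a matroid $M$ without coloops, a balanced series extension of $M$ is a matroid obtained by replacing each element of $M$ by $k$ elements in series, for some positive integer $k$ (the same $k$ for all elements). *)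

(* Defs.v *)
From HB Require Import structures.
From Stdlib Require Import Relations.Relation_Operators.
From mathcomp Require Import all_boot all_order all_algebra.
Set Implicit Arguments.
Unset Strict Implicit.
Unset Printing Implicit Defensive.

Section MatroidData.
Variable T : finType.
Implicit Types (G X Y B : {set T}) (I : {set {set T}}).

Definition matroid_axiom G I : bool :=
  [&& [forall X in I, X \subset G],
      set0 \in I,
      [forall X in I, forall Y : {set T}, (Y \subset X) ==> (Y \in I)]
    & [forall X in I, forall Y in I, (#|X| < #|Y|) ==>
         [exists y in Y :\: X, (y |: X) \in I]]].

Lemma matroid_axiomP G I :
  reflect [/\ forall X, X \in I -> X \subset G,
              set0 \in I,
              forall X Y, X \in I -> Y \subset X -> Y \in I
            & forall X Y, X \in I -> Y \in I -> #|X| < #|Y| ->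
                exists2 y, y \in Y :\: X & (y |: X) \in I]
          (matroid_axiom G I).
Proof.
apply: (iffP and4P) => -[h1 h2 h3 h4]; split => //.
- by move=> X; apply/implyP; move/forallP: h1; apply.
- move=> X Y XI YX; move/forallP/(_ X)/implyP/(_ XI)/forallP/(_ Y): h3.
  by move/implyP; apply.
- move=> X Y XI YI XY; move/forall_inP/(_ X XI)/forall_inP/(_ Y YI): h4.
  by move/implyP/(_ XY)/exists_inP.
- exact/forall_inP.
- by apply/forall_inP => X XI; apply/forallP => Y; apply/implyP; apply: h3.
- apply/forall_inP => X XI; apply/forall_inP => Y YI; apply/implyP => XY.
  by apply/exists_inP; apply: h4.
Qed.

(* The ground set is a subset of the carrier T, so that deletion, contraction
   and (inverse) single-element extensions stay over T. *)
Record matroid := Matroid {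
  matroid_data : {set T} * {set {set T}};
  _ : matroid_axiom matroid_data.1 matroid_data.2 }.

HB.instance Definition _ := [isSub for matroid_data].
HB.instance Definition _ := [Equality of matroid by <:].

Definition ground (M : matroid) : {set T} := (matroid_data M).1.
Definition indep (M : matroid) : {set {set T}} := (matroid_data M).2.

(* Leibniz equality of matroids is equality of ground and independent sets. *)
Lemma matroid_ext M N : ground M = ground N -> indep M = indep N -> M = N.
Proof.
by move=> eqG eqI; apply: val_inj; apply: injective_projections.
Qed.

Lemma matroidP M :
  [/\ forall X, X \in indep M -> X \subset ground M,
      set0 \in indep M,
      forall X Y, X \in indep M -> Y \subset X -> Y \in indep M
    & forall X Y, X \in indep M -> Y \in indep M -> #|X| < #|Y| ->
        exists2 y, y \in Y :\: X & (y |: X) \in indep M].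
Proof. by apply/matroid_axiomP; case: M. Qed.

Definition basis (M : matroid) B : bool := maxset (mem (indep M)) B.

Definition circuit (M : matroid) C : bool :=
  minset (fun X => (X \subset ground M) && (X \notin indep M)) C.

Lemma uniform_axiom r G : matroid_axiom G [set X in powerset G | #|X| <= r].
Proof.
apply/matroid_axiomP; split.
- by move=> X; rewrite inE powersetE => /andP[].
- by rewrite inE powersetE sub0set cards0.
- move=> X Y; rewrite !inE => /andP[XG Xr] YX.
  by rewrite (subset_trans YX XG) (leq_trans (subset_leq_card YX) Xr).
- move=> X Y; rewrite !inE => /andP[XG Xr] /andP[YG Yr] ltXY.
  have /subsetPn[y yY yX] : ~~ (Y \subset X).
    by apply/negP => /subset_leq_card; rewrite leqNgt ltXY.
  exists y; first by rewrite inE yX.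
  rewrite !inE subUset sub1set (subsetP YG) // XG cardsU1 yX.
  exact: leq_trans ltXY Yr.
Qed.

Definition uniform r G : matroid :=
  @Matroid (G, [set X in powerset G | #|X| <= r]) (uniform_axiom r G).

Lemma restrict_axiom (M : matroid) X :
  matroid_axiom (ground M :&: X) [set I in indep M | I \subset X].
Proof.
have [m1 m2 m3 m4] := matroidP M.
apply/matroid_axiomP; split.
- by move=> I; rewrite inE subsetI => /andP[/m1 -> ->].
- by rewrite inE m2 sub0set.
- move=> I J; rewrite !inE => /andP[IM IX] JI.
  by rewrite (m3 I J) // (subset_trans JI).
- move=> I J; rewrite !inE => /andP[IM IX] /andP[JM JX] ltIJ.
  have [y yJI yI] := m4 I J IM JM ltIJ.
  exists y => //; rewrite inE yI subUset IX andbT sub1set.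
  by move: yJI; rewrite inE => /andP[_ /(subsetP JX)].
Qed.

Definition restrict (M : matroid) X : matroid :=
  @Matroid (ground M :&: X, [set I in indep M | I \subset X])
           (restrict_axiom M X).

Definition delete (M : matroid) X : matroid := restrict M (ground M :\: X).

Definition coindep (M : matroid) : {set {set T}} :=
  [set X in powerset (ground M) | [exists B, basis M B && [disjoint X & B]]].

Lemma indep_extend (M : matroid) X Y : X \in indep M -> Y \in indep M ->
  #|X| <= #|Y| ->
  exists Z, [/\ Z \in indep M, X \subset Z, Z \subset X :|: Y & #|Z| = #|Y|].
Proof.
have [_ _ _ m4] := matroidP M.
move: {2}(#|Y| - #|X|) (erefl (#|Y| - #|X|)) => n.
elim: n X => [|n IHn] X En XM YM leXY.
  exists X; split => //; first exact: subsetUl.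
  by apply/eqP; rewrite eqn_leq leXY /= -subn_eq0 En.
have ltXY : #|X| < #|Y| by rewrite -subn_gt0 En.
have [y] := m4 X Y XM YM ltXY; rewrite inE => /andP[yX yY] yXM.
have cy : #|y |: X| = #|X|.+1 by rewrite cardsU1 yX.
have [||//||Z [ZM XZ ZXY cZ]] := IHn (y |: X).
- by rewrite cy subnS En.
- by [].
- by rewrite cy.
exists Z; split => //; first exact: subset_trans (subsetUr _ _) XZ.
apply: (subset_trans ZXY); rewrite -setUA subUset subxx andbT sub1set.
by rewrite inE yY orbT.
Qed.

Lemma indep_sub_basis (M : matroid) X : X \in indep M ->
  exists2 B, basis M B & X \subset B.
Proof. by move=> XM; case: (@maxset_exists _ (mem (indep M)) X XM) => B; exists B. Qed.

Lemma basis_indep (M : matroid) B : basis M B -> B \in indep M.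
Proof. by case/maxsetP. Qed.

Lemma indep_le_basis (M : matroid) B X :
  basis M B -> X \in indep M -> #|X| <= #|B|.
Proof.
have [_ _ _ m4] := matroidP M.
case/maxsetP => BM maxB XM; rewrite leqNgt; apply/negP => lt.
have [y] := m4 B X BM XM lt; rewrite inE => /andP[yB _] yBM.
have E := maxB _ yBM (subsetUr _ _).
by move: yB; rewrite -E setU11.
Qed.

Lemma basis_card (M : matroid) B X :
  basis M B -> X \in indep M -> #|X| = #|B| -> basis M X.
Proof.
move=> bB XM cX; apply/maxsetP; split => // Y YM XY.
by apply/eqP; rewrite eq_sym eqEcard XY cX (indep_le_basis bB YM).
Qed.

Lemma dual_axiom (M : matroid) : matroid_axiom (ground M) (coindep M).
Proof.
have [m1 m2 m3 m4] := matroidP M.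
have coP X : reflect (X \subset ground M /\ exists2 B, basis M B & [disjoint X & B])
                     (X \in coindep M).
  rewrite inE powersetE; apply: (iffP andP) => -[-> h]; split => //.
    by case/existsP: h => B /andP[]; exists B.
  by case: h => B h1 h2; apply/existsP; exists B; rewrite h1.
apply/matroid_axiomP; split.
- by move=> X /coP[].
- apply/coP; split; first exact: sub0set.
  have [B bB _] := indep_sub_basis m2; exists B => //.
  by rewrite -setI_eq0 set0I.
- move=> X Y /coP[XG [B bB dX]] YX; apply/coP.
  split; first exact: subset_trans YX XG.
  by exists B => //; apply: disjointWl dX.
- move=> X Y /coP[XG [B bB dX]] /coP[YG [B' bB' dY]] ltXY.
  have B'XM : B' :\: X \in indep M.
    by apply: m3 (basis_indep bB') _; apply: subsetDl.
  have [Z [ZM subZ Zsub cZ]] :=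
    indep_extend B'XM (basis_indep bB) (indep_le_basis bB B'XM).
  have bZ := basis_card bB ZM cZ.
  have dZ : [disjoint X & Z].
    rewrite disjoint_sym; apply: (disjointWl Zsub).
    rewrite disjoint_sym -setI_eq0 setIUr setU_eq0 !setI_eq0 dX andbT.
    by rewrite -setI_eq0; apply/eqP/setP => x; rewrite !inE; case: (x \in X).
  have [YXZ | /subsetPn[y yYX yZ]] := boolP (Y :\: X \subset Z); last first.
    exists y => //; apply/coP; split.
      rewrite subUset XG andbT sub1set (subsetP YG) //.
      by move: yYX; rewrite inE => /andP[].
    exists Z => //; rewrite -setI_eq0 setIUl setU_eq0 !setI_eq0 dZ andbT.
    by rewrite disjoints1.
  exfalso.
  have lt : #|X :\: Y| < #|Y :\: X|.
    by rewrite -(ltn_add2l #|X :&: Y|) cardsID setIC cardsID.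
  have le1 : #|B'| <= #|B' :\: X| + #|X :\: Y|.
    rewrite -(cardsID X B') addnC leq_add2l; apply: subset_leq_card.
    apply/subsetP => x; rewrite !inE => /andP[xB' ->]; rewrite andbT.
    by apply/negP => xY; rewrite (disjointFr dY xY) in xB'.
  have le2 : #|B' :\: X| + #|Y :\: X| <= #|Z|.
    have d : [disjoint B' :\: X & Y :\: X].
      by apply: disjointWl (subsetDl _ _) _; apply: disjointWr (subsetDl _ _) _;
         rewrite disjoint_sym.
    have := leq_card_setU (B' :\: X) (Y :\: X); case=> _; rewrite d => /eqP <-.
    by apply: subset_leq_card; rewrite subUset subZ.
  have := indep_le_basis bB' ZM; rewrite leqNgt => /negP; apply.
  by apply: leq_ltn_trans le1 _; apply: leq_trans le2; rewrite ltn_add2l.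
Qed.

Definition dual (M : matroid) : matroid :=
  @Matroid (ground M, coindep M) (dual_axiom M).

Definition contract (M : matroid) X : matroid := dual (delete (dual M) X).

Definition is_loop (M : matroid) e : bool := circuit M [set e].
Definition parallel (M : matroid) e f : bool :=
  (e != f) && circuit M [set e; f].
Definition in_series (M : matroid) e f : bool := parallel (dual M) e f.

Definition parallel_class (M : matroid) A : bool :=
  maxset (fun X => [&& X \subset ground M,
                       [forall e in X, ~~ is_loop M e]
                     & [forall e in X, forall f in X,
                          (e != f) ==> parallel M e f]]) A.
Definition series_class (M : matroid) A : bool := parallel_class (dual M) A.

Definition coloopless (M : matroid) : Prop := forall e, ~~ is_loop (dual M) e.

Definition connected (M : matroid) : Prop :=
  forall e f, e \in ground M -> f \in ground M -> e != f ->
    exists C, [/\ circuit M C, e \in C & f \in C].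

Definition representable (F : fieldType) (M : matroid) : Prop :=
  exists (m : nat) (v : T -> 'rV[F]_m), forall X, X \subset ground M ->
    (X \in indep M) = free [seq v x | x <- enum X].
Definition binary (M : matroid) : Prop := representable 'F_2 M.

(* parallel_ext1 N M: M is a single-element parallel extension of N. *)
Definition parallel_ext1 (N M : matroid) : Prop :=
  exists e f, [/\ parallel M e f & delete M [set e] = N].
Definition parallel_ext : matroid -> matroid -> Prop :=
  clos_refl_trans matroid parallel_ext1.

(* balanced_series_ext M N: N arises from M by replacing each element e by the
   k elements of the fibre p^-1(e), which contains e itself; contracting the
   added elements gives M back. *)
Definition balanced_series_ext (M N : matroid) : Prop :=
  [/\ coloopless M, ground M \subset ground N,
      contract N (ground N :\: ground M) = M &
      exists (k : nat) (p : T -> T),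
        [/\ 0 < k,
            forall x, x \in ground N -> p x \in ground M,
            forall e, e \in ground M ->
              p e = e /\ #|[set x in ground N | p x == e]| = k &
            forall x y, x \in ground N -> y \in ground N -> x != y ->
              p x = p y -> in_series N x y]].

End MatroidData.

Definition matroid_iso (T T' : finType) (M : matroid T) (N : matroid T') : Prop :=
  exists f : {x : T | x \in ground M} -> {y : T' | y \in ground N},
    bijective f /\
    forall X : {set {x : T | x \in ground M}},
      ([set val x | x in X] \in indep M) =
      ([set val (f x) | x in X] \in indep N).

(* Loops and multiple edges are allowed; the order of the two ends of an edge
   carries no meaning. *)
Record multigraph (V E : finType) := Multigraph { ends : E -> V * V }.

Section Graphs.
Variables (V E : finType) (G : multigraph V E).

Definition joins (e : E) (x y : V) : bool :=
  (ends G e == (x, y)) || (ends G e == (y, x)).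

(* The walk x, e1, y1, ..., ek, yk is the start x with the list of (ei, yi). *)
Fixpoint walk (x : V) (p : seq (E * V)) : bool :=
  if p is (e, y) :: p' then joins e x y && walk y p' else true.

Definition path_between (x y : V) (p : seq (E * V)) : bool :=
  [&& walk x p, last x (unzip2 p) == y & uniq (x :: unzip2 p)].

Definition internal_vertices (x : V) (p : seq (E * V)) : seq V :=
  behead (belast x (unzip2 p)).

Definition is_cycle (x : V) (p : seq (E * V)) : bool :=
  [&& p != [::], walk x p, last x (unzip2 p) == x,
      uniq (unzip1 p) & uniq (unzip2 p)].

Definition theta_graph : Prop :=
  exists (u v : V) (p1 p2 p3 : seq (E * V)),
    [/\ u != v,
        [/\ path_between u v p1, path_between u v p2 & path_between u v p3],
        perm_eq [:: u, v & internal_vertices u p1 ++ internal_vertices u p2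
                           ++ internal_vertices u p3] (enum V)
      & perm_eq (unzip1 p1 ++ unzip1 p2 ++ unzip1 p3) (enum E)].

Definition is_cycle_matroid (N : matroid E) : Prop :=
  ground N = [set: E] /\
  forall C : {set E},
    circuit N C <-> exists x p, is_cycle x p /\ C = [set e in unzip1 p].

End Graphs.

Section Orderings.
Variables (T : finType) (M : matroid T).
Implicit Types (w : {set T} -> seq T) (s : seq T) (X A B C : {set T}).

(* X is the ground set of a theta-graph M|X of M. *)
Definition theta_in X : Prop :=
  X \subset ground M /\
  exists (V E : finType) (G : multigraph V E) (N : matroid E),
    [/\ theta_graph G, is_cycle_matroid G N & matroid_iso (restrict M X) N].

Definition theta_arc X A : bool := series_class (restrict M X) A.

(* A reversible cyclic ordering is represented by any sequence obtained by
   reading the polygon from some vertex in some direction; only the adjacency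
   relation below, invariant under rotation and reflection, is ever used. *)
Definition adjacent s (e f : T) : bool :=
  (e != f) && ((next s e == f) || (next s f == e)).

Definition block s B : Prop :=
  exists2 b : seq T, perm_eq b (enum B) & sorted (adjacent s) b.

Definition matroid_ordering w : Prop :=
  forall C, circuit M C -> perm_eq (w C) (enum C).

Definition consistent w : Prop :=
  forall e f C C', e != f -> circuit M C -> circuit M C' ->
    [set e; f] \subset C :&: C' -> adjacent (w C) e f -> adjacent (w C') e f.

(* Two circuits containing a common set A induce the same adjacencies on A in a
   consistent ordering, so being a block does not depend on the choice of C. *)
Definition theta_ordering w : Prop :=
  [/\ matroid_ordering w, consistent w &
      forall X A, theta_in X -> theta_arc X A ->
        forall C, circuit M C -> A \subset C -> block (w C) A].

Definition theta_orderable : Prop := exists w, theta_ordering w.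

End Orderings.

(* Main.v *)
Require Import Defs.
From Stdlib Require Import Relations.Relation_Operators.
From mathcomp Require Import all_boot all_algebra zify.
Set Implicit Arguments.
Unset Strict Implicit.
Unset Printing Implicit Defensive.

(* For an ordering of [M], join two elements when they are adjacent in some, hence every,
   common circuit: every circuit with at least three elements then induces a Hamiltonian
   cycle, and every theta-arc induces a path.  If [M] is not binary, some restriction of
   nullity two has at least four series classes.  Its circuits are the complements of the
   series classes, so counting degrees shows that there are exactly four of them, that they
   carry no edges, and that any two of them are joined by a perfect matching; in particular
   they have the same size.  Take a restriction that is a series extension of U_{2,n} with n
   maximal and attach an ear [D] to it.  Comparing degrees in the restrictions of nullity two
   spanned by circuits and [D] shows that [D] is a single element parallel to an old one, or
   a further series class, which contradicts maximality.

   Conversely, in such a matroid no theta avoids a parallel pair (its three circuits would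
   meet 9 lines of U_{2,n}, each line an even number of times), so only consistency matters;
   placing (j,t+1) next to (i,t) whenever i < j gives a consistent ordering. *)

(** Non-binarity supplies two meeting circuits whose union has nullity two and whose symmetric
    difference is not a circuit: if there were none, the fundamental vectors of one basis would
    represent the matroid over GF(2). The intersection of the two circuits then holds at least two
    series classes, next to the complements of the circuits; this is where the four classes come
    from.

    The obstacle in attaching an ear [D] is that circuits through [D] may cut a class [S]. A class
    avoided by some circuit through [D] is never cut. If no such circuit avoids [S], part of [S] is
    moved into the ear, and the structure without [S] shows that every other class is avoided. Hence
    ears are treated by induction on the number of classes; at four classes the deletion of one
    leaves a single circuit, and degrees decide.

    For the converse, the chain of extensions is replaced by coordinates (line, position), which
    pass through each parallel extension and through isomorphisms. *)

Ltac set_at z :=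
  repeat match goal with
  | H : is_true (?A \subset ?B) |- _ => move: (introT implyP (subsetP H z)); clear H
  | H : is_true [disjoint ?A & ?B] |- _ =>
      move: (introT implyP (fun k => negbT (disjointFr H (x := z) k))); clear H
  | H : is_true (_ \in _) |- _ => move: H
  | H : is_true (_ \notin _) |- _ => move: H
  | H : ?A = ?B |- _ =>
      move: (congr1 (fun X : {set _} => z \in X) H) => /=; clear H
  end;
  rewrite ?inE;
  repeat match goal with
  | |- context [z == ?x] => case: (z =P x) => [?|_]; [subst z|]; rewrite //=
  end;
  repeat match goal with
  | |- context [?y \in ?A] => case: (y \in A) => //=
  end; rewrite ?eqxx ?orbT ?andbT ?orbF ?andbF //=.

(** Works elementwise: every inclusion, disjointness and set equality in the context is read at a
    generic [z], and a Boolean case split finishes. All such hypotheses are pulled in, hence the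
    [clear] before many calls. *)
Ltac set_solve :=
  match goal with
  | |- is_true (_ \subset _) => let z := fresh "z" in apply/subsetP => z; set_at z
  | |- is_true [disjoint _ & _] =>
     rewrite disjoint_subset; let z := fresh "z" in apply/subsetP => z; set_at z
  | |- _ = _ => let z := fresh "z" in apply/setP => z; set_at z
  end.

(** * Nullity *)

Section Nullity.
Variables (T : finType) (M : matroid T).
Implicit Types (X Y C I : {set T}).

(** Minimality is taken among all sets outside [indep]. Besides the circuits this admits only
    singletons of elements off the ground set, and it spares the elimination lemmas a side
    condition. *)
Definition circ C : bool := minset (fun X => X \notin indep M) C.

Lemma circuitE C : circuit M C = (C \subset ground M) && circ C.
Proof.
apply/idP/andP => [/minsetP[/andP[CG CI] min]|[CG /minsetP[CI min]]].
  split=> //; apply/minsetP; split=> // B BI BC.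
  by apply: min => //; rewrite (subset_trans BC CG).
by apply/minsetP; split=> [|B /andP[_ BI] BC]; [rewrite CG | apply: min].
Qed.

Lemma indepS X Y : Y \in indep M -> X \subset Y -> X \in indep M.
Proof. by have [_ _ h _] := matroidP M; apply: h. Qed.

Lemma indep0 : set0 \in indep M. Proof. by have [] := matroidP M. Qed.

Lemma indep_ground X : X \in indep M -> X \subset ground M.
Proof. by have [h _ _ _] := matroidP M; apply: h. Qed.

Lemma circ_dep C : circ C -> C \notin indep M.
Proof. by case/minsetP. Qed.

Lemma circ_sub C X : circ C -> X \in indep M -> ~~ (C \subset X).
Proof. by move=> /circ_dep/negP cC XI; apply/negP => /(indepS XI). Qed.

Lemma circ_D1 C x : circ C -> x \in C -> C :\ x \in indep M.
Proof.
move=> /minsetP[_ min] xC; apply/negPn/negP => /min/(_ (subD1set _ _)) E.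
by have := setD11 x C; rewrite E xC.
Qed.

Lemma circ_inj C C' : circ C -> circ C' -> C \subset C' -> C = C'.
Proof. by move=> /circ_dep cC /minsetP[_ h] sub; apply: h. Qed.

Lemma indepPn X : reflect (exists2 C, circ C & C \subset X) (X \notin indep M).
Proof.
apply: (iffP idP) => [XI|[C cC CX]].
  by case: (@minset_exists _ (fun X => X \notin indep M) X XI) => C; exists C.
by apply/negP => XI; move: (circ_sub cC XI); rewrite CX.
Qed.

Lemma circ_neq0 C : circ C -> C != set0.
Proof. by move/circ_dep; apply: contraNneq => ->; apply: indep0. Qed.

Definition rk X := \max_(I in indep M | I \subset X) #|I|.
Definition nul X := #|X| - rk X.

Lemma rk_max I X : I \in indep M -> I \subset X -> #|I| <= rk X.
Proof. by move=> II IX; apply: (bigmax_sup I); rewrite ?II. Qed.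

Lemma rk_ex X : exists I, [/\ I \in indep M, I \subset X & #|I| = rk X].
Proof.
have h : (set0 \in indep M) && (set0 \subset X) by rewrite indep0 sub0set.
have [|I /andP[II IX] E] := @eq_bigmax_cond _ (fun I => (I \in indep M) && (I \subset X)) (fun I : {set T} => #|I|).
  by apply/card_gt0P; exists set0; rewrite unfold_in /= h.
by exists I; split.
Qed.

Lemma rk_card X : rk X <= #|X|.
Proof. by have [I [_ IX <-]] := rk_ex X; apply: subset_leq_card. Qed.

Lemma rkS X Y : X \subset Y -> rk X <= rk Y.
Proof.
by move=> XY; have [I [II IX <-]] := rk_ex X; apply: rk_max (subset_trans IX XY).
Qed.

Lemma nul0P X : (nul X == 0) = (X \in indep M).
Proof.
rewrite subn_eq0; apply/idP/idP => [le|XI]; last exact: rk_max.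
have [I [II IX E]] := rk_ex X.
suff <- : I = X by [].
by apply/eqP; rewrite eqEcard IX E.
Qed.

(** [C :\ x] extends to a largest independent subset of [X]; that set cannot contain [x], for it
    would then contain [C]. *)
Lemma rkD1_circ C X x : circ C -> C \subset X -> x \in C -> rk X = rk (X :\ x).
Proof.
move=> cC CX xC; apply/eqP; rewrite eqn_leq; apply/andP; split; last exact/rkS/subD1set.
have [I [II IX cI]] := rk_ex X.
have CxI := circ_D1 cC xC.
have le : #|C :\ x| <= #|I|.
  by rewrite cI rk_max // (subset_trans (subD1set _ _) CX).
have [Z [ZI CZ ZCI cZ]] := indep_extend CxI II le.
have xZ : x \notin Z.
  by apply: contraNN (circ_sub cC ZI) => xZ; rewrite -(setD1K xC) subUset sub1set xZ CZ.
by rewrite -cI -cZ; apply: rk_max => //; set_solve.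
Qed.

Lemma nulD1_circ C X x : circ C -> C \subset X -> x \in C ->
  nul X = (nul (X :\ x)).+1.
Proof.
move=> cC CX xC; have xX := subsetP CX x xC.
rewrite /nul (rkD1_circ cC CX xC) (cardsD1 x X) xX add1n subSn //.
exact: rk_card.
Qed.

(** An element on no circuit of [X] can be added to any independent subset of [X :\ x], so rank and
    size drop together. *)
Lemma nulD1_nocirc X x : x \in X ->
  (forall C, circ C -> C \subset X -> x \notin C) -> nul X = nul (X :\ x).
Proof.
move=> xX noC; rewrite /nul (cardsD1 x X) xX add1n.
suff -> : rk X = (rk (X :\ x)).+1 by rewrite subSS.
apply/eqP; rewrite eqn_leq; apply/andP; split.
  have [I [II IX <-]] := rk_ex X.
  rewrite (cardsD1 x I); apply: (@leq_trans (#|I :\ x|.+1)).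
    by rewrite -add1n leq_add2r; case: (x \in I).
  by rewrite ltnS rk_max ?setSD // (indepS II) // subD1set.
have [I [II IX <-]] := rk_ex (X :\ x).
have xI : x \notin I by apply/negP => /(subsetP IX); rewrite !inE eqxx.
have <- : #|x |: I| = #|I|.+1 by rewrite cardsU1 xI.
apply: rk_max; last by rewrite subUset sub1set xX (subset_trans IX (subD1set _ _)).
apply/negPn/indepPn => -[C cC CxI].
have xC : x \in C.
  apply/negPn/negP => xC; move/negP: (circ_sub cC II); apply.
  set_solve.
apply: (negP (noC C cC _) xC); apply: (subset_trans CxI).
by rewrite subUset sub1set xX (subset_trans IX (subD1set _ _)).
Qed.

Lemma nulS X Y : X \subset Y -> nul X <= nul Y.
Proof.
move E : #|Y :\: X| => n; elim: n Y E => [|n IHn] Y E XY.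
  move/eqP: E; rewrite cards_eq0 setD_eq0 => YX.
  by suff -> : X = Y by []; apply/eqP; rewrite eqEsubset XY.
have /set0Pn[y] : Y :\: X != set0 by rewrite -cards_eq0 E.
rewrite inE => /andP[yX yY].
have : nul X <= nul (Y :\ y).
  apply: IHn; last by rewrite subsetD1 XY.
  have -> : Y :\ y :\: X = (Y :\: X) :\ y by set_solve.
  by move: E; rewrite (cardsD1 y) inE yX yY => -[].
move=> h; apply: leq_trans h _.
have [noC|] := boolP [forall C : {set T}, (circ C && (C \subset Y)) ==> (y \notin C)].
  rewrite (@nulD1_nocirc Y y) // => C cC CY.
  by move/forallP/(_ C): noC; rewrite cC CY.
case/forallPn => C; rewrite negb_imply negbK => /andP[/andP[cC CY] yC].
by rewrite (nulD1_circ cC CY yC).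
Qed.

Lemma nul_circ C : circ C -> nul C = 1.
Proof.
move=> cC; have /set0Pn[x xC] := circ_neq0 cC.
rewrite (nulD1_circ cC (subxx _) xC); congr _.+1.
by apply/eqP; rewrite nul0P circ_D1.
Qed.

Lemma nulD1_lt X x : nul (X :\ x) < nul X ->
  exists C, [/\ circ C, C \subset X & x \in C].
Proof.
move=> lt; have [xX|xX] := boolP (x \in X); last first.
  by move: lt; have -> : X :\ x = X by [apply/setP => z; rewrite !inE; case: eqP => [->|]; rewrite ?(negbTE xX)];
    rewrite ltnn.
have [noC|] := boolP [forall C : {set T}, (circ C && (C \subset X)) ==> (x \notin C)].
  move: lt; rewrite (@nulD1_nocirc X x) ?ltnn // => C cC CY.
  by move/forallP/(_ C): noC; rewrite cC CY.
case/forallPn => C; rewrite negb_imply negbK => /andP[/andP[cC CY] yC].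
by exists C.
Qed.

(** Strong elimination by counting. Deleting [x] or [e] from the union lowers the nullity by one,
    and deleting both lowers it by two, because [C'] survives the loss of [e] and passes through
    [x]. So [e] still lies on a circuit once [x] is gone. *)
Lemma circ_elim C C' x e : circ C -> circ C' -> x \in C -> x \in C' ->
  e \in C -> e \notin C' ->
  exists C3, [/\ circ C3, e \in C3 & C3 \subset (C :|: C') :\ x].
Proof.
move=> cC cC' xC xC' eC eC'; set U := C :|: C'.
have h1 := nulD1_circ cC (subsetUl C C') eC.
have C'U : C' \subset U :\ e by rewrite subsetD1 subsetUr.
have h2 := nulD1_circ cC' C'U xC'.
have h3 := nulD1_circ cC (subsetUl C C') xC.
have [|C3 [c3 s3 e3]] := @nulD1_lt (U :\ x) e; last by exists C3.
move: h1; rewrite h3 h2 => -[->]; rewrite ltnS.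
by apply: nulS; set_solve.
Qed.

Lemma circ_diff C C' : circ C -> circ C' -> C != C' -> exists2 e, e \in C & e \notin C'.
Proof.
by move=> cC cC' ne; apply/subsetPn; apply: contra_neqN ne; apply: circ_inj.
Qed.

Lemma circ_elim_weak C C' x : circ C -> circ C' -> C != C' -> x \in C -> x \in C' ->
  exists2 C3, circ C3 & C3 \subset (C :|: C') :\ x.
Proof.
move=> cC cC' ne xC xC'; have [e eC eC'] := circ_diff cC cC' ne.
by have [C3 [c3 _ s3]] := circ_elim cC cC' xC xC' eC eC'; exists C3.
Qed.

Lemma nul_ge2 C C' X : circ C -> circ C' -> C != C' -> C \subset X -> C' \subset X ->
  2 <= nul X.
Proof.
move=> cC cC' ne CX C'X; have [e eC eC'] := circ_diff cC cC' ne.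
rewrite (nulD1_circ cC CX eC) ltnS -(nul_circ cC'); apply: nulS.
by rewrite subsetD1 C'X.
Qed.

Lemma nul1_uniq C C' X : circ C -> circ C' -> C \subset X -> C' \subset X ->
  nul X <= 1 -> C = C'.
Proof.
move=> cC cC' CX C'X n1; apply/eqP/negPn/negP => ne.
by have := leq_trans (nul_ge2 cC cC' ne CX C'X) n1.
Qed.

(** Deleting any [x] leaves nullity one, so exactly one circuit of [X] avoids [x]: the complements
    of the circuits cover [X] and are disjoint. They are the series classes of the restriction to
    [X]. *)
Lemma nul2_part X : nul X = 2 ->
  (forall x, x \in X -> exists C, [/\ circ C, x \in C & C \subset X]) ->
  exists P : {set {set T}}, partition P X /\
    forall C, C \subset X -> circ C = (X :\: C \in P).
Proof.
move=> n2 cov; pose P := [set X :\: C | C in [set C | circ C & C \subset X]].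
have inP C : C \subset X -> circ C = (X :\: C \in P).
  move=> CX; apply/idP/imsetP => [cC|[C']]; first by exists C; rewrite ?inE ?cC.
  rewrite inE => /andP[cC' C'X] E.
  suff -> : C = C' by [].
  by set_solve.
have nulx x : x \in X -> nul (X :\ x) = 1.
  by move=> /cov[C [cC xC CX]]; move: (nulD1_circ cC CX xC); rewrite n2 => -[].
exists P; split => //; apply/and3P; split.
- apply/eqP/setP => x; apply/bigcupP/idP => [[S /imsetP[C _ ->]]|xX].
    by rewrite inE => /andP[].
  have [|C cC CX] := @indepPn (X :\ x) _; first by rewrite -nul0P nulx.
  exists (X :\: C); last by rewrite inE xX andbT; apply/negP => /(subsetP CX); rewrite !inE eqxx.
  by rewrite -inP // (subset_trans CX) // subD1set.
- apply/trivIsetP => S S' /imsetP[C + ->] /imsetP[C' + ->].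
  rewrite !inE => /andP[cC CX] /andP[cC' C'X]; apply: contraR.
  rewrite -setI_eq0 => /set0Pn[x]; rewrite !inE => /andP[/andP[xC xX] /andP[xC' _]].
  have /eqP : nul (X :\ x) = 1 by apply: nulx.
  rewrite eqn_leq => /andP[le _].
  by rewrite (nul1_uniq cC cC' _ _ le) // subsetD1 ?CX ?C'X.
- apply/negP => /imsetP[C]; rewrite inE => /andP[cC CX] E.
  have XC : C = X by set_solve.
  by move: n2; rewrite -XC nul_circ.
Qed.

End Nullity.

(** * Non-binary matroids *)

Section Binary.
Import GRing.Theory.
Local Open Scope ring_scope.
Variables (T : finType) (M : matroid T).
Implicit Types (X Y C B : {set T}).

(** * Fundamental vectors over GF(2) *)

Section Representation.
(** The binary circuit property for meeting circuits whose union has nullity two, the situation that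
    arises in a basis exchange. *)
Hypothesis symdiff_circ : forall C C' x, circ M C -> circ M C' ->
  C :|: C' \subset ground M -> nul M (C :|: C') = 2%N -> x \in C -> x \in C' ->
  circ M ((C :|: C') :\: (C :&: C')).
Variable B : {set T}.
Hypothesis basisB : basis M B.

(** For a ground element [x] outside [B] the support is the fundamental circuit of [x] without [x].
    An [x] in [B] can only replace itself, which gives a unit vector. *)
Definition fundamental_vector (x : T) : 'rV['F_2]_#|T| :=
  \row_j ((enum_val j \in B) && basis M (x |: (B :\ enum_val j)))%:R.
Local Notation v := fundamental_vector.
Local Notation sumv C := (\sum_(z in C) v z).

Lemma fundamental_vector_basis b : b \in B -> v b = delta_mx 0 (enum_rank b).
Proof.
move=> bB; apply/rowP => j; rewrite !mxE /=.
have [->|ne] := eqVneq j (enum_rank b); first by rewrite enum_rankK bB setD1K ?basisB ?eqxx.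
have [jB|//] := boolP (enum_val j \in B); rewrite (_ : basis _ _ = false) //.
have bBj : b \in B :\ enum_val j.
  by rewrite !inE bB andbT; apply: contraNneq ne => ->; rewrite enum_valK eqxx.
rewrite (setUidPr _) ?sub1set //; apply/negP => /indep_le_basis/(_ (basis_indep basisB)).
by rewrite (cardsD1 (enum_val j) B) jB ltnn.
Qed.

Lemma nul_basis_add B' C y : basis M B' -> circ M C -> C :\: B' = [set y] ->
  nul M (y |: B') = 1%N.
Proof.
move=> bB' cC E.
have CB : C \subset y |: B'.
  apply/subsetP => z zC; have := congr1 (fun X : {set T} => z \in X) E.
  by rewrite !inE zC andbT => <-; rewrite orNb.
have yC : y \in C.
  by have := congr1 (fun X : {set T} => y \in X) E; rewrite !inE eqxx => /andP[].
have yB : y \notin B'.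
  by have := congr1 (fun X : {set T} => y \in X) E; rewrite !inE eqxx => /andP[].
rewrite (nulD1_circ cC CB yC) setU1K //; congr _.+1.
by apply/eqP; rewrite nul0P basis_indep.
Qed.

(** Coordinatewise: at an element [b] of [C] in [B] there is a 1 from [v b] and a 1 from [v y],
    since [y] can replace [b] in the basis; every other coordinate receives zeros. *)
Lemma sum_fundamental C y : circ M C -> C \subset ground M -> C :\: B = [set y] -> sumv C = 0.
Proof.
move=> cC CG E; have n1 := nul_basis_add basisB cC E.
have CB : C \subset y |: B.
  apply/subsetP => z zC; have := congr1 (fun X : {set T} => z \in X) E.
  by rewrite !inE zC andbT => <-; rewrite orNb.
have yC : y \in C.
  by have := congr1 (fun X : {set T} => y \in X) E; rewrite !inE eqxx => /andP[].
have yB : y \notin B.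
  by have := congr1 (fun X : {set T} => y \in X) E; rewrite !inE eqxx => /andP[].
have outy z : z \in C -> z != y -> z \in B.
  by move=> /(subsetP CB); rewrite !inE => /orP[->|].
rewrite (bigD1 y) //=; apply/rowP => j; rewrite mxE summxE mxE.
set b := enum_val j.
have eqz z : z \in C -> z != y -> v z 0 j = (z == b)%:R.
  move=> zC zy; rewrite fundamental_vector_basis ?outy // mxE eqxx /=.
  by congr ((_ : bool)%:R); rewrite /b -{1}(enum_valK j) (inj_eq enum_rank_inj) eq_sym.
rewrite (eq_bigr (fun z => (z == b)%:R)); last by move=> z /andP[]; apply: eqz.
rewrite mxE -/b; have [bB|bB] := boolP (b \in B); last first.
  rewrite add0r big1 // => z /andP[zC zy]; case: eqP => // E'.
  by move: bB; rewrite -E' outy.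
have [bC|bC] := boolP (b \in C); last first.
  rewrite (_ : basis M _ = false); last first.
    apply: contraNF (circ_dep cC) => /basis_indep/indepS; apply.
    clear E n1; set_solve.
  by rewrite add0r big1 // => z /andP[zC zy]; case: eqP => // E'; rewrite -E' zC in bC.
have by_ : b != y by apply: contraNneq yB => <-.
rewrite (bigD1 b) ?bC //= eqxx big1; last by move=> z /andP[_ /negbTE->].
rewrite (_ : basis M _ = true); first by apply/val_inj.
apply: (basis_card basisB); last by rewrite cardsU1 !inE (negbTE yB) andbF (cardsD1 b B) bB.
apply/negPn/indepPn => -[C' cC' C'B].
have C'yB : C' \subset y |: B.
  by apply: subset_trans C'B _; apply: setUS; apply: subD1set.
have := nul1_uniq cC cC' CB C'yB; rewrite n1 => /(_ isT) eqC.
by move/subsetP/(_ b): C'B; rewrite -eqC bC !inE eqxx (negbTE by_) => /(_ isT).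
Qed.

(** The vectors are those of the fixed [B]; a good [B'] is one whose fundamental circuits they
    respect. Exchanges carry this property from [B] to every basis. *)
Definition good_basis B' := basis M B' /\
  forall C y, circ M C -> C \subset ground M -> C :\: B' = [set y] -> sumv C = 0.

Lemma sum_symdiff C C' : sumv ((C :|: C') :\: (C :&: C')) = sumv C + sumv C'.
Proof.
have E : sumv C + sumv C' = sumv (C :&: C') + sumv (C :&: C') + (sumv (C :\: C') + sumv (C' :\: C)).
  by rewrite (@big_setID _ _ _ _ C C') (@big_setID _ _ _ _ C' C) /= [C' :&: C]setIC addrACA.
rewrite E -mulr2n -scaler_nat pchar_Fp_0 // scale0r add0r (@big_setID _ _ _ _ (_ :\: _) C) /=.
by congr (_ + _); apply: eq_bigl => z; rewrite !inE; case: (z \in C); case: (z \in C').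
Qed.

(** A fundamental circuit [C] of the new basis is already fundamental for [B'], unless it contains
    [x] and its outer element [y] is not [b]. In that case its union with the fundamental circuit
    [Cx] of [x] has nullity two, so the symmetric difference is a circuit; it is the fundamental
    circuit of [y] for [B'], and the three sums are linked by [sum_symdiff]. *)
Lemma good_exchange B' b x : good_basis B' -> b \in B' -> x \notin B' ->
  basis M (x |: B' :\ b) -> good_basis (x |: B' :\ b).
Proof.
move=> [bB' gB'] bB xB bB''; split=> // C y cC CG E.
have C0 : C \subset y |: (x |: B' :\ b).
  by apply/subsetP => z zC; have := congr1 (fun X : {set T} => z \in X) E; 
     rewrite !inE zC andbT => <-; rewrite orNb.
have /andP[yC yB] : (y \in C) && (y \notin x |: B' :\ b).
  by have := congr1 (fun X : {set T} => y \in X) E; rewrite !inE eqxx => /andP[-> ->].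
have xG : x \in ground M.
  by apply: (subsetP (indep_ground (basis_indep bB''))); rewrite !inE eqxx.
have [eyb|yb] := eqVneq y b.
  have CxB : C \subset x |: B' by move: eyb => ?; subst y; set_solve.
  apply: (gB' C x) => //; apply/setP => z; rewrite !inE.
  have xC : x \in C.
    apply/negPn/negP => xC; apply: (negP (circ_sub cC (basis_indep bB'))).
    set_solve.
  apply/andP/eqP => [[zB zC]|->//].
  by have := subsetP CxB _ zC; rewrite !inE (negbTE zB) orbF => /eqP.
have yx : y != x by apply: contraNneq yB => ->; rewrite !inE eqxx.
have yB' : y \notin B' by apply: contraNN yB => yB'; rewrite !inE yb yB' orbT.
have [xC|xC] := boolP (x \in C); last first.
  apply: (gB' C y) => //; apply/setP => z; rewrite !inE.
  apply/andP/eqP => [[zB zC]|->//].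
  have := subsetP C0 _ zC; rewrite !inE (negbTE zB) andbF orbF => /orP[/eqP//|/eqP zx].
  by rewrite -zx zC in xC.
have [Cx cCx CxB] : exists2 Cx, circ M Cx & Cx \subset x |: B'.
  apply/indepPn/negP => /(indep_le_basis bB').
  by rewrite cardsU1 xB ltnn.
have xCx : x \in Cx.
  apply/negPn/negP => xC'; apply: (negP (circ_sub cCx (basis_indep bB'))).
  set_solve.
have bCx : b \in Cx.
  apply/negPn/negP => bC'; apply: (negP (circ_sub cCx (basis_indep bB''))).
  set_solve.
have CxD : Cx :\: B' = [set x].
  apply/setP => z; rewrite !inE; apply/andP/eqP => [[zB zC]|->//].
  by have := subsetP CxB _ zC; rewrite !inE (negbTE zB) orbF => /eqP.
have bC : b \notin C.
  by apply/negP => /(subsetP C0); rewrite !inE eqxx /= orbF eq_sym (negbTE yb)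
     => /eqP bx; rewrite -bx bB in xB.
have yCx : y \notin Cx.
  by apply/negP => /(subsetP CxB); rewrite !inE (negbTE yB') (negbTE yx).
have CxG : Cx \subset ground M.
  by apply: subset_trans CxB _; rewrite subUset sub1set xG (indep_ground (basis_indep bB')).
have n2 : nul M (C :|: Cx) = 2%N.
  apply/eqP; rewrite eqn_leq; apply/andP; split; last first.
    apply: (nul_ge2 cC cCx) (subsetUl _ _) (subsetUr _ _).
    by apply: contraNneq yCx => <-.
  rewrite (nulD1_circ cC (subsetUl _ _) yC) ltnS -(nul_basis_add bB' cCx CxD).
  apply: nulS; clear CxD; set_solve.
have cS := symdiff_circ cC cCx _ n2 xC xCx.
have sS : (C :|: Cx) :\: (C :&: Cx) \subset y |: B'.
  by clear CxD; set_solve.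
have : sumv ((C :|: Cx) :\: (C :&: Cx)) = 0.
  apply: (gB' _ y).
  - by apply: cS; rewrite subUset CG.
  - by apply: subset_trans (subsetDl _ _) _; rewrite subUset CG.
  apply/setP => z; apply/setDP/set1P => [[/(subsetP sS)]|->].
    by rewrite !inE => /orP[/eqP//|->].
  by rewrite !inE yC (negbTE yCx).
by rewrite sum_symdiff (gB' Cx x) // addr0.
Qed.

Lemma all_good B' : basis M B' -> good_basis B'.
Proof.
move=> bB'.
suff : forall n B0, good_basis B0 -> #|B' :\: B0| = n -> good_basis B'.
  by move/(_ _ B (conj basisB sum_fundamental) erefl).
elim=> [|n IHn] B0 gB0 En.
  suff <- : B0 = B' by [].
  have bB0 := gB0.1; apply/esym/eqP; rewrite eqEcard -setD_eq0 -cards_eq0 En eqxx /=.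
  exact: indep_le_basis bB' (basis_indep bB0).
have bB0 := gB0.1.
have /set0Pn[x] : B' :\: B0 != set0 by rewrite -cards_eq0 En.
rewrite inE => /andP[xB0 xB'].
have [Cx cCx CxB] : exists2 Cx, circ M Cx & Cx \subset x |: B0.
  apply/indepPn/negP => /(indep_le_basis bB0).
  by rewrite cardsU1 xB0 ltnn.
have xCx : x \in Cx.
  apply/negPn/negP => xC'; apply: (negP (circ_sub cCx (basis_indep bB0))).
  set_solve.
have [b bC bB] := subsetPn (circ_sub cCx (basis_indep bB')).
have bx : b != x by apply: contraNneq bB => ->.
have bB_ : b \in B0 by have := subsetP CxB _ bC; rewrite !inE (negbTE bx).
have bB1 : basis M (x |: B0 :\ b).
  apply: (basis_card bB0); last by rewrite cardsU1 !inE (negbTE xB0) andbF (cardsD1 b B0) bB_.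
  apply/negPn/indepPn => -[C' cC' C'B].
  have C'yB : C' \subset x |: B0.
    by apply: subset_trans C'B _; apply: setUS; apply: subD1set.
  have n1 : nul M (x |: B0) = 1%N.
    apply: (nul_basis_add bB0 cCx); apply/setP => z; rewrite !inE.
    apply/andP/eqP => [[zB zC]|->//].
    by have := subsetP CxB _ zC; rewrite !inE (negbTE zB) orbF => /eqP.
  have := nul1_uniq cCx cC' CxB C'yB; rewrite n1 => /(_ isT) eqC.
  by move/subsetP/(_ b): C'B; rewrite -eqC bC !inE eqxx (negbTE bx) => /(_ isT).
apply: (IHn _ (good_exchange gB0 bB_ xB0 bB1)).
have -> : B' :\: (x |: B0 :\ b) = (B' :\: B0) :\ x.
  apply/setP => z; rewrite !inE.
  case: (z =P x) => [->|_]; first by rewrite ?andbF.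
  case: (z =P b) => [->|_] /=; last by [].
  by rewrite (negbTE bB) !andbF.
by move: En; rewrite (cardsD1 x) inE xB0 xB' => -[].
Qed.

(** Every circuit is fundamental for a basis that extends all but one of its elements. *)
Lemma sum_circ C : circ M C -> C \subset ground M -> sumv C = 0.
Proof.
move=> cC CG; have /set0Pn[c cC'] := circ_neq0 cC.
have [B' bB' CB'] := indep_sub_basis (circ_D1 cC cC').
apply: ((all_good bB').2 C c) => //; apply/setP => z; rewrite !inE.
apply/andP/eqP => [[zB zC]|->].
  by apply/eqP/negPn/negP => zc; rewrite (subsetP CB') // !inE zc zC in zB.
split=> //; apply/negP => cB; apply: (negP (circ_sub cC (basis_indep bB'))).
by rewrite -(setD1K cC') subUset sub1set cB.
Qed.

Lemma free_perm (s s' : seq T) : perm_eq s s' -> free (map v s) = free (map v s').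
Proof. by move=> p; apply: perm_free; apply: perm_map. Qed.

Lemma enum_setID X Y : Y \subset X -> perm_eq (enum Y ++ enum (X :\: Y)) (enum X).
Proof.
move=> YX; apply: uniq_perm; rewrite ?enum_uniq //.
  rewrite cat_uniq !enum_uniq andbT /=; apply/hasPn => z.
  by rewrite !mem_enum inE => /andP[].
move=> z; rewrite mem_cat !mem_enum inE.
by case: (boolP (z \in Y)) => //= /(subsetP YX) ->.
Qed.

Lemma enum_setD1 X x : x \in X -> perm_eq (x :: enum (X :\ x)) (enum X).
Proof.
move=> xX; apply: uniq_perm; rewrite /= ?enum_uniq ?mem_enum ?setD11 //.
by move=> z; rewrite !inE !mem_enum !inE; case: eqP => [->|].
Qed.

Lemma free_basis : free (map v (enum B)).
Proof.
have szB : size (map v (enum B)) = #|B| by rewrite size_map -cardE.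
pose t := Tuple (introT eqP szB); suff : free t by [].
apply/freeP => k E i; have := congr1 (fun r : 'rV_#|T| => r 0 (enum_rank (enum_val i))) E.
have nthE (j : 'I_#|B|) : t`_j = delta_mx 0 (enum_rank (enum_val j)).
  rewrite /= (nth_map (enum_val j)) -?cardE ?ltn_ord // -fundamental_vector_basis ?enum_valP //.
  by rewrite -enum_val_nth.
rewrite summxE mxE (bigD1 i) //= nthE !mxE !eqxx mulr1 big1 ?addr0 // => j ji.
rewrite nthE !mxE eqxx /= (inj_eq enum_rank_inj) (inj_eq enum_val_inj) eq_sym (negbTE ji).
by rewrite mulr0.
Qed.

(** By the relations of its fundamental circuits, the vectors of a basis [B'] containing [X] span
    the vectors of [B]. Those are free, and the two bases have the same size, so the vectors of [B']
    are free as well. *)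
Lemma free_indep X : X \in indep M -> free (map v (enum X)).
Proof.
move=> XI; have [B' bB' XB'] := indep_sub_basis XI.
suff : free (map v (enum B')).
  by rewrite -(free_perm (enum_setID XB')) map_cat => /catl_free.
have sub : (<<map v (enum B)>> <= <<map v (enum B')>>)%VS.
  apply/span_subvP => _ /mapP[b + ->]; rewrite mem_enum => bB.
  have [bB''|bB''] := boolP (b \in B'); first by rewrite memv_span // map_f // mem_enum.
  have [C cC CB] : exists2 C, circ M C & C \subset b |: B'.
    apply/indepPn/negP => /(indep_le_basis bB').
    by rewrite cardsU1 bB'' ltnn.
  have bC : b \in C.
    apply/negPn/negP => bC; apply: (negP (circ_sub cC (basis_indep bB'))).
    set_solve.
  have CG : C \subset ground M.
    apply: subset_trans CB _; rewrite subUset sub1set (indep_ground (basis_indep bB')).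
    by rewrite andbT; apply: (subsetP (indep_ground (basis_indep basisB))).
  have := sum_circ cC CG; rewrite (bigD1 b) //= => /eqP; rewrite addr_eq0 => /eqP->.
  rewrite memvN memv_suml // => z /andP[zC zb].
  rewrite memv_span // map_f // mem_enum.
  by have := subsetP CB _ zC; rewrite !inE (negbTE zb).
have szB (Y : {set T}) : size (map v (enum Y)) = #|Y| by rewrite size_map -cardE.
have eqBB : #|B'| = #|B|.
  apply/eqP; rewrite eqn_leq (indep_le_basis basisB) ?basis_indep //.
  by rewrite (indep_le_basis bB') ?basis_indep.
rewrite /free eqn_leq dim_span /= szB eqBB.
by have := dimvS sub; rewrite (eqP free_basis) szB.
Qed.

Lemma representable_fundamental : binary M.
Proof.
exists #|T|, v => X XG; apply/idP/idP; first exact: free_indep.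
apply: contraTT => /indepPn[C cC CX]; have /set0Pn[c cC'] := circ_neq0 cC.
rewrite -(free_perm (enum_setID CX)) map_cat; apply/negP => /catl_free.
rewrite -(free_perm (enum_setD1 cC')) free_cons => /andP[/negP+ _]; apply.
have := sum_circ cC (subset_trans CX XG); rewrite (bigD1 c) //= => /eqP.
rewrite addr_eq0 => /eqP->; rewrite memvN memv_suml // => z /andP[zC zb].
by rewrite memv_span // map_f // mem_enum !inE zb.
Qed.

End Representation.

(** Besides the complements of the two bad circuits [C] and [C'], all classes lie in [C :&: C']. If
    one class filled this intersection, its complement would be the symmetric difference, which
    would then be a circuit. *)
Lemma nonbinary_part : ~ binary M -> exists X (P : {set {set T}}),
  [/\ X \subset ground M, partition P X, (4 <= #|P|)%N &
   forall C, C \subset X -> circ M C = (X :\: C \in P)].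
Proof.
move=> nbin.
have [B basisB _] := indep_sub_basis (indep0 M).
pose bad C C' := [&& circ M C, circ M C', C :|: C' \subset ground M, nul M (C :|: C') == 2%N,
  C :&: C' != set0 & ~~ circ M ((C :|: C') :\: (C :&: C'))].
have [|/existsPn nobad] := boolP [exists C, exists C', bad C C']; last first.
  case: nbin; apply: (representable_fundamental _ basisB) => C C' x cC cC' G n2 xC xC'.
  apply/negPn/negP => nc; have /existsPn/(_ C')/negP := nobad C; apply.
  rewrite /bad cC cC' G n2 eqxx nc andbT /=.
  by apply/set0Pn; exists x; rewrite inE xC.
case/existsP => C /existsP[C' /and5P[cC cC' G /eqP n2 /andP[/set0Pn[x xI] nc]]].
have [|P [pP inP]] := nul2_part n2.
  move=> z; rewrite inE => /orP[] zC; [exists C | exists C'].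
    by rewrite subsetUl.
  by rewrite subsetUr.
exists (C :|: C'), P; split => //.
set X := C :|: C' in P inP pP G n2 nc *.
have CX : C \subset X by apply: subsetUl.
have C'X : C' \subset X by apply: subsetUr.
have SP : X :\: C \in P by rewrite -inP.
have S'P : X :\: C' \in P by rewrite -inP.
have [covP trivP P0] := and3P pP; rewrite -(eqP covP) in CX C'X.
move: xI; rewrite inE => /andP[xC xC'].
have xX : x \in cover P by rewrite (subsetP CX).
pose S := pblock P x; have SxP : S \in P by rewrite pblock_mem.
have xS : x \in S by rewrite mem_pblock.
have sub3 (Q : {set {set T}}) : Q \subset P -> (#|Q| <= #|P|)%N by apply: subset_leq_card.
have ne1 : X :\: C != X :\: C'.
  apply: contraNneq nc => E; have CC' : C = C'.
    by rewrite /X in E; clear -E; set_solve.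
  move: cC n2; rewrite /X -CC' setUid => /nul_circ -> //.
have [y yCC' yS] : exists2 y, y \in C :&: C' & y \notin S.
  apply/subsetPn; apply: contraNN nc => sub.
  rewrite inP ?subsetDl // (_ : _ :\: _ = S) //.
  have dis1 : [disjoint S & X :\: C].
    apply: (trivIsetP trivP) => //; apply: contraTneq xS => ->; by rewrite !inE xC.
  have dis2 : [disjoint S & X :\: C'].
    apply: (trivIsetP trivP) => //; apply: contraTneq xS => ->; by rewrite !inE xC'.
  have SX : S \subset X by rewrite -(eqP covP); apply: (bigcup_sup S).
  apply/setP => z; rewrite !inE.
  move: (subsetP sub z) (subsetP SX z) (disjointFr dis1 (x := z)) (disjointFr dis2 (x := z)).
  rewrite !inE; case: (z \in S); case: (z \in C); case: (z \in C') => //=.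
  - by move=> _ _ _ /(_ isT).
  - by move=> _ _ /(_ isT).
  - by move=> _ /(_ isT).
  - by move=> /(_ isT).
move: yCC'; rewrite inE => /andP[yC yC'].
have yX : y \in cover P by rewrite (subsetP CX).
have SyP : pblock P y \in P by rewrite pblock_mem.
have yS' : y \in pblock P y by rewrite mem_pblock.
pose Q := [set X :\: C; X :\: C'; S; pblock P y].
have -> : 4%N = #|Q|.
  have h (A D : {set T}) z : z \in A -> z \notin D -> (D == A) = false.
    by move=> zA; apply: contraNF => /eqP->.
  rewrite /Q -!setUA !cardsU1 !inE (negbTE ne1) cards1.
  rewrite (h S (X :\: C) x) ?(h S (X :\: C') x) ?inE ?xC ?xC' //.
  rewrite (h (pblock P y) (X :\: C) y) ?(h (pblock P y) (X :\: C') y) ?inE ?yC ?yC' //.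
  by rewrite (h (pblock P y) S y).
apply: sub3; rewrite /Q !subUset !sub1set SP S'P SxP SyP.
by [].
Qed.
End Binary.

(** * Series extensions of U_{2,n} and their ears *)

Section Covers.
Variable T : finType.
Implicit Types (A B X : {set T}) (P Q : {set {set T}}).

Lemma sub_cover P A : A \in P -> A \subset cover P.
Proof. by move=> AP; apply: (bigcup_sup A). Qed.

Lemma coverS P Q : Q \subset P -> cover Q \subset cover P.
Proof.
move=> QP; apply/subsetP => x /bigcupP[A AQ xA].
by apply/bigcupP; exists A => //; apply: (subsetP QP).
Qed.

Lemma cover_setU1 P A : cover (A |: P) = A :|: cover P.
Proof. by rewrite /cover bigcup_setU big_set1. Qed.

Lemma trivIset_in P A B x : trivIset P -> A \in P -> B \in P -> x \in A -> x \in B -> A = B.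
Proof.
by move=> tP AP BP xA xB; rewrite -(def_pblock tP AP xA) -(def_pblock tP BP xB).
Qed.

Lemma cover_setD1 P A : trivIset P -> A \in P -> cover (P :\ A) = cover P :\: A.
Proof.
move=> tP AP; apply/setP => x; rewrite inE; apply/bigcupP/andP.
  case=> B; rewrite !inE => /andP[ne BP] xB; split; last by apply/bigcupP; exists B.
  by apply: contraNN ne => xA; rewrite (trivIset_in tP AP BP xA xB).
case=> xA /bigcupP[B BP xB]; exists B => //; rewrite !inE BP andbT.
by apply: contraNneq xA => <-.
Qed.

Lemma mem_of_cover P Q A x : trivIset P -> Q \subset P -> A \in P -> x \in A -> x \in cover Q -> A \in Q.
Proof.
move=> tP QP AP xA /bigcupP[B BQ xB].
by rewrite (trivIset_in tP AP (subsetP QP _ BQ) xA xB).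
Qed.

Lemma sub_of_cover P Q Q' : trivIset P -> set0 \notin P -> Q \subset P -> Q' \subset P ->
  cover Q' \subset cover Q -> Q' \subset Q.
Proof.
move=> tP P0 QP Q'P sub; apply/subsetP => A AQ'.
have AP := subsetP Q'P _ AQ'.
have /set0Pn[x xA] : A != set0 by apply: contraNneq P0 => <-.
apply: (mem_of_cover tP QP AP xA); apply: (subsetP sub).
by apply/bigcupP; exists A.
Qed.

Lemma card_cover_ge P : trivIset P -> set0 \notin P -> #|P| <= #|cover P|.
Proof.
move=> /eqP <- P0; rewrite -sum1_card; apply: leq_sum => A AP.
by rewrite card_gt0; apply: contraNneq P0 => <-.
Qed.

Lemma card_setD1 (U : finType) (P : {set U}) (A : U) n : A \in P -> #|P| = n.+1 -> #|P :\ A| = n.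
Proof. by move=> AP; rewrite (cardsD1 A P) AP => -[]. Qed.

Lemma card_pick (U : finType) (P : {set U}) : 0 < #|P| -> exists A : U, A \in P.
Proof. by case/card_gt0P => A; exists A. Qed.

Lemma third_eq (U : finType) (Q : {set U}) (a b c d : U) : #|Q| = 3 ->
  a \in Q -> b \in Q -> c \in Q -> d \in Q -> a != b ->
  c != a -> c != b -> d != a -> d != b -> c = d.
Proof.
move=> Q3 aQ bQ cQ dQ ab ca cb da db.
have := card_setD1 (_ : b \in Q :\ a) (card_setD1 aQ Q3).
rewrite !inE eq_sym ab bQ => /(_ isT) /eqP/cards1P[z E].
have : c \in [set z] by rewrite -E !inE ca cb.
have : d \in [set z] by rewrite -E !inE da db.
by rewrite !inE => /eqP-> /eqP->.
Qed.

Lemma cards3 (U : finType) (a b c : U) : a != b -> a != c -> b != c -> #|[set a; b; c]| = 3.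
Proof. by move=> ab ac bc; rewrite -setUA !cardsU1 cards1 !inE negb_or ab ac bc. Qed.

Lemma set3_eq (U : finType) (P : {set U}) (a b c : U) : #|P| = 3 -> a \in P -> b \in P -> c \in P ->
  a != b -> a != c -> b != c -> P = [set a; b; c].
Proof.
move=> P3 aP bP cP ab ac bc; apply/eqP.
by rewrite eq_sym eqEcard !subUset !sub1set aP bP cP P3 cards3.
Qed.

Lemma cover3 A B C : cover [set A; B; C] = A :|: B :|: C.
Proof. by rewrite -(setUA [set A]) !cover_setU1 /cover big_set1 setUA. Qed.

End Covers.

(** * Degree counting in a graph that is a cycle on each circuit *)

Section Core.
Variables (T : finType) (M : matroid T) (G : rel T).
Implicit Types (A B C D S X Z J : {set T}) (P Q : {set {set T}}).
Local Notation W := (ground M).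
Local Notation circ := (circ M).

Definition degree_in (v : T) A := \sum_(u in A) (G v u : nat).
Local Notation N := degree_in.

Definition circuit_complements X P :=
  partition P X /\ forall C, C \subset X -> circ C = (X :\: C \in P).

Hypothesis G_sym : symmetric G.
Hypothesis G_irr : irreflexive G.
Hypothesis G_deg : forall C v, circ C -> C \subset W -> 2 < #|C| -> v \in C -> N v C = 2.
Hypothesis G_conn : forall C B, circ C -> C \subset W -> 2 < #|C| -> B \subset C -> B != set0 ->
  (forall v u, v \in B -> u \in C -> G v u -> u \in B) -> B = C.
(** The form in which the theta condition enters: in an arc with at least two elements, no element
    is isolated. *)
Hypothesis G_arc : forall X P A v, X \subset W -> circuit_complements X P -> #|P| = 3 ->
  A \in P -> 1 < #|A| -> v \in A -> exists2 u, u \in A & G v u.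

Lemma degree_pos v A u : u \in A -> G v u -> 0 < N v A.
Proof. by move=> uA vu; rewrite /N (bigD1 u) //= vu. Qed.

Lemma degree_ex v A : 0 < N v A -> exists2 u, u \in A & G v u.
Proof.
rewrite lt0n sum_nat_eq0 => /forallPn[u]; rewrite negb_imply eqb0 negbK => /andP[uA vu].
by exists u.
Qed.

Lemma degree0 v A u : N v A = 0 -> u \in A -> ~~ G v u.
Proof. by move=> n0 uA; apply/negP => /(degree_pos uA); rewrite n0. Qed.

Lemma degree1 v A u w : N v A = 1 -> u \in A -> w \in A -> G v u -> G v w -> u = w.
Proof.
move=> n1 uA wA vu vw; apply/eqP/negPn/negP => ne.
move: n1; rewrite /N (bigD1 u) //= vu (bigD1 w) /=; last by rewrite wA eq_sym.
by rewrite vw.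
Qed.

Lemma degree_setD v A B : B \subset A -> N v A = N v B + N v (A :\: B).
Proof. by move=> BA; rewrite /N (@big_setID _ _ _ _ A B) (setIidPr BA). Qed.

Lemma degree_partition v P X : partition P X -> N v X = \sum_(A in P) N v A.
Proof. by move=> /and3P[/eqP <- tP _]; rewrite /N big_trivIset. Qed.

Definition matched P := forall A B v, A \in P -> B \in P -> v \in A ->
  N v B = (A != B).

Lemma partition_coverK P X : partition P X -> [/\ cover P = X, trivIset P & set0 \notin P].
Proof. by case/and3P => /eqP. Qed.

(** Let [v] lie in the part [S]. The complement of any other part [A] is a circuit through [v], so
    [N v X = N v A + 2], and [v] has the same number [c] of neighbours in all other parts. Summing
    over the parts gives [N v S + (#|P| - 2) * c = 2]. With at least four parts, either [c = 0], or
    [c = 1], [#|P| = 4] and [N v S = 0]. *)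
Lemma matched_quad X P : X \subset W -> circuit_complements X P -> 4 <= #|P| ->
  #|P| = 4 /\ matched P.
Proof.
move=> XW [pP inP] P4; have [cP tP P0] := partition_coverK pP.
have circA A : A \in P -> circ (X :\: A).
  move=> AP; rewrite inP ?subsetDl // setDDr setDv set0U.
  by rewrite (setIidPr _) // -cP sub_cover.
have cardA A : A \in P -> 2 < #|X :\: A|.
  move=> AP; rewrite -cP -cover_setD1 //.
  apply: leq_trans (card_cover_ge _ _).
  - by move: P4; rewrite (cardsD1 A) AP.
  - by apply: trivIsetS tP; apply: subD1set.
  - by rewrite !inE negb_and P0 orbT.
have inX A : A \in P -> A \subset X by rewrite -cP => /sub_cover.
have other S v A : S \in P -> v \in S -> A \in P -> A != S -> v \in X :\: A.
  move=> SP vS AP ne; rewrite inE (subsetP (inX _ SP)) // andbT.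
  by apply: contraNN ne => vA; rewrite (trivIset_in tP AP SP vA vS).
have degA S v A : S \in P -> v \in S -> A \in P -> A != S -> N v X = N v A + 2.
  move=> SP vS AP ne; rewrite (degree_setD v (inX _ AP)); congr (_ + _).
  apply: G_deg (circA _ AP) _ (cardA _ AP) (other _ _ _ SP vS AP ne).
  exact: subset_trans (subsetDl _ _) XW.
have count S v : S \in P -> v \in S -> N v X = N v S + (#|P|.-1) * (N v X - 2).
  move=> SP vS; rewrite {1}(degree_partition v pP) (bigD1 S) //=; congr (_ + _).
  rewrite (eq_bigr (fun=> N v X - 2)) => [|A /andP[AP ne]].
    rewrite sum_nat_const; congr (_ * _); rewrite (cardsD1 S P) SP /=.
    by apply: eq_card => A; rewrite !inE andbC.
  by rewrite (degA S v A) // addnK.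
have main S v : S \in P -> v \in S ->
    (N v X = 2 /\ N v S = 2) \/ [/\ #|P| = 4, N v X = 3 & N v S = 0].
  move=> SP vS; have := count _ _ SP vS.
  have [A AP] : exists A, A \in P :\ S.
    by apply: card_pick; move: P4; rewrite (cardsD1 S P) SP add1n; case: #|_|.
  move: AP; rewrite !inE => /andP[ne AP]; rewrite (degA S v A) // addnK.
  case: #|P| P4 => [|[|[|[|p]]]] // _ /=.
  case: (N v A) => [|c]; first by rewrite muln0 addn0 add0n => <-; left.
  rewrite !mulSn mulnS => E; right.
  have : N v S + (c + c + p + p * c) = 0 by apply/eqP; rewrite -(eqn_add2r (c + 3)) add0n; apply/eqP; clear -E; lia.
  by case: (N v S) => //=; case: c {E} => //=; case: p.
(* Excludes [c = 0]: the elements of [S] whose neighbours in [X] all lie in [S] would form a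
   nonempty set closed under adjacency in the circuit [X :\: A], hence all of it; but this circuit
   also contains a third part. *)
have no2 S v : S \in P -> v \in S -> N v X <> 2.
  move=> SP vS n2; pose Bs := [set x in S | N x X == 2].
  have [A AP] : exists A, A \in P :\ S.
    by apply: card_pick; move: P4; rewrite (cardsD1 S P) SP add1n; case: #|_|.
  move: AP; rewrite !inE => /andP[ne AP].
  have SXA : S \subset X :\: A.
    by apply/subsetP => x xS; apply: other xS _ _.
  have BsS : Bs \subset S by apply/subsetP => x; rewrite inE => /andP[].
  have E : Bs = X :\: A.
    apply: G_conn (circA _ AP) _ (cardA _ AP) _ _ _.
    - exact: subset_trans (subsetDl _ _) XW.
    - exact: subset_trans BsS SXA.
    - by apply/set0Pn; exists v; rewrite inE vS n2.
    move=> x u; rewrite inE => /andP[xS /eqP nx] uXA xu.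
    have nxS : N x (X :\: S) = 0.
      have := degree_setD x (inX _ SP).
      by case: (main _ _ SP xS) => [[-> ->]|[_]]; [move/eqP; rewrite -{1}[2]addn0 eqn_add2l eq_sym => /eqP | rewrite nx].
    have uX : u \in X by move: uXA; rewrite inE => /andP[].
    have uS : u \in S.
      by apply/negPn/negP => uS; have := degree0 nxS (_ : u \in _); rewrite inE uS uX xu => /(_ isT).
    rewrite inE uS; have := degree_pos xS (_ : G u x); rewrite G_sym xu => /(_ isT).
    by case: (main _ _ SP uS) => [[-> //]|[_ _ ->]].
  have [B BP] : exists B, B \in P :\ S :\ A.
    apply: card_pick; have -> : #|P :\ S :\ A| = #|P| - 2.
      by rewrite (cardsD1 S P) SP (cardsD1 A (P :\ S)) !inE ne AP !add1n subSS subn1.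
    by rewrite subn_gt0 (leq_trans _ P4).
  move: BP; rewrite !inE => /and3P[neA neS BP].
  have /set0Pn[y yB] : B != set0 by apply: contraNneq P0 => <-.
  have : y \in Bs by rewrite E (other _ _ _ BP yB AP) // eq_sym.
  by move=> /(subsetP BsS) yS; rewrite (trivIset_in tP BP SP yB yS) eqxx in neS.
have mainT S v : S \in P -> v \in S -> [/\ #|P| = 4, N v X = 3 & N v S = 0].
  by move=> SP vS; case: (main _ _ SP vS) => // -[] /(no2 _ _ SP vS).
split.
  have [S SP] := card_pick (leq_trans (isT : 0 < 4) P4).
  have /set0Pn[y yB] : S != set0 by apply: contraNneq P0 => <-.
  by have [] := mainT _ _ SP yB.
move=> A B v AP BP vA; have [_ nX nA] := mainT _ _ AP vA.
have [<-|ne] := eqVneq A B; first by rewrite nA.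
by move: (degA _ _ B AP vA BP); rewrite eq_sym nX => /(_ ne) /eqP; rewrite addnC eqSS eqSS => /eqP/esym ->.
Qed.

(** Both sizes count the edges between [A] and [B]. *)
Lemma matched_card P A B : matched P -> A \in P -> B \in P -> #|A| = #|B|.
Proof.
move=> mP AP BP; have [-> //|ne] := eqVneq A B.
have E (C D : {set T}) : C \in P -> D \in P -> C != D -> #|C| = \sum_(v in C) N v D.
  move=> CP DP nCD; rewrite -sum1_card; apply: eq_bigr => v vC.
  by rewrite (mP C D v) ?nCD.
rewrite (E A B) // (E B A) // ?(eq_sym B) // exchange_big /=.
by apply: eq_bigr => u _; apply: eq_bigr => v _; rewrite G_sym.
Qed.

(* The cyclic order of [C] visits the three parts of a matched partition
   periodically, so the colouring is determined by two consecutive elements. *)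
Lemma matched_unique C Q Q' : circ C -> C \subset W -> 2 < #|C| ->
  partition Q C -> partition Q' C -> #|Q| = 3 -> #|Q'| = 3 ->
  matched Q -> matched Q' -> Q = Q'.
Proof.
move=> cC CW C3 pQ pQ' Q3 Q'3 mQ mQ'.
have [cQ tQ Q0] := partition_coverK pQ; have [cQ' tQ' Q'0] := partition_coverK pQ'.
have inQ x : x \in C -> (pblock Q x \in Q) * (x \in pblock Q x).
  by move=> xC; rewrite pblock_mem ?mem_pblock ?cQ.
have inQ' x : x \in C -> (pblock Q' x \in Q') * (x \in pblock Q' x).
  by move=> xC; rewrite pblock_mem ?mem_pblock ?cQ'.
have subQ A : A \in Q -> A \subset C by rewrite -cQ => /sub_cover.
have adj (P : {set {set T}}) x y : partition P C -> matched P -> x \in C -> y \in C -> G x y ->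
    pblock P x != pblock P y.
  move=> /partition_coverK[cP tP _] mP xC yC xy.
  have : 0 < N x (pblock P y) by apply: degree_pos xy; rewrite mem_pblock cP.
  by rewrite (mP (pblock P x) (pblock P y) x) ?pblock_mem ?mem_pblock ?cP ?lt0b.
have adj2 (P : {set {set T}}) x y z : partition P C -> matched P -> x \in C -> y \in C -> z \in C ->
    G y x -> G y z -> x != z -> pblock P x != pblock P z.
  move=> pP mP xC yC zC yx yz ne; apply/eqP => E.
  have [cP tP _] := partition_coverK pP.
  have := adj P y x pP mP yC xC yx => nyx.
  have n1 : N y (pblock P x) = 1 by rewrite (mP (pblock P y) (pblock P x) y) ?pblock_mem ?mem_pblock ?cP ?nyx.
  by have := degree1 n1 (_ : x \in _) (_ : z \in _) yx yz;
    rewrite E mem_pblock cP zC -E mem_pblock cP xC => /(_ isT isT) /eqP; rewrite (negbTE ne).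
have nb2 x : x \in C -> exists u w, [/\ u \in C, w \in C, G x u, G x w & u != w].
  move=> xC; have := G_deg cC CW C3 xC.
  case: (degree_ex (_ : 0 < N x C)) => [|u uC xu nx]; first by rewrite (G_deg cC CW C3 xC).
  case: (degree_ex (_ : 0 < N x (C :\ u))) => [|w].
    by move: nx; rewrite (@degree_setD x C [set u]) ?sub1set // {1}/N big_set1 xu add1n => -[->].
  rewrite !inE => /andP[wu wC] xw; exists u, w; split => //; by rewrite eq_sym.
have nbs x u w z : x \in C -> u \in C -> w \in C -> z \in C -> G x u -> G x w -> G x z -> u != w ->
    z = u \/ z = w.
  move=> xC uC wC zC xu xw xz uw.
  have [|zu] := eqVneq z u; [by left | right; apply/eqP/negPn/negP => zw].
  have := G_deg cC CW C3 xC; rewrite /N (bigD1 u) //= xu (bigD1 w) /=; last by rewrite wC eq_sym.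
  by rewrite xw (bigD1 z) /= ?zC ?zu // xz.
have [v vC] : exists v, v \in C by apply: card_pick; apply: leq_trans C3.
have [u0 [w0 [u0C w0C vu vw uw]]] := nb2 v vC.
(* The element [v] and its two neighbours in [C] lie in three different parts of [Q], and likewise
   of [Q']; [f] is the resulting bijection. *)
pose f A := if A == pblock Q v then pblock Q' v else
            if A == pblock Q u0 then pblock Q' u0 else pblock Q' w0.
have nvu := adj Q v u0 pQ mQ vC u0C vu; have nvw := adj Q v w0 pQ mQ vC w0C vw.
have nuw := adj2 Q u0 v w0 pQ mQ u0C vC w0C vu vw uw.
have nvu' := adj Q' v u0 pQ' mQ' vC u0C vu; have nvw' := adj Q' v w0 pQ' mQ' vC w0C vw.
have nuw' := adj2 Q' u0 v w0 pQ' mQ' u0C vC w0C vu vw uw.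
have fv : f (pblock Q v) = pblock Q' v by rewrite /f eqxx.
have fu : f (pblock Q u0) = pblock Q' u0 by rewrite /f eq_sym (negbTE nvu) eqxx.
have fw : f (pblock Q w0) = pblock Q' w0.
  by rewrite /f eq_sym (negbTE nvw) eq_sym (negbTE nuw).
have Qcase A : A \in Q -> [\/ A = pblock Q v, A = pblock Q u0 | A = pblock Q w0].
  move=> AQ; have [|n1] := eqVneq A (pblock Q v); first by constructor 1.
  have [|n2] := eqVneq A (pblock Q u0); first by constructor 2.
  constructor 3; apply: (third_eq Q3 (inQ v vC).1 (inQ u0 u0C).1 AQ (inQ w0 w0C).1 nvu n1 n2).
    by rewrite eq_sym.
  by rewrite eq_sym.
have finj A B : A \in Q -> B \in Q -> A != B -> f A != f B.
  have s := eq_sym.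
  by move=> /Qcase[]-> /Qcase[]->; rewrite ?fv ?fu ?fw ?eqxx // => _; rewrite // eq_sym.
have fQ' A : A \in Q -> f A \in Q'.
  by move=> /Qcase[]->; rewrite ?fv ?fu ?fw; apply: (inQ' _ _).1.
pose good x := f (pblock Q x) == pblock Q' x.
(* If two consecutive elements are good, so is the next one, since three consecutive elements lie in
   three different parts. Asking for good neighbours as well makes [Bs] closed under adjacency. *)
pose Bs := [set x in C | good x && [forall y in C, G x y ==> good y]].
have step x y z : x \in C -> y \in C -> z \in C -> good x -> good y -> G y x -> G y z -> good z.
  move=> xC yC zC gx gy yx yz; have [<- //|xz] := eqVneq x z.
  have xy : G x y by rewrite G_sym.
  have zy : G z y by rewrite G_sym.
  apply/eqP; apply: (third_eq Q'3 (fQ' _ (inQ x xC).1) (fQ' _ (inQ y yC).1)).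
  - exact: fQ' (inQ z zC).1.
  - exact: (inQ' z zC).1.
  - by apply: finj (inQ _ _).1 (inQ _ _).1 _ => //; apply: adj xy.
  - by apply: finj (inQ _ _).1 (inQ _ _).1 _ => //; rewrite eq_sym; apply: (adj2 Q x y z).
  - by apply: finj (inQ _ _).1 (inQ _ _).1 _ => //; apply: adj zy.
  - by rewrite (eqP gx) eq_sym; apply: (adj2 Q' x y z).
  - by rewrite (eqP gy); apply: adj zy.
have BC : Bs = C.
  apply: (G_conn cC CW C3).
  - by apply/subsetP => x; rewrite inE => /andP[].
  - apply/set0Pn; exists v; rewrite inE vC /good fv eqxx /=.
    apply/forall_inP => y yC; apply/implyP => vy.
    by case: (nbs v u0 w0 y) => // ->; rewrite /good ?fu ?fw.
  move=> x y; rewrite inE => /and3P[xC gx /forall_inP h] yC xy.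
  have gy : good y by move/implyP: (h y yC); apply.
  rewrite inE yC gy /=; apply/forall_inP => z zC; apply/implyP => yz.
  by apply: (step x y z) => //; rewrite G_sym.
have fE A : A \in Q -> f A = A.
  move=> AQ; apply/setP => x; apply/idP/idP => xA.
    have xC : x \in C by rewrite -cQ'; apply: (subsetP (sub_cover (fQ' _ AQ))).
    have : x \in Bs by rewrite BC.
    rewrite inE => /and3P[_ /eqP gx _].
    have E : f (pblock Q x) = f A.
      by rewrite gx (def_pblock tQ' (fQ' _ AQ) xA).
    have [<-|ne] := eqVneq (pblock Q x) A; first exact: (inQ x xC).2.
    by move: (finj _ _ (inQ x xC).1 AQ ne); rewrite E eqxx.
  have xC : x \in C := subsetP (subQ _ AQ) _ xA.
  have : x \in Bs by rewrite BC.
  rewrite inE => /and3P[_ /eqP + _]; rewrite (def_pblock tQ AQ xA) => ->.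
  exact: (inQ' x xC).2.
apply/eqP; rewrite eqEcard Q3 Q'3 leqnn andbT; apply/subsetP => A AQ.
by rewrite -(fE A AQ) fQ'.
Qed.

(** Such a [D] is a circuit of the contraction [M / Z] that is not a circuit of [M], expressed
    through the circuits of [M]. *)
Definition ear Z D := [/\ D != set0, [disjoint D & Z], ~~ circ D,
  exists C, [/\ circ C, C \subset Z :|: D & ~~ (C \subset Z)] &
  forall C, circ C -> C \subset Z :|: D -> ~~ (C \subset Z) -> D \subset C].

Lemma ear_sub Z Z' D C : ear Z D -> Z' \subset Z -> circ C -> C \subset Z' :|: D ->
  ~~ (C \subset Z') -> ear Z' D.
Proof.
move=> [D0 dD nD _ min] Z'Z cC CZ' nC; split=> //.
- exact: disjointWr Z'Z dD.
- by exists C.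
move=> C' cC' C'Z nC'; apply: min => //; first exact: subset_trans C'Z (setSU _ Z'Z).
apply: contraNN nC' => C'Z'.
set_solve.
Qed.

(** Among the circuits through [e] inside [Z :|: C0], take one with the fewest elements outside [Z];
    these elements form [D]. A circuit missing a point of [D] would allow a smaller choice, directly
    or after an elimination that keeps [e]. If [D] were a circuit it would equal [C0], which meets
    [Z]. *)
Lemma ear_exists Z e z C0 : z \in Z -> e \notin Z -> circ C0 -> e \in C0 -> z \in C0 ->
  exists2 D, ear Z D & e \in D /\ D \subset C0.
Proof.
move=> zZ eZ cC0 eC0 zC0.
pose ok C := [&& circ C, e \in C & C \subset Z :|: C0].
have ok0 : ok C0 by rewrite /ok cC0 eC0 subsetUr.
case: (arg_minnP (fun C : {set T} => #|C :\: Z|) ok0) => C /and3P[cC eC CZ] Cmin.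
exists (C :\: Z); last by rewrite inE eZ eC; split=> //; set_solve.
split.
- by apply/set0Pn; exists e; rewrite inE eZ.
- by set_solve.
- apply/negP => cD.
  have E : C :\: Z = C0 by apply: (circ_inj cD cC0); set_solve.
  by move: zC0; rewrite -E inE zZ.
- exists C; split=> //; first by set_solve.
  by apply: contraNN eZ => /subsetP/(_ e eC).
move=> C' cC' C'Z nC'; apply/subsetP => y; rewrite inE => /andP[yZ yC].
apply/negPn/negP => yC'.
suff [C3 c3 [e3 s3]] : exists2 C3, circ C3 &
    e \in C3 /\ (C3 \subset Z :|: (C :\: Z)) && [exists y in C :\: Z, y \notin C3].
  case/andP: s3 => s3 /exists_inP[y' y'C y'3].
  have : ok C3 by rewrite /ok c3 e3 /=; set_solve.
  move/Cmin; rewrite leqNgt => /negP; apply; apply: proper_card.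
  apply/properP; split; first by set_solve.
  by exists y' => //; rewrite inE (negbTE y'3) andbF.
have [eC'|eC'] := boolP (e \in C').
  exists C' => //; split=> //; rewrite C'Z; apply/exists_inP; exists y => //.
  by rewrite inE yZ.
have [x xC' xZ] := subsetPn nC'.
have xC : x \in C by move: (subsetP C'Z x xC'); rewrite !inE (negbTE xZ).
have [C3 [c3 e3 s3]] := circ_elim cC cC' xC xC' eC eC'.
exists C3 => //; split=> //; apply/andP; split; first by set_solve.
apply/exists_inP; exists x; first by rewrite inE xZ.
by apply/negP => /(subsetP s3); rewrite !inE eqxx.
Qed.

(** Deleting one element of [D] destroys every circuit but [C], so the union has nullity two. A
    circuit [C'] through [D] is larger than [D], and an element of [C' :\: D] lies in a class other
    than [D] and the complement of [C']. *)
Lemma ear_circuit C D : circ C -> ear C D ->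
  exists P, [/\ circuit_complements (C :|: D) P, D \in P & 3 <= #|P|].
Proof.
move=> cC [D0 dD nD [C' [cC' C'Z nC']] min].
have DC' := min _ cC' C'Z nC'.
have [d dD'] := set0Pn _ D0.
have dC : d \notin C by rewrite (disjointFr dD dD').
have [c cC_] := set0Pn _ (circ_neq0 cC).
have n2 : nul M (C :|: D) = 2.
  rewrite (nulD1_circ cC' C'Z (subsetP DC' _ dD')).
  have CD : C \subset (C :|: D) :\ d by rewrite subsetD1 subsetUl.
  rewrite (nulD1_circ cC CD cC_); congr _.+2; apply/eqP; rewrite nul0P.
  apply/negPn/indepPn => -[C3 c3 s3].
  have nc : ~~ (C3 \subset C).
    apply/negP => /(circ_inj c3 cC) E; move: (subsetP s3 c).
    by rewrite E cC_ !inE eqxx => /(_ isT).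
  have := min _ c3 (subset_trans s3 (subset_trans (subD1set _ _) (subD1set _ _))) nc.
  by move=> /subsetP/(_ _ dD')/(subsetP s3); rewrite !inE eqxx andbF.
have [|P [pP inP]] := nul2_part n2.
  move=> x; rewrite inE => /orP[xC|xD]; [exists C | exists C'].
    by rewrite subsetUl.
  by rewrite (subsetP DC').
exists P; split => //.
  rewrite (_ : D = (C :|: D) :\: C) -?inP ?subsetUl //.
  by clear -dD; set_solve.
have [cP tP P0] := partition_coverK pP.
have DP : D \in P.
  rewrite (_ : D = (C :|: D) :\: C) -?inP ?subsetUl //.
  by clear -dD; set_solve.
have JP : (C :|: D) :\: C' \in P by rewrite -inP.
have [x] : exists x, x \in C' :\: D.
  apply/set0Pn; rewrite setD_eq0; apply: contraNN nD => C'D.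
  by rewrite (_ : D = C') //; apply/eqP; rewrite eqEsubset DC'.
rewrite inE => /andP[xD xC'].
have xX : x \in cover P by rewrite cP (subsetP C'Z).
have neDJ : D != (C :|: D) :\: C'.
  by apply/eqP => E; move: (dD'); rewrite {1}E inE (subsetP DC' _ dD').
have nex : pblock P x != D by apply: contraNneq xD => <-; rewrite mem_pblock.
have nex' : pblock P x != (C :|: D) :\: C'.
  apply: contraTneq xX => E; rewrite -mem_pblock E inE xC'. by [].
have <- : #|[set pblock P x; D; (C :|: D) :\: C']| = 3.
  by rewrite cards3.
apply: subset_leq_card; rewrite !subUset !sub1set DP JP pblock_mem //.
Qed.

(** Four or more classes are matched, and without [D] they form a matched partition of the circuit
    [C] into three parts; such a partition is unique. *)
Lemma ear_matched C D Q : circ C -> C \subset W -> D \subset W -> ear C D ->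
  2 < #|C| -> partition Q C -> #|Q| = 3 -> matched Q ->
  exists P, [/\ circuit_complements (C :|: D) P, D \in P & #|P| = 3 \/ P = D |: Q].
Proof.
move=> cC CW DW eD C3 pQ Q3 mQ; have [P [ccP DP P3]] := ear_circuit cC eD.
exists P; split => //; move: P3; rewrite leq_eqVlt => /orP[/eqP<-|P4]; [by left | right].
have XW : C :|: D \subset W by rewrite subUset CW.
have [P4' mP] := matched_quad XW ccP P4.
have [pP _] := ccP; have [cP tP P0] := partition_coverK pP.
have dD : [disjoint D & C] by case: eD.
rewrite -(setD1K DP); congr (_ |: _).
apply: (matched_unique cC CW C3) => //.
- apply/and3P; split.
  + by rewrite cover_setD1 // cP; apply/eqP; clear -dD; set_solve.
  + by apply: trivIsetS tP; apply: subD1set.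
  + by rewrite !inE negb_and P0 orbT.
- exact: card_setD1.
- by move=> A B v; rewrite !inE => /andP[_ AP] /andP[_ BP]; apply: mP.
Qed.

(* The restriction to [cover P] is a series extension of U_{2,n} with n = #|P| and
   series classes [P]. *)
Definition utype P := [/\ trivIset P, set0 \notin P, cover P \subset W &
  forall C, C \subset cover P ->
    circ C <-> exists Q, [/\ Q \subset P, #|Q| = 3 & C = cover Q]].

Lemma utype_sub P Q : utype P -> Q \subset P -> utype Q.
Proof.
move=> [tP P0 PW cP] QP; have cQP := coverS QP; split.
- exact: trivIsetS tP.
- by apply: contraNN P0; apply: (subsetP QP).
- exact: subset_trans cQP PW.
move=> C CQ; split=> [cC|[Q' [Q'Q Q'3 ->]]].
  have [Q' [Q'P Q'3 E]] := (cP C (subset_trans CQ cQP)).1 cC.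
  exists Q'; split => //; apply: (sub_of_cover tP) => //; by rewrite -E.
apply/cP; first by apply: coverS; apply: subset_trans QP.
by exists Q'; split => //; apply: subset_trans QP.
Qed.

Lemma utype_circ P Q : utype P -> Q \subset P -> #|Q| = 3 -> circ (cover Q).
Proof.
move=> [_ _ _ cP] QP Q3; apply/cP; first exact: coverS.
by exists Q.
Qed.

Lemma utype_circ3 P A B C : utype P -> A \in P -> B \in P -> C \in P ->
  A != B -> A != C -> B != C -> circ (A :|: B :|: C).
Proof.
move=> uP AP BP CP AB AC BC.
rewrite -cover3; apply: (utype_circ uP); last exact: cards3.
by rewrite !subUset !sub1set AP BP CP.
Qed.

Lemma utype_complements P : utype P -> #|P| = 4 -> circuit_complements (cover P) P.
Proof.
move=> uP P4; have [tP P0 PW cP] := uP; split; first by apply/and3P; split.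
move=> C CP; apply/idP/idP => [cC|CP'].
  have [Q [QP Q3 E]] := (cP C CP).1 cC.
  have [A AP AQ] : exists2 A, A \in P & A \notin Q.
    by apply/subsetPn/negP => /subset_leq_card; rewrite P4 Q3.
  have QA : Q = P :\ A.
    apply/eqP; rewrite eqEcard Q3 (card_setD1 AP P4) leqnn andbT.
    by rewrite subsetD1 QP.
  by rewrite E QA cover_setD1 // setDDr setDv set0U (setIidPr (sub_cover AP)).
have -> : C = cover (P :\ (cover P :\: C)).
  by rewrite cover_setD1 // setDDr setDv set0U (setIidPr CP).
apply: (utype_circ uP); [exact: subD1set | exact: card_setD1].
Qed.

Lemma card_between (U : finType) (X Y : {set U}) n : X \subset Y -> #|X| <= n -> n <= #|Y| ->
  exists Z : {set U}, [/\ X \subset Z, Z \subset Y & #|Z| = n].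
Proof.
move=> XY Xn nY; move E : (n - #|X|) => m; elim: m X E XY Xn => [|m IHm] X E XY Xn.
  by exists X; split => //; apply/eqP; rewrite eqn_leq Xn -subn_eq0 E.
have lt : #|X| < n by rewrite -subn_gt0 E.
have [y yY yX] : exists2 y, y \in Y & y \notin X.
  by apply/subsetPn/negP => /subset_leq_card; rewrite leqNgt (leq_trans lt nY).
have c : #|y |: X| = #|X|.+1 by rewrite cardsU1 yX.
case: (IHm (y |: X)) => [|||Z [XZ ZY Zn]].
- by rewrite c subnS E.
- by rewrite subUset sub1set yY.
- by rewrite c.
by exists Z; split => //; apply: subset_trans XZ; apply: subsetUr.
Qed.

(** Any two classes belong to a choice of four, to which [matched_quad] applies. *)
Lemma utype_matched P : utype P -> 4 <= #|P| -> matched P.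
Proof.
move=> uP P4 A B v AP BP vA.
have [|||Q [sQ QP Q4]] := @card_between _ [set A; B] P 4 => //.
- by rewrite subUset !sub1set AP.
- by rewrite cards2; case: (A != B).
have uQ := utype_sub uP QP; have QW : cover Q \subset W by case: uQ.
have [_ mQ] := matched_quad QW (utype_complements uQ Q4) (eq_leq (esym Q4)).
by apply: mQ => //; apply: (subsetP sQ); rewrite !inE eqxx ?orbT.
Qed.

Lemma card_cover3 P Q : trivIset P -> set0 \notin P -> Q \subset P -> #|Q| = 3 -> 2 < #|cover Q|.
Proof.
move=> tP P0 QP <-; apply: card_cover_ge; first exact: trivIsetS tP.
by apply: contraNN P0; apply: (subsetP QP).
Qed.

(** Decides whether [D] stays an ear when the class [S] is deleted. If no circuit through [D] avoids
    [S], a part of [S] has to join the ear. *)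
Definition attached P D S := exists C,
  [/\ circ C, D \subset C & C \subset cover (P :\ S) :|: D].

(** Eliminate an element of [D] between [C] and a circuit through [D] that avoids [S], keeping an
    element of [S] that lies in [C]. The result no longer contains [D], so it is a union of classes
    and contains all of [S]; these elements can only come from [C]. *)
Lemma attached_block P D S C : utype P -> ear (cover P) D -> S \in P -> attached P D S ->
  circ C -> D \subset C -> C \subset cover P :|: D -> (S \subset C) || [disjoint S & C].
Proof.
move=> [tP P0 PW cP] [D0 dD nD _ min] SP [C0 [cC0 DC0 C0P]] cC DC CP.
rewrite -implyNb; apply/implyP => /subsetPn[b' b'S b'C].
rewrite -setI_eq0; apply/negPn/negP => /set0Pn[b]; rewrite inE => /andP[bS bC].
rewrite cover_setD1 // in C0P.
have notC0 x : x \in S -> x \notin C0.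
  move=> xS; apply/negP => /(subsetP C0P); rewrite !inE xS /= => xD.
  by have := subsetP (sub_cover SP) _ xS; rewrite (disjointFr dD xD).
have [d dD'] := set0Pn _ D0.
have [C3 [c3 b3 s3]] := circ_elim cC cC0 (subsetP DC _ dD') (subsetP DC0 _ dD') bC (notC0 _ bS).
have C3P : C3 \subset cover P.
  apply/negPn/negP => h0.
  have : D \subset C3 by apply: min c3 _ h0; clear -s3 C0P CP cP P0; set_solve.
  by move=> /subsetP/(_ _ dD')/(subsetP s3); rewrite !inE eqxx.
have [Q [QP Q3 E]] := (cP _ C3P).1 c3.
rewrite E in b3; have SQ := mem_of_cover tP QP SP bS b3.
have : b' \in C3 by rewrite E (subsetP (sub_cover SQ)).
by move/(subsetP s3); rewrite !inE (negbTE b'C) (negbTE (notC0 _ b'S)) andbF.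
Qed.

Lemma attached_ear P D S : utype P -> S \in P -> ear (cover P) D -> attached P D S ->
  ear (cover (P :\ S)) D.
Proof.
move=> [tP P0 PW cP] SP eD [C [cC DC CP]].
apply: (ear_sub eD _ cC CP); first by apply: coverS; apply: subD1set.
have [D0 dD _ _ _] := eD; have [d dD'] := set0Pn _ D0.
apply/negP => /subsetP/(_ d (subsetP DC _ dD')).
by move=> /(subsetP (coverS (subD1set P S))); rewrite (disjointFr dD dD').
Qed.

(** [J] is a smallest trace on [S] of a circuit through [D] that misses a chosen [j] in [S].
    Minimality puts [J] into every relevant circuit, and the choice of [j] keeps [D :|: J] from
    being a circuit. *)
Lemma split_ear P D S : utype P -> 4 <= #|P| -> S \in P -> ear (cover P) D ->
  ~ attached P D S ->
  exists J, [/\ J \subset S, J != set0 & ear (cover (P :\ S)) (D :|: J)].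
Proof.
move=> uP P4 SP eD nat.
have [tP P0 PW cP] := uP; have [D0 dD nD [C1 [cC1 C1P nC1]] min] := eD.
have SZ := sub_cover SP.
have S0 : S != set0 by apply: contraNneq P0 => <-.
have [d dD'] := set0Pn _ D0.
have dZ : d \notin cover P by rewrite (disjointFr dD dD').
have DC1 := min _ cC1 C1P nC1.
have [A [B [AP BP AS BS AB]]] : exists A B, [/\ A \in P, B \in P, A != S, B != S & A != B].
  have [A] : exists A, A \in P :\ S.
    by apply: card_pick; move: P4; rewrite (cardsD1 S P) SP add1n; case: #|_|.
  rewrite !inE => /andP[AS AP].
  have [B] : exists B, B \in P :\ S :\ A.
    apply: card_pick; rewrite -ltnS -(_ : #|P :\ S| = #|P :\ S :\ A|.+1).
      by move: P4; rewrite (cardsD1 S P) SP add1n ltnS; case: #|_| => [|[|]].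
    by rewrite (cardsD1 A (P :\ S)) !inE AS AP.
  by rewrite !inE => /and3P[BA BS BP]; exists A, B; split=> //; rewrite eq_sym.
have cT : circ (S :|: A :|: B) by apply: (utype_circ3 uP) => //; rewrite eq_sym.
have TZ : S :|: A :|: B \subset cover P by rewrite !subUset SZ !sub_cover.
have SI : S \in indep M.
  have /set0Pn[b bB] : B != set0 by apply: contraNneq P0 => <-.
  have bS : b \notin S by apply: contraNN BS => bS; rewrite (trivIset_in tP BP SP bB bS).
  apply: (indepS (circ_D1 cT (_ : b \in _))); first by rewrite !inE bB orbT.
  by rewrite subsetD1 bS -setUA subsetUl.
(* Two such circuits would, after elimination of [d], leave a circuit inside the independent set
   [S]. So there is at most one, and if there is one, [j] is chosen on it. *)
have uniqDS C C' : circ C -> circ C' -> D \subset C -> D \subset C' -> C \subset D :|: S ->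
    C' \subset D :|: S -> C = C'.
  move=> cC cC' DC DC' CDS C'DS; apply/eqP/negPn/negP => ne.
  have [C3 c3 s3] := circ_elim_weak cC cC' ne (subsetP DC _ dD') (subsetP DC' _ dD').
  have : C3 \subset cover P.
    apply/negPn/negP => h0.
    have : D \subset C3 by apply: min c3 _ h0; clear -s3 CDS C'DS SZ; set_solve.
    by move=> /subsetP/(_ _ dD')/(subsetP s3); rewrite !inE eqxx.
  move=> C3P; apply: (negP (circ_sub c3 SI)).
  by set_solve.
have [j jS jP] : exists2 j, j \in S & forall C, circ C -> D \subset C -> C \subset D :|: S -> j \in C.
  have [|/existsPn noC] := boolP [exists C0 : {set T}, [&& circ C0, D \subset C0 & C0 \subset D :|: S]].
    case/existsP => C0 /and3P[cC0 DC0 C0S].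
    have [j] : exists j, j \in C0 :\: D.
      apply/set0Pn; rewrite setD_eq0; apply: contraNN nD => C'D.
      by rewrite (_ : D = C0) //; apply/eqP; rewrite eqEsubset DC0.
    rewrite inE => /andP[jD jC0]; exists j.
      by move: (subsetP C0S _ jC0); rewrite !inE (negbTE jD).
    by move=> C cC DC CS; rewrite (uniqDS C C0).
  have [j jS] := set0Pn _ S0; exists j => // C cC DC CS.
  by have := noC C; rewrite cC DC CS.
pose ok C := [&& circ C, D \subset C, C \subset cover P :|: D & j \notin C].
(* If [C1] uses [j], then [j] is eliminated against the circuit formed by [S] and two other classes,
   keeping [d]. *)
have [C0 okC0] : exists C, ok C.
  have [jC1|jC1] := boolP (j \in C1); last by exists C1; rewrite /ok cC1 DC1 C1P.
  have [||C3 [c3 d3 s3]] := circ_elim cC1 cT jC1 _ (subsetP DC1 _ dD').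
  - by rewrite !inE jS.
  - by apply: contraNN dZ; apply: (subsetP TZ).
  have s3' : C3 \subset cover P :|: D.
    apply: subset_trans s3 _; apply: subset_trans (subD1set _ _) _.
    by rewrite subUset C1P subsetU ?TZ.
  exists C3; rewrite /ok c3 s3' min //=; last by apply: contraNN dZ => /subsetP/(_ _ d3).
  by apply/negP => /(subsetP s3); rewrite !inE eqxx.
case: (arg_minnP (fun C : {set T} => #|C :&: S|) okC0) => C /and4P[cC DC CP jC] Cmin.
have dC : d \in C by apply: (subsetP DC).
have nCZ X : ~~ (C \subset cover (P :\ X)).
  apply/negP => /subsetP/(_ _ dC)/(subsetP (coverS (subD1set _ _))).
  by rewrite (negbTE dZ).
have jZS : j \notin cover (P :\ S) by rewrite cover_setD1 // inE jS.
have jD : j \notin D by rewrite (disjointFl dD) // (subsetP SZ).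
have CE : C \subset cover (P :\ S) :|: (D :|: C :&: S).
  by rewrite cover_setD1 //; clear -CP; set_solve.
exists (C :&: S); split; first exact: subsetIr.
  apply/negP => /eqP E; apply: nat; exists C; split=> //.
  by move: CE; rewrite E setU0.
split.
- by apply: contraNneq D0 => /eqP; rewrite setU_eq0 => /andP[/eqP-> _].
- by rewrite cover_setD1 //; clear -dD; set_solve.
- apply/negP => cDJ; have : j \in D :|: C :&: S.
    by apply: jP => //; [apply: subsetUl | apply: setUS; apply: subsetIr].
  by rewrite !inE (negbTE jD) (negbTE jC).
- by exists C; split.
move=> C2 cC2 C2P nC2.
have jC2 : j \notin C2.
  by apply/negP => /(subsetP C2P); rewrite !inE (negbTE jZS) (negbTE jD) (negbTE jC).
have C2P' : C2 \subset cover P :|: D.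
  apply: subset_trans C2P _; rewrite !subUset subsetUr.
  rewrite (subset_trans (coverS (subD1set _ _)) (subsetUl _ _)) /=.
  by apply: subset_trans (subsetIr _ _) _; apply: subset_trans SZ (subsetUl _ _).
have [C2Z|C2Z] := boolP (C2 \subset cover P).
  have [Q [QP Q3 E]] := (cP _ C2Z).1 cC2.
  have SQ : S \notin Q.
    by apply: contraNN jC2 => SQ; rewrite E (subsetP (sub_cover SQ)).
  by case/negP: nC2; rewrite E; apply: coverS; rewrite subsetD1 QP.
have DC2 := min _ cC2 C2P' C2Z.
have ok2 : ok C2 by rewrite /ok cC2 DC2 C2P'.
rewrite subUset DC2 /=.
have sub : C2 :&: S \subset C :&: S.
  apply/subsetP => x; rewrite inE => /andP[xC2 xS].
  move: (subsetP C2P x xC2); rewrite cover_setD1 // !inE xS /=.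
  by rewrite (disjointFl dD) ?(subsetP SZ) //= andbT.
have /eqP <- : C2 :&: S == C :&: S by rewrite eqEcard sub Cmin.
exact: subsetIl.
Qed.

(** * Degrees in thetas that have an ear as one arc *)

Lemma degree_partition3 v P X A B C : partition P X -> #|P| = 3 -> A \in P -> B \in P -> C \in P ->
  A != B -> A != C -> B != C -> N v X = N v A + N v B + N v C.
Proof.
move=> pP P3 AP BP CP AB AC BC.
rewrite (degree_partition v pP) (set3_eq P3 AP BP CP AB AC BC) -(setUA [set A] [set B]).
by rewrite !big_setU1 ?inE ?negb_or ?AB ?AC ?BC //= big_set1 addnA.
Qed.

Lemma complements_circ X P A : circuit_complements X P -> A \in P -> circ (X :\: A).
Proof.
move=> [pP inP] AP; rewrite inP ?subsetDl // setDDr setDv set0U.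
have [cP _ _] := partition_coverK pP.
by rewrite (setIidPr _) // -cP sub_cover.
Qed.

Lemma card_setU_disjoint (A B : {set T}) : [disjoint A & B] -> #|A :|: B| = #|A| + #|B|.
Proof. by move=> d; rewrite cardsU disjoint_setI0 // cards0 subn0. Qed.

Lemma pick3 (U : finType) (Q : {set U}) : #|Q| = 3 -> exists A B C : U,
  [/\ A \in Q, B \in Q, C \in Q, A != B & A != C /\ B != C].
Proof.
move=> Q3; have /card_pick[A AQ] : 0 < #|Q| by rewrite Q3.
have Q2 := card_setD1 AQ Q3.
have /card_pick[B BQ] : 0 < #|Q :\ A| by rewrite Q2.
have Q1 := card_setD1 BQ Q2.
have /card_pick[C CQ] : 0 < #|Q :\ A :\ B| by rewrite Q1.
move: BQ CQ; rewrite !inE => /andP[BA BQ] /and3P[CB CA CQ].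
by rewrite eq_sym in BA; rewrite eq_sym in CA; rewrite eq_sym in CB; exists A, B, C.
Qed.

(* In a theta with arcs [D], [A], [B], the equations N D + N A = N D + N B = 2 and
   N A + N B = 3 for the degrees of [v] contradict each other modulo 2. *)
Lemma no_theta C D P' v : circ C -> C \subset W -> D \subset W -> circuit_complements (C :|: D) P' ->
  D \in P' -> #|P'| = 3 -> [disjoint D & C] -> 1 < #|D| -> 1 < #|C| -> v \in D -> N v C = 3 -> False.
Proof.
move=> cC CW DW ccP DP P3 dD D2 C2 vD nC.
have [pP inP] := ccP; have [cP tP P0] := partition_coverK pP.
have /card_pick[A AP] : 0 < #|P' :\ D| by rewrite (card_setD1 DP P3).
have /card_pick[B BP] : 0 < #|P' :\ D :\ A| by rewrite (card_setD1 AP (card_setD1 DP P3)).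
move: AP BP; rewrite !inE => /andP[AD AP] /and3P[BA BD BP].
have sum := degree_partition3 v pP P3 DP AP BP.
rewrite eq_sym AD eq_sym BD eq_sym BA in sum; have {}sum := sum isT isT isT.
have DC : C = (C :|: D) :\: D by clear -dD; set_solve.
have vX : v \in C :|: D by rewrite inE vD orbT.
have deg E E' : E \in P' -> E' \in P' -> E != D -> E' != D -> E' != E -> N v ((C :|: D) :\: E) = 2.
  move=> EP EP' ED ED' EE; have vE : v \notin E.
    by apply: contraNN ED => vE; rewrite (trivIset_in tP EP DP vE vD).
  apply: (G_deg (complements_circ ccP EP)).
  - by apply: subset_trans (subsetDl _ _) _; rewrite subUset CW.
  - have : D :|: E' \subset (C :|: D) :\: E.
      rewrite -cP -cover_setD1 // subUset.
      by rewrite !sub_cover // !inE ?EE ?EP' // eq_sym ED.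
    move/subset_leq_card; apply: leq_trans.
    rewrite card_setU_disjoint; last by apply: (trivIsetP tP) => //; rewrite eq_sym.
    apply: (@leq_trans (#|D| + 1)); first by rewrite addn1 ltnS.
    by rewrite leq_add2l card_gt0; apply: contraNneq P0 => <-.
  - by rewrite inE vE.
have e1 := deg A B AP BP AD BD BA.
have e2 := deg B A BP AP BD AD; rewrite eq_sym BA in e2; have {}e2 := e2 isT.
have sA := degree_setD v (_ : A \subset C :|: D); rewrite e1 in sA.
have sB := degree_setD v (_ : B \subset C :|: D); rewrite e2 in sB.
have sD := degree_setD v (subsetUr C D); rewrite -DC nC in sD.
have {}sA : N v (C :|: D) = N v A + 2 by apply: sA; rewrite -cP sub_cover.
have {}sB : N v (C :|: D) = N v B + 2 by apply: sB; rewrite -cP sub_cover.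
clear -sum sA sB sD; lia.
Qed.

Lemma matched_degree3 P Q v : matched P -> trivIset P -> Q \subset P ->
  (exists2 S, S \in P & v \in S /\ S \notin Q) ->
  N v (cover Q) = #|Q|.
Proof.
move=> mP tP QP [S SP [vS SQ]].
have tQ := trivIsetS QP tP.
rewrite /N big_trivIset //= -sum1_card; apply: eq_bigr => A AQ.
have := mP S A v SP (subsetP QP _ AQ) vS; rewrite /N => ->.
by rewrite (_ : S != A) //; apply: contraNneq SQ => ->.
Qed.

Definition parallel_ear Z D := exists d z, [/\ D = [set d], z \in Z & circ [set d; z]].

(** The union is a theta with arcs [D], [C :\ s] and [[set s]], so [D :|: C :\ s] is a circuit and
    has degree two at [x]. *)
Lemma ear_point_degree C D s x : circ C -> C \subset W -> 2 < #|C| -> D \subset W -> ear C D ->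
  s \in C -> circ (s |: D) -> x \in D :|: C :\ s -> N x D + N x (C :\ s) = 2.
Proof.
move=> cC CW C3 DW eD sC cs xDC; have [D0 dD _ _ _] := eD.
have sD : s \notin D by rewrite (disjointFl dD sC).
have [P [[pP inP] DP _]] := ear_circuit cC eD.
have [cP tP P0] := partition_coverK pP.
have KP : C :\ s \in P.
  have -> : C :\ s = (C :|: D) :\: (s |: D) by clear -dD; set_solve.
  by rewrite -inP // subUset sub1set inE sC subsetUr.
have sP : pblock P s \in P by rewrite pblock_mem // cP inE sC.
have ss : s \in pblock P s by rewrite mem_pblock cP inE sC.
have cDC : circ (D :|: C :\ s).
  rewrite inP; last by rewrite subUset subsetUr subsetU // subD1set.
  have -> : (C :|: D) :\: (D :|: C :\ s) = pblock P s; last by [].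
  apply/eqP; rewrite eqEsubset; apply/andP; split.
    apply/subsetP => y; have [-> //|ne] := eqVneq y s.
    by rewrite !inE ne /= andbC orbC andbN.
  apply/subsetP => y ys; rewrite inE -cP (subsetP (sub_cover sP)) // andbT.
  rewrite inE negb_or; apply/andP; split.
    by apply: contraNN sD => yD; rewrite (trivIset_in tP DP sP yD ys).
  apply/negP => yC; have E := trivIset_in tP KP sP yC ys.
  by move: ss; rewrite -E !inE eqxx.
have dDC : [disjoint D & C :\ s] := disjointWr (subD1set _ _) dD.
rewrite /N -(G_deg cDC _ _ xDC).
- rewrite -/(N x (D :|: C :\ s)) (degree_setD x (subsetUl D _)).
  by have -> : (D :|: C :\ s) :\: D = C :\ s by clear -dD; set_solve.
- by rewrite subUset DW (subset_trans (subD1set _ _) CW).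
rewrite card_setU_disjoint //; move: C3; rewrite (cardsD1 s) sC ltnS => C2.
by apply: leq_ltn_trans C2 _; rewrite -{1}[#|C :\ s|]add0n ltn_add2r card_gt0.
Qed.

(** Suppose [D] has at least two elements, and take three classes other than that of [s]. In each of
    them [s] has a neighbour, which in turn has a neighbour in [D] that is again adjacent to [s]. No
    element of [D] can serve two classes, so [s] has three neighbours in [D], against degree two in
    the circuit [s |: D]. *)
Lemma ear_point P D s : utype P -> 4 <= #|P| -> D \subset W -> ear (cover P) D -> s \in cover P ->
  circ (s |: D) -> parallel_ear (cover P) D.
Proof.
move=> uP P4 DW eD sP cs; have [tP P0 PW cP] := uP; have mP := utype_matched uP P4.
have [D0 dD nD _ min] := eD; have [d0 d0D] := set0Pn _ D0.
have [D1|D2] := leqP #|D| 1.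
  have /eqP/cards1P[d ED] : #|D| = 1 by apply/eqP; rewrite eqn_leq D1 card_gt0.
  by exists d, s; split => //; rewrite -ED setUC.
exfalso; have sD : s \notin D by rewrite (disjointFl dD sP).
have csW : s |: D \subset W by rewrite subUset sub1set (subsetP PW).
have cs3 : 2 < #|s |: D| by rewrite cardsU1 sD.
have deg_s x : x \in s |: D -> G x s + N x D = 2.
  by move=> xsD; rewrite -(G_deg cs csW cs3 xsD) /N big_setU1.
pose S := pblock P s; have SP : S \in P by rewrite pblock_mem.
have sS : s \in S by rewrite mem_pblock.
have [|||Q [_ QPS Q3]] := @card_between _ set0 (P :\ S) 3; rewrite ?sub0set ?cards0 //.
  by move: P4; rewrite (cardsD1 S) SP.
have inQ A : A \in Q -> A \in P /\ S != A.
  by move=> /(subsetP QPS); rewrite !inE eq_sym => /andP[].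
have nbr A : A \in Q -> exists2 a, a \in A & G s a.
  move=> /inQ[AP AS]; apply: degree_ex.
  by rewrite (mP S A s SP AP sS) AS.
have outS A x : A \in Q -> x \in A -> x != s.
  move=> /inQ[AP AS] xA; apply: contraNneq AS => E; rewrite /S -E.
  by rewrite (def_pblock tP AP xA).
have theta A B : A \in Q -> B \in Q -> A != B -> exists C,
    [/\ circ C, C \subset W, 2 < #|C|, A :|: B \subset C :\ s & s \in C /\
      forall x, x \in D :|: C :\ s -> N x D + N x (C :\ s) = 2].
  move=> AQ BQ AB; have [[AP SA] [BP SB]] := (inQ _ AQ, inQ _ BQ).
  have SABP : [set S; A; B] \subset P by rewrite !subUset !sub1set SP AP.
  have [cC C3] := (utype_circ uP SABP (cards3 SA SB AB), card_cover3 tP P0 SABP (cards3 SA SB AB)).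
  have CZ := coverS SABP; have CE := cover3 S A B.
  set C := cover _ in cC C3 CZ CE; have CW := subset_trans CZ PW.
  have sC : s \in C by rewrite CE !inE sS.
  exists C; split => //.
    rewrite subsetD1 CE -setUA subsetUr !inE negb_or /=; apply/andP; split.
      by apply/negP => sA; have := outS _ _ AQ sA; rewrite eqxx.
    by apply/negP => sB; have := outS _ _ BQ sB; rewrite eqxx.
  split=> // x; apply: ear_point_degree => //; apply: (ear_sub eD CZ cs).
    by rewrite subUset sub1set inE sC subsetUr.
  apply/negP => /subsetP/(_ d0 (setU1r _ d0D)) d0C.
  by move: (subsetP CZ _ d0C); rewrite (disjointFr dD).
(* In [C] the element [a] has only one neighbour besides [s], so the circuit [D :|: C :\ s] gives it
   a neighbour [d] in [D]. If [d] were not adjacent to [s], the circuit [s |: D] would place two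
   neighbours of [d] in [D], leaving none in [C :\ s]. *)
have endD A a : A \in Q -> a \in A -> G s a -> exists2 d, d \in D & G d a /\ G s d.
  move=> AQ aA sa.
  have /card_pick[B] : 0 < #|Q :\ A| by rewrite (card_setD1 AQ Q3).
  rewrite !inE => /andP[BA BQ]; rewrite eq_sym in BA.
  have [C [cC CW C3 ABC [sC degC]]] := theta A B AQ BQ BA.
  have aC : a \in C :\ s by rewrite (subsetP ABC) // inE aA.
  have aC' : a \in C by move: aC; rewrite inE => /andP[].
  have nC := G_deg cC CW C3 aC'.
  rewrite (@degree_setD a C [set s]) ?sub1set // {1}/N big_set1 G_sym sa in nC.
  have nD1 : 0 < N a D.
    by have := degC a; rewrite inE aC orbT => /(_ isT); move: nC; rewrite add1n => -[->]; case: (N a D).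
  have [d dD' ad] := degree_ex nD1; exists d; rewrite // G_sym; split=> //.
  rewrite G_sym; apply/negPn/negP => nsd.
  have := deg_s d (setU1r _ dD'); rewrite (negbTE nsd) add0n => nd.
  have := degC d; rewrite inE dD' nd => /(_ isT) /eqP; rewrite -{2}[2]addn0 eqn_add2l => /eqP n0.
  by have := degree0 n0 aC; rewrite G_sym ad.
(* Next to [s], the element [d] has one neighbour in [D] and therefore one in [C :\ s], so [a] and
   [b] would coincide. *)
have clash A B a b d : A \in Q -> B \in Q -> A != B -> a \in A -> b \in B -> d \in D ->
    G d a -> G d b -> G s d -> False.
  move=> AQ BQ AB aA bB dD' da db sd.
  have [C [cC CW C3 ABC [sC degC]]] := theta A B AQ BQ AB.
  have := deg_s d (setU1r _ dD'); rewrite G_sym sd add1n => -[nd].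
  have := degC d; rewrite inE dD' nd add1n => /(_ isT) [n1].
  have E : a = b by apply: (degree1 n1 _ _ da db); rewrite (subsetP ABC) // inE ?aA ?bB ?orbT.
  have [[AP _] [BP _]] := (inQ _ AQ, inQ _ BQ).
  by move: AB; rewrite (trivIset_in tP AP BP aA) ?eqxx // E.
have [A1 [A2 [A3 [A1Q A2Q A3Q A12 [A13 A23]]]]] := pick3 Q3.
have [a1 a1A sa1] := nbr _ A1Q; have [a2 a2A sa2] := nbr _ A2Q; have [a3 a3A sa3] := nbr _ A3Q.
have [d1 d1D [da1 sd1]] := endD _ _ A1Q a1A sa1.
have [d2 d2D [da2 sd2]] := endD _ _ A2Q a2A sa2.
have [d3 d3D [da3 sd3]] := endD _ _ A3Q a3A sa3.
have ns2 : N s D = 2 by have := deg_s s (setU11 s D); rewrite G_irr.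
have [E|n12] := eqVneq d1 d2.
  by apply: (clash _ _ a1 a2 d1 A1Q A2Q A12) => //; rewrite E.
have [E|n13] := eqVneq d1 d3.
  by apply: (clash _ _ a1 a3 d1 A1Q A3Q A13) => //; rewrite E.
have [E|n23] := eqVneq d2 d3.
  by apply: (clash _ _ a2 a3 d2 A2Q A3Q A23) => //; rewrite E.
move: ns2; rewrite /N (bigD1 d1) //= sd1 (bigD1 d2) /=; last by rewrite d2D eq_sym.
by rewrite sd2 (bigD1 d3) /= ?d3D ?sd3 // eq_sym n13 eq_sym n23.
Qed.

Lemma pick_other (U : finType) (P R : {set U}) : #|R| < #|P| -> exists2 X : U, X \in P & X \notin R.
Proof. by move=> lt; apply/subsetPn/negP => /subset_leq_card; rewrite leqNgt lt. Qed.

(** Suppose [A2] and [A3] both have at least two elements, so that neither has an isolated element.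
    If [B1] and [B2] lie in the same arc, the other arc is contained in the third part [B3], which
    has no edges. If they lie in different arcs, every element of [B3] would lie in both. So one of
    the arcs is a single element [s]. *)
Lemma theta_single C D Q A2 A3 B1 B2 : circ C -> C \subset W -> D \subset W -> ear C D ->
  partition Q C -> #|Q| = 3 -> matched Q ->
  circuit_complements (C :|: D) [set D; A2; A3] -> #|[set D; A2; A3]| = 3 ->
  B1 \in Q -> B2 \in Q -> B1 != B2 ->
  (B1 \subset A2) || (B1 \subset A3) -> (B2 \subset A2) || (B2 \subset A3) ->
  exists2 s, s \in C & circ (s |: D).
Proof.
move=> cC CW DW eD pQ Q3 mQ ccP P3 B1Q B2Q B12 B1A B2A.
have [cQ tQ Q0] := partition_coverK pQ.
have XW : C :|: D \subset W by rewrite subUset CW.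
have dDC : [disjoint D & C] by case: eD.
wlog B1A2 : A2 A3 ccP P3 B1A B2A / B1 \subset A2.
  move=> wl; case/orP: (B1A) => h; first by apply: (wl A2 A3).
  apply: (wl A3 A2) => //; rewrite 1?orbC //.
    by rewrite -setUA (setUC [set A3]) setUA.
  by rewrite -setUA (setUC [set A3]) setUA.
have [pP inP] := ccP; have [cP tP P0] := partition_coverK pP.
have [DP A2P A3P] : [/\ D \in [set D; A2; A3], A2 \in [set D; A2; A3] & A3 \in [set D; A2; A3]].
  by rewrite !inE !eqxx !orbT.
have [DA2 DA3 A23] : [/\ D != A2, D != A3 & A2 != A3].
  move: P3; rewrite -setUA !cardsU1 cards1 !inE.
  by case: (D =P A2); case: (D =P A3); case: (A2 =P A3).
have CE : C = A2 :|: A3.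
  have := cover3 D A2 A3; rewrite cP => E.
  have d2 := trivIsetP tP D A2 DP A2P DA2; have d3 := trivIsetP tP D A3 DP A3P DA3.
  by clear -E dDC d2 d3; set_solve.
have d23 := trivIsetP tP A2 A3 A2P A3P A23.
have dD2 := trivIsetP tP D A2 DP A2P DA2; have dD3 := trivIsetP tP D A3 DP A3P DA3.
have c2 : circ (D :|: A2).
  have -> : D :|: A2 = (C :|: D) :\: A3 by rewrite CE; clear -d23 dD3; set_solve.
  exact: complements_circ ccP A3P.
have c3 : circ (D :|: A3).
  have -> : D :|: A3 = (C :|: D) :\: A2 by rewrite CE; clear -d23 dD2; set_solve.
  exact: complements_circ ccP A2P.
have ne0 A : A \in [set D; A2; A3] -> A != set0 by move=> AP; apply: contraNneq P0 => <-.
have single A : A \in [set D; A2; A3] -> A \subset C -> circ (D :|: A) -> #|A| <= 1 ->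
    exists2 s, s \in C & circ (s |: D).
  move=> AP AC cA A1; have /eqP/cards1P[s E] : #|A| = 1.
    by apply/eqP; rewrite eqn_leq A1 card_gt0 ne0.
  by exists s; [rewrite (subsetP AC) // E inE | rewrite setUC -E].
have A2C : A2 \subset C by rewrite CE subsetUl.
have A3C : A3 \subset C by rewrite CE subsetUr.
have [|A2_gt] := leqP #|A2| 1; first exact: single.
have [|A3_gt] := leqP #|A3| 1; first exact: single.
exfalso.
have [B3 B3Q] : exists2 B3, B3 \in Q & B3 \notin [set B1; B2].
  by apply: pick_other; rewrite Q3 cards2; case: (B1 != B2).
rewrite !inE negb_or => /andP[B31 B32].
have Qcase x : x \in C -> [\/ x \in B1, x \in B2 | x \in B3].
  rewrite -cQ => xC; have := third_eq Q3 B1Q B2Q (pblock_mem xC) B3Q B12.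
  have xx : x \in pblock Q x by rewrite mem_pblock.
  have [E|n1] := eqVneq (pblock Q x) B1; first by constructor 1; rewrite -E.
  have [E|n2] := eqVneq (pblock Q x) B2; first by constructor 2; rewrite -E.
  by move=> /(_ isT isT B31 B32) E; constructor 3; rewrite -E.
have own A x y : A \in Q -> x \in A -> y \in A -> G x y -> False.
  move=> AQ xA yA xy; have := degree_pos yA xy.
  by rewrite (mQ A A x) ?eqxx.
have [b3 b3B] : exists b, b \in B3.
  by apply/set0Pn; apply: contraNneq Q0 => <-.
have cross B B' x u : B \in Q -> B' \in Q -> B != B' -> x \in B -> N x B' = 1.
  by move=> BQ B'Q ne xB; rewrite (mQ B B' x) ?ne.
case/orP: B2A => B2A.
  have A3B3 : A3 \subset B3.
    apply/subsetP => x xA3; case: (Qcase x (subsetP A3C _ xA3)) => // xB.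
      by have := subsetP B1A2 _ xB; rewrite (disjointFl d23 xA3).
    by have := subsetP B2A _ xB; rewrite (disjointFl d23 xA3).
  have [x xA3] := set0Pn _ (ne0 _ A3P).
  have [u uA3 xu] := G_arc XW ccP P3 A3P A3_gt xA3.
  exact: own B3Q (subsetP A3B3 _ xA3) (subsetP A3B3 _ uA3) xu.
have b3C : b3 \in C by rewrite -cQ; apply: (subsetP (sub_cover B3Q)).
(* A neighbour [v] of [b3] in [B1] has a neighbour in the arc [A2]; it lies in [B3],
   where [b3] is the only neighbour of [v], so [b3] is in [A2].  Likewise for [A3]. *)
have inA B A : B \in Q -> B3 != B -> A \in [set D; A2; A3] -> 1 < #|A| -> B \subset A -> A \subset C ->
   (forall x, x \in A -> x \in B \/ x \in B3) -> b3 \in A.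
  move=> BQ nB AP A_gt BA AC Acase.
  have [|v vB b3v] := @degree_ex b3 B; first by rewrite (mQ B3 B b3) // nB.
  have [u uA vu] := G_arc XW ccP P3 AP A_gt (subsetP BA _ vB).
  case: (Acase u uA) => uB; first by case: (own B v u BQ vB uB vu).
  have n1 : N v B3 = 1 by rewrite (mQ B B3 v) // eq_sym nB.
  by rewrite (degree1 n1 b3B uB (_ : G v b3) vu) // G_sym.
have b3A2 : b3 \in A2.
  apply: (inA B1) => // x xA2; case: (Qcase x (subsetP A2C _ xA2)) => xB; [by left| |by right].
  by have := subsetP B2A _ xB; rewrite (disjointFr d23 xA2).
have b3A3 : b3 \in A3.
  apply: (inA B2) => // x xA3; case: (Qcase x (subsetP A3C _ xA3)) => xB; [|by left|by right].
  by have := subsetP B1A2 _ xB; rewrite (disjointFl d23 xA3).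
by rewrite (disjointFr d23 b3A2) in b3A3.
Qed.

(** Towards the classes of [P], the set [D] behaves as one more series class. *)
Definition extends P D := forall A B, A \in P -> B \in P -> A != B -> circ (A :|: B :|: D).

(** Induction on the number of classes. A class that is not attached yields a larger ear over the
    remaining classes, and that ear extends them; so at most one class is of this kind. Given [A]
    and [B], there is thus an attached class [X] different from both, and [D] is still an ear after
    its deletion. With four classes the deletion leaves one circuit, and thetas have to be excluded
    by degrees. *)
Lemma ear_alternative P D : utype P -> 4 <= #|P| -> D \subset W -> ear (cover P) D ->
  parallel_ear (cover P) D \/ extends P D.
Proof.
have [n] := ubnP #|P|; elim: n P D => // n IHn P D ltPn uP P4 DW eD.
have [tP P0 PW cP] := uP; have mP := utype_matched uP P4.
have [D0 dD nD _ min] := eD; have [d0 d0D] := set0Pn _ D0.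
have P2 S A : exists2 B, B \in P & (B != S) && (B != A).
  have [|B BP] := @pick_other _ P [set S; A].
    by rewrite cards2 (leq_trans _ P4) //; case: (_ != _).
  by rewrite !inE negb_or; exists B.
have P3 S A B : exists2 C, C \in P & [&& C != S, C != A & C != B].
  have [|C CP] := @pick_other _ P [set S; A; B].
    apply: leq_trans P4; rewrite -setUA cardsU1 cards2.
    by case: (_ \notin _); case: (_ != _).
  by rewrite !inE !negb_or -andbA; exists C.
have circ4 S : S \in P -> #|P| = 4 -> let C := cover (P :\ S) in
    [/\ circ C, C \subset W, 2 < #|C|, partition (P :\ S) C & [/\ #|P :\ S| = 3 & matched (P :\ S)]].
  move=> SP P4' /=; have sub := subD1set P S; have P3' := card_setD1 SP P4'.
  split.
  - exact: utype_circ uP sub P3'.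
  - exact: subset_trans (coverS sub) PW.
  - exact: card_cover3 tP P0 sub P3'.
  - apply/and3P; split => //; first exact: trivIsetS tP.
    by apply: contraNN P0; apply: (subsetP sub).
  - split=> // A B v; rewrite !inE => /andP[_ AP] /andP[_ BP]; exact: mP.
(* [D :|: J] has at least two elements, so it is not a parallel element. With four classes, a theta
   is impossible because [j] lies in the deleted class [S] and so has three neighbours in [C]. *)
have splitE S : S \in P -> ~ attached P D S ->
    exists2 J : {set T}, J \subset S & extends (P :\ S) (D :|: J).
  move=> SP nat; have [J [JS J0 eDJ]] := split_ear uP P4 SP eD nat.
  have [j jJ] := set0Pn _ J0.
  have SZ := sub_cover SP.
  have DJW : D :|: J \subset W.
    by rewrite subUset DW (subset_trans JS (subset_trans SZ PW)).
  have DJ2 : 1 < #|D :|: J|.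
    have jD : j \notin D by rewrite (disjointFl dD) // (subsetP SZ) // (subsetP JS).
    apply: leq_trans (_ : #|[set j; d0]| <= _).
      by rewrite cards2; case: eqP => // E; rewrite E d0D in jD.
    by apply: subset_leq_card; rewrite subUset !sub1set !inE jJ d0D orbT.
  exists J => //; move: P4; rewrite leq_eqVlt => /orP[/eqP/esym P4'|P5]; last first.
    have lt : #|P :\ S| < n by move: ltPn; rewrite (cardsD1 S P) SP.
    have P4' : 4 <= #|P :\ S| by move: P5; rewrite (cardsD1 S P) SP.
    case: (IHn _ _ lt (utype_sub uP (subD1set P S)) P4' DJW eDJ) => // -[d [z [E _ _]]].
    by move: DJ2; rewrite E cards1.
  have [cC CW C3 pQ [Q3 mQ]] := circ4 S SP P4'.
  set C := cover (P :\ S) in cC CW C3 pQ eDJ.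
  have [P' [ccP DJP []]] := ear_matched cC CW DJW eDJ C3 pQ Q3 mQ.
    move=> P'3; exfalso; have dDJ : [disjoint D :|: J & C] by case: eDJ.
    apply: (@no_theta C (D :|: J) P' j) => //.
    - exact: leq_trans C3.
    - by rewrite inE jJ orbT.
    rewrite (matched_degree3 mP tP (subD1set P S)) //; exists S => //.
    by split; [apply: (subsetP JS) | rewrite !inE eqxx].
  move=> EP' A B AP BP AB.
  have [X XP] : exists2 X, X \in P :\ S & X \notin [set A; B].
    by apply: pick_other; rewrite Q3 cards2; case: (_ != _).
  rewrite !inE negb_or => /andP[XA XB].
  have -> : A :|: B :|: (D :|: J) = (C :|: (D :|: J)) :\: X.
    have -> : C = A :|: B :|: X.
      by rewrite -cover3 /C (set3_eq Q3 AP BP XP) // eq_sym.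
    have [pP' _] := ccP; have [cP' tP' P'0] := partition_coverK pP'.
    have XP' : X \in P' by rewrite EP' inE XP orbT.
    have AP' : A \in P' by rewrite EP' inE AP orbT.
    have BP' : B \in P' by rewrite EP' inE BP orbT.
    have dA := trivIsetP tP' A X AP' XP'; rewrite eq_sym in dA; have {}dA := dA XA.
    have dB := trivIsetP tP' B X BP' XP'; rewrite eq_sym in dB; have {}dB := dB XB.
    have dX : [disjoint D :|: J & X].
      by apply: disjointWr (sub_cover XP) _; case: eDJ.
    by clear -dA dB dX; set_solve.
  by apply: complements_circ ccP _; rewrite EP' inE XP orbT.
(* Two classes different from [S] and [A] form a circuit with [D :|: J]; it contains [D] and avoids
   [A]. *)
have att_other S A : S \in P -> A \in P -> A != S -> ~ attached P D S -> attached P D A.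
  move=> SP AP AS nat; have [J JS ext] := splitE S SP nat.
  have [B BP /andP[BS BA]] := P2 S A.
  have [B' B'P /and3P[B'S B'A B'B]] := P3 S A B.
  exists (B :|: B' :|: (D :|: J)); split.
  - by apply: ext; rewrite ?inE ?BS ?B'S ?BP ?B'P // eq_sym.
  - exact: subset_trans (subsetUl D J) (subsetUr _ _).
  have cov Y : Y \in P -> Y != A -> Y \subset cover (P :\ A) :|: D.
    by move=> YP YA; apply: subset_trans (subsetUl _ _); apply: sub_cover; rewrite !inE YA.
  rewrite !subUset (cov B) // (cov B') // subsetUr /=.
  by apply: subset_trans JS (cov S _ _); rewrite // eq_sym.
have [par|npar] := boolP [exists d, exists z in cover P, (D == [set d]) && circ [set d; z]].
  left; case/existsP: par => d /exists_inP[z zP /andP[/eqP E cdz]].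
  by exists d, z.
right=> A B AP BP AB.
have nPar Z : Z \subset cover P -> ~ parallel_ear Z D.
  move=> ZP [d [z [E zZ cdz]]]; case/existsP: npar; exists d; apply/exists_inP.
  by exists z; rewrite ?(subsetP ZP) // E eqxx cdz.
have att_dec S : attached P D S \/ ~ attached P D S.
  have [h|h] := boolP [exists C : {set T}, [&& circ C, D \subset C & C \subset cover (P :\ S) :|: D]].
    by left; case/existsP: h => C /and3P[]; exists C.
  right=> -[C [h1 h2 h3]]; case/existsP: h; exists C; exact/and3P.
have [X [XP XA XB attX]] : exists X, [/\ X \in P, X != A, X != B & attached P D X].
  have [X1 X1P /andP[X1A X1B]] := P2 A B.
  have [X2 X2P /and3P[X2A X2B X21]] := P3 A B X1.
  case: (att_dec X1) => att; first by exists X1.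
  by exists X2; split => //; apply: att_other att.
have eDX := attached_ear uP XP eD attX.
have sub := subD1set P X; have cZ := coverS sub.
have [AX BX] : A \in P :\ X /\ B \in P :\ X by rewrite !inE AP BP ![_ == X]eq_sym XA XB.
move: (P4); rewrite leq_eqVlt => /orP[/eqP/esym P4'|P5]; last first.
  have lt : #|P :\ X| < n by move: ltPn; rewrite (cardsD1 X P) XP.
  have P4' : 4 <= #|P :\ X| by move: P5; rewrite (cardsD1 X P) XP.
  by case: (IHn _ _ lt (utype_sub uP sub) P4' DW eDX) => [/(nPar _ cZ)//|]; apply.
have [cC CW C3 pQ [Q3 mQ]] := circ4 X XP P4'.
set C := cover (P :\ X) in cC CW C3 pQ eDX cZ.
have [P' [ccP DP' []]] := ear_matched cC CW DW eDX C3 pQ Q3 mQ; last first.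
  move=> EP'.
  have [Y YP] : exists2 Y, Y \in P :\ X & Y \notin [set A; B].
    by apply: pick_other; rewrite Q3 cards2; case: (_ != _).
  rewrite !inE negb_or => /andP[YA YB].
  have -> : A :|: B :|: D = (C :|: D) :\: Y.
    have -> : C = A :|: B :|: Y.
      by rewrite -cover3 /C (set3_eq Q3 AX BX YP) // eq_sym.
    have YPP : Y \in P by apply: (subsetP sub).
    have dA := trivIsetP tP A Y AP YPP; rewrite eq_sym in dA; have {}dA := dA YA.
    have dB := trivIsetP tP B Y BP YPP; rewrite eq_sym in dB; have {}dB := dB YB.
    have dX := disjointWr (sub_cover YPP) dD.
    by clear -dA dB dX; set_solve.
  by apply: complements_circ ccP _; rewrite EP' inE YP orbT.
(* The theta case. At least two of the three remaining classes are attached, so each of them lies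
   within one arc; then some arc is a single element [s], and [ear_point] makes [D] parallel to an
   element, against [npar]. *)
move=> P'3; exfalso.
have [B1 [B2 [B1Q B2Q B12 [att1 att2]]]] : exists B1 B2,
    [/\ B1 \in P :\ X, B2 \in P :\ X, B1 != B2 & attached P D B1 /\ attached P D B2].
  have [B1 [B2 [B3 [B1Q B2Q B3Q B12 [B13 B23]]]]] := pick3 Q3.
  have [B1P B2P B3P] := And3 (subsetP sub _ B1Q) (subsetP sub _ B2Q) (subsetP sub _ B3Q).
  case: (att_dec B1) => [att1|nat]; last first.
    by exists B2, B3; split => //; split; apply: att_other nat => //; rewrite eq_sym.
  case: (att_dec B2) => [att2|nat]; first by exists B1, B2.
  by exists B1, B3; split => //; split => //; apply: att_other nat => //; rewrite eq_sym.
have [A2 A2P] : exists2 A2, A2 \in P' & A2 \notin [set D].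
  by apply: pick_other; rewrite P'3 cards1.
rewrite inE => A2D.
have [A3 A3P] : exists2 A3, A3 \in P' & A3 \notin [set D; A2].
  by apply: pick_other; rewrite P'3 cards2; case: (_ != _).
rewrite !inE negb_or => /andP[A3D A32].
have EP' : P' = [set D; A2; A3].
  by apply: (set3_eq P'3 DP' A2P A3P); rewrite eq_sym.
have [pP' _] := ccP; have [cP' tP' P'0] := partition_coverK pP'.
have dA2 := trivIsetP tP' D A2 DP' A2P; rewrite eq_sym in dA2; have {}dA2 := dA2 A2D.
have dA3 := trivIsetP tP' D A3 DP' A3P; rewrite eq_sym in dA3; have {}dA3 := dA3 A3D.
have dA23 := trivIsetP tP' A2 A3 A2P A3P; rewrite eq_sym in dA23; have {}dA23 := dA23 A32.
have dDC : [disjoint D & C] by case: eDX.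
have sideB S : S \in P :\ X -> attached P D S -> (S \subset A2) || (S \subset A3).
  move=> SQ attS; have SP := subsetP sub _ SQ.
  have c2 := complements_circ ccP A3P.
  have DC2 : D \subset (C :|: D) :\: A3.
    by clear -dA3; set_solve.
  have C2Z : (C :|: D) :\: A3 \subset cover P :|: D.
    by apply: subset_trans (subsetDl _ _) _; apply: setSU.
  have SC : S \subset C by apply: sub_cover.
  have coverE : cover P' = D :|: A2 :|: A3 by rewrite EP' cover3.
  rewrite cP' in coverE.
  case/orP: (attached_block uP eD SP attS c2 DC2 C2Z) => h; apply/orP; [left|right].
    by clear -h SC coverE dDC; set_solve.
  by clear -h SC coverE dDC; set_solve.
have [s sC cs] : exists2 s, s \in C & circ (s |: D).
  apply: (@theta_single C D (P :\ X) A2 A3 B1 B2) => //; rewrite -?EP' //.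
    exact: sideB.
  exact: sideB.
by apply: (nPar _ (subxx _)); apply: (ear_point uP P4 DW eD (subsetP cZ _ sC)).
Qed.

(** Each class is avoided by some circuit [A :|: B :|: D], so a circuit through [D] consists of [D]
    and whole classes. With at most one class it would be properly contained in such a circuit; with
    two it already contains one. *)
Lemma utype_extend P D : utype P -> 3 <= #|P| -> D \subset W -> ear (cover P) D -> extends P D ->
  D \notin P /\ utype (D |: P).
Proof.
move=> uP P3 DW [D0 dD nD eD min] ext; have [tP P0 PW cP] := uP.
have [d0 d0D] := set0Pn _ D0.
have DP : D \notin P.
  by apply/negP => /sub_cover/subsetP/(_ _ d0D); rewrite (disjointFr dD d0D).
split=> //; split.
- apply/trivIsetP => A B; rewrite !inE => /orP[/eqP->|AP] /orP[/eqP->|BP]; rewrite ?eqxx // => ne.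
  + exact: disjointWr (sub_cover BP) dD.
  + by rewrite disjoint_sym; apply: disjointWr (sub_cover AP) dD.
  + exact: (trivIsetP tP).
- by rewrite !inE negb_or P0 andbT eq_sym.
- by rewrite cover_setU1 subUset DW.
move=> C; rewrite cover_setU1 => CP; split=> [cC|[Q [QP Q3 ->]]]; last first.
  have [DQ|DQ] := boolP (D \in Q); last first.
    apply: (utype_circ uP) => //; apply/subsetP => A AQ; have := subsetP QP _ AQ.
    by rewrite !inE => /orP[/eqP E|//]; rewrite -E AQ in DQ.
  have Q2 := card_setD1 DQ Q3; move/eqP/cards2P: Q2 => [A [B [AB E]]].
  have [AQ BQ] : A \in P /\ B \in P.
    have : [set A; B] \subset P.
      rewrite -E; apply/subsetP => Y; rewrite !inE => /andP[YD /(subsetP QP)].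
      by rewrite !inE (negbTE YD).
    by rewrite subUset !sub1set => /andP.
  have -> : cover Q = A :|: B :|: D.
    by rewrite -(setD1K DQ) E !cover_setU1 /cover big_set1 setUC.
  exact: ext.
have [CZ|nCZ] := boolP (C \subset cover P).
  have [Q [QP Q3 E]] := (cP _ CZ).1 cC; exists Q; split => //.
  by apply: subset_trans QP _; apply: subsetUr.
have CP' : C \subset cover P :|: D by rewrite setUC.
have DC := min _ cC CP' nCZ.
have att S : S \in P -> attached P D S.
  move=> SP.
  have [A AP] : exists2 A, A \in P & A \notin [set S].
    by apply: pick_other; rewrite cards1; apply: leq_trans P3.
  rewrite inE => AS.
  have [B BP] : exists2 B, B \in P & B \notin [set S; A].
    by apply: pick_other; rewrite cards2; apply: leq_trans P3; case: (_ != _).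
  rewrite !inE negb_or => /andP[BS BA].
  exists (A :|: B :|: D); split; [by apply: ext; rewrite // eq_sym | exact: subsetUr |].
  by rewrite setSU // subUset !sub_cover // !inE ?AS ?BS.
have eD' : ear (cover P) D by split.
have blk S : S \in P -> (S \subset C) || [disjoint S & C].
  by move=> SP; apply: (attached_block uP eD' SP (att S SP) cC DC CP').
pose R := [set S in P | S \subset C].
have RE : C = cover R :|: D.
  apply/setP => x; rewrite inE; apply/idP/orP => [xC|[/bigcupP[S]|]].
  - move: (subsetP CP' _ xC); rewrite inE => /orP[|xD]; [|by right].
    case/bigcupP => S SP xS; left; apply/bigcupP; exists S => //; rewrite inE SP /=.
    by case/orP: (blk S SP) => // dS; rewrite (disjointFr dS xS) in xC.
  - by rewrite inE => /andP[_ /subsetP h] /h.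
  - exact: (subsetP DC).
have R2 : 1 < #|R|.
  rewrite ltnNge; apply/negP => R1.
  have [A AP RA] : exists2 A, A \in P & R \subset [set A].
    move: R1; rewrite leq_eqVlt ltnS leqn0 => /orP[/cards1P[A E]|/eqP/cards0_eq->].
      by move: (set11 A); rewrite -E inE => /andP[AP _]; exists A; rewrite ?E.
    have /card_pick[A AP] : 0 < #|P| by apply: leq_trans P3.
    by exists A; rewrite ?sub0set.
  have [B BP] : exists2 B, B \in P & B \notin [set A].
    by apply: pick_other; rewrite cards1; apply: leq_trans P3.
  rewrite inE eq_sym => AB; have cABD := ext A B AP BP AB.
  have CA : C \subset A :|: D.
    by rewrite RE setSU //; have := coverS RA; rewrite {2}/cover big_set1.
  have E : C = A :|: B :|: D.
    by apply: (circ_inj cC cABD); apply: subset_trans CA _; rewrite setSU // subsetUl.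
  have /set0Pn[b bB] : B != set0 by apply: contraNneq P0 => <-.
  move: (subsetP CA b); rewrite E !inE bB orbT => /(_ isT) /orP[bA|bD].
    by move: AB; rewrite (trivIset_in tP AP BP bA bB) eqxx.
  by move: (subsetP (sub_cover BP) _ bB); rewrite (disjointFr dD bD).
have [|A AR _] := @pick_other _ R set0; first by rewrite cards0; apply: leq_trans R2.
have [|B BR] := @pick_other _ R [set A]; first by rewrite cards1.
rewrite inE eq_sym => AB; move: AR BR; rewrite !inE => /andP[AP AC] /andP[BP BC].
have E : A :|: B :|: D = C.
  by apply: circ_inj cC _; [apply: ext | rewrite !subUset AC BC].
exists (D |: [set A; B]); split.
- by rewrite setUS // subUset !sub1set AP.
- rewrite cardsU1 cards2 AB !inE negb_or (_ : D != A) 1?(_ : D != B) //.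
    by apply: contraNneq DP => ->.
  by apply: contraNneq DP => ->.
by rewrite -E !cover_setU1 /cover big_set1 setUC.
Qed.

(** The number of classes is bounded by [#|T|], so the growth ends. An element parallel to nothing
    in the core lies, by connectedness, on a circuit that meets the core, hence in an ear; this ear
    is not a parallel element and becomes a new class. *)
Theorem maximal_utype X P : connected M -> X \subset W -> circuit_complements X P -> 4 <= #|P| ->
  exists Q, [/\ utype Q, 4 <= #|Q|, matched Q &
    forall e, e \in W -> e \notin cover Q -> exists2 z, z \in cover Q & circ [set e; z]].
Proof.
move=> conn XW ccP P4.
have [P4' mP] := matched_quad XW ccP P4; have [pP inP] := ccP.
have [cP tP P0] := partition_coverK pP.
have uP : utype P.
  split=> //; first by rewrite cP.
  move=> C; rewrite cP => CX; rewrite inP //; split=> [SP|[Q [QP Q3 ->]]].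
    exists (P :\ (X :\: C)); split; [exact: subD1set | exact: card_setD1 |].
    by rewrite cover_setD1 // cP setDDr setDv set0U (setIidPr CX).
  have [A AP AQ] : exists2 A, A \in P & A \notin Q by apply: pick_other; rewrite P4' Q3.
  have -> : Q = P :\ A.
    by apply/eqP; rewrite eqEcard (card_setD1 AP P4') Q3 leqnn subsetD1 QP AQ.
  by rewrite cover_setD1 // -{1}cP setDDr setDv set0U (setIidPr (sub_cover AP)).
have {mP pP inP cP tP P0 ccP P4'} [n] := ubnP (#|T| - #|P|).
elim: n P P4 uP => // n IHn P P4 uP ltn; have [tP P0 PW cP] := uP.
pose par e := [exists z in cover P, circ [set e; z]].
have [/forall_inP all|/forall_inPn[e]] := boolP [forall e in W :\: cover P, par e].
  exists P; split => //; first exact: utype_matched.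
  by move=> e eW eP; have := all e; rewrite inE eP eW => /(_ isT)/exists_inP[z]; exists z.
rewrite inE => /andP[eP eW] npar.
have [z zP] : exists z, z \in cover P.
  apply: card_pick; apply: leq_trans (card_cover_ge tP P0); exact: leq_trans P4.
have ez : e != z by apply: contraNneq eP => ->.
have [C0 [cC0 eC0 zC0]] := conn e z eW (subsetP PW _ zP) ez.
move: cC0; rewrite circuitE => /andP[C0W cC0].
have [D eD [eD' DC0]] := ear_exists zP eP cC0 eC0 zC0.
have DW := subset_trans DC0 C0W.
case: (ear_alternative uP P4 DW eD) => [[d [z' [E zP' cdz]]]|ext].
  case/negP: npar; apply/exists_inP; exists z' => //.
  by move: eD'; rewrite E inE => /eqP->.
have [DP uDP] := utype_extend uP (leq_trans (isT : 3 <= 4) P4) DW eD ext.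
have c : #|D |: P| = #|P|.+1 by rewrite cardsU1 DP.
apply: (IHn (D |: P)) => //; rewrite c; first exact: leq_trans P4 _.
have le : #|D |: P| <= #|T|.
  have [tDP D0P _ _] := uDP.
  exact: leq_trans (card_cover_ge tDP D0P) (max_card _).
rewrite c in le; move: ltn le; clear; lia.
Qed.
End Core.

(** * Cycles of theta-graphs *)

Section ThetaGraphs.
Variables (V E : finType) (G : multigraph V E).
Implicit Types (x y z : V) (e : E) (p : seq (E * V)) (F : {set E}).

(** Incidence modulo 2: a loop counts zero at its vertex, and the sum along a closed walk
    vanishes. *)
Definition incident e z := ((ends G e).1 == z) (+) ((ends G e).2 == z).

Lemma joins_incident e x y z : joins G e x y -> incident e z = (x == z) (+) (y == z).
Proof. by rewrite /incident; case/orP => /eqP-> //=; rewrite addbC. Qed.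

Lemma walk_incident x p z : walk G x p ->
  \big[addb/false]_(e <- unzip1 p) incident e z = (x == z) (+) (last x (unzip2 p) == z).
Proof.
elim: p x => [|[e y] p IHp] x /=; first by rewrite big_nil addbb.
by case/andP=> /joins_incident exy /IHp; rewrite big_cons exy => ->; rewrite -addbA addKb.
Qed.

Lemma walk_avoid x p z e : walk G x p -> z \notin x :: unzip2 p -> e \in unzip1 p ->
  incident e z = false.
Proof.
elim: p x => [|[e' y] p IHp] x //=.
case/andP=> /joins_incident exy wp; rewrite !inE !negb_or => /and3P[zx zy zp].
case/orP => [/eqP->|]; first by rewrite exy eq_sym (negbTE zx) eq_sym (negbTE zy).
by apply: IHp wp _; rewrite inE negb_or zy.
Qed.

Definition degree_parity F z p := \big[addb/false]_(e <- unzip1 p) ((e \in F) && incident e z).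

Lemma degree_parity_avoid F x p z : walk G x p -> z \notin x :: unzip2 p ->
  degree_parity F z p = false.
Proof.
move=> wp zp; rewrite /degree_parity big_seq big1 // => e ep.
by rewrite (walk_avoid wp zp ep) andbF.
Qed.

Lemma degree_parity_start F x e y p : walk G x ((e, y) :: p) -> uniq (x :: y :: unzip2 p) ->
  degree_parity F x ((e, y) :: p) = (e \in F).
Proof.
move=> /= /andP[/joins_incident exy wp] /andP[xp _].
have := degree_parity_avoid F wp xp; rewrite /degree_parity /= big_cons => ->.
rewrite exy eqxx; move: xp; rewrite inE negb_or eq_sym => /andP[/negbTE-> _].
by case: (e \in F).
Qed.

(** An inner vertex meets exactly two edges of the path, so evenness passes membership in [F] from
    each edge to the next. *)
Lemma path_all_or_none F x e y p : walk G x ((e, y) :: p) -> uniq (x :: y :: unzip2 p) ->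
  (forall z, z \in belast y (unzip2 p) -> degree_parity F z ((e, y) :: p) = false) ->
  forall e', e' \in unzip1 ((e, y) :: p) -> (e' \in F) = (e \in F).
Proof.
elim: p x e y => [|[e2 y2] p IHp] x e y /=; first by move=> _ _ _ e'; rewrite inE => /eqP->.
case/andP=> /joins_incident exy wp /andP[xp up] inner e'.
have yF : (e2 \in F) = (e \in F).
  have := inner y (mem_head _ _); rewrite /degree_parity /= big_cons.
  have := degree_parity_start F wp up; rewrite /degree_parity /= => ->.
  rewrite exy eqxx; move: xp; rewrite inE negb_or => /andP[/negbTE-> _].
  by rewrite andbT; case: (e \in F); case: (e2 \in F).
rewrite inE => /orP[/eqP->//|e'p]; rewrite -yF.
apply: (IHp y e2 y2) => // z zp.
have zi : z \in belast y (y2 :: unzip2 p) by rewrite /= inE zp orbT.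
have := inner z zi; rewrite /degree_parity /= big_cons.
suff -> : incident e z = false by rewrite andbF.
have zp2 : z \in y2 :: unzip2 p by apply: mem_belast.
rewrite exy; move: xp up; rewrite !inE /= => /norP[xy xp2] /andP[yp2 _].
rewrite (_ : (x == z) = false); last by apply: contraNF xp2 => /eqP->.
by rewrite (_ : (y == z) = false) //; apply: contraNF yp2 => /eqP->.
Qed.

Lemma walk_cat x p q : walk G x (p ++ q) = walk G x p && walk G (last x (unzip2 p)) q.
Proof. by elim: p x => [|[e y] p IHp] x //=; rewrite IHp andbA. Qed.

Lemma unzip1_cat p q : unzip1 (p ++ q) = unzip1 p ++ unzip1 q. Proof. exact: map_cat. Qed.
Lemma unzip2_cat p q : unzip2 (p ++ q) = unzip2 p ++ unzip2 q. Proof. exact: map_cat. Qed.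

Fixpoint rev_walk x p := if p is (e, y) :: p' then rcons (rev_walk y p') (e, x) else [::].

Lemma rev_walk_edges x p : unzip1 (rev_walk x p) = rev (unzip1 p).
Proof. by elim: p x => [|[e y] p IHp] x //=; rewrite /unzip1 map_rcons rev_cons -(IHp y). Qed.

Lemma rev_walk_vertices x p : unzip2 (rev_walk x p) = rev (belast x (unzip2 p)).
Proof. by elim: p x => [|[e y] p IHp] x //=; rewrite /unzip2 map_rcons rev_cons -(IHp y). Qed.

Lemma rev_walk_last x p : last (last x (unzip2 p)) (unzip2 (rev_walk x p)) = x.
Proof. by case: p => [|[e y] p] //=; rewrite /unzip2 map_rcons last_rcons. Qed.

Lemma joins_sym e x y : joins G e x y = joins G e y x.
Proof. by rewrite /joins orbC. Qed.

Lemma rev_walkP x p : walk G x p -> walk G (last x (unzip2 p)) (rev_walk x p).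
Proof.
elim: p x => [|[e y] p IHp] x //= /andP[exy wp].
by rewrite -cats1 walk_cat IHp //= rev_walk_last joins_sym exy.
Qed.

Lemma path_between_vertices x y p : x != y -> path_between G x y p ->
  unzip2 p = rcons (internal_vertices x p) y /\
  belast x (unzip2 p) = x :: internal_vertices x p.
Proof.
move=> xy /and3P[_ /eqP lp _]; case: p lp => [|[e z] p] /=.
  by move=> xy0; rewrite xy0 eqxx in xy.
rewrite /internal_vertices /= => lp; split=> //.
by rewrite -lp -lastI.
Qed.

Definition is_cycle_set F := exists x p, is_cycle G x p /\ F = [set e in unzip1 p].
Definition edge_set p : {set E} := [set e in unzip1 p].

(** The body of [theta_graph] with its witnesses exposed, so that the three paths can be
    permuted. *)
Definition theta_paths (u v : V) (p1 p2 p3 : seq (E * V)) :=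
  [/\ u != v, [/\ path_between G u v p1, path_between G u v p2 & path_between G u v p3],
      perm_eq [:: u, v & internal_vertices u p1 ++ internal_vertices u p2
                           ++ internal_vertices u p3] (enum V)
    & perm_eq (unzip1 p1 ++ unzip1 p2 ++ unzip1 p3) (enum E)].

Lemma theta_paths_rot u v p1 p2 p3 : theta_paths u v p1 p2 p3 -> theta_paths u v p2 p3 p1.
Proof.
move=> [uv [h1 h2 h3] pv pe]; split => //; [apply: perm_trans pv | apply: perm_trans pe].
  by rewrite !perm_cons catA perm_catC.
by rewrite catA perm_catC.
Qed.

(** Follow [p1] and return along [p2] reversed. *)
Lemma theta_cycle_mem u v p1 p2 p3 : theta_paths u v p1 p2 p3 ->
  is_cycle_set (edge_set p1 :|: edge_set p2).
Proof.
move=> [uv [h1 h2 h3] pv pe].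
have [v1 b1] := path_between_vertices uv h1; have [v2 b2] := path_between_vertices uv h2.
have [/and3P[w1 /eqP l1 _] /and3P[w2 /eqP l2 _]] := (h1, h2).
exists u, (p1 ++ rev_walk u p2); split; last first.
  by apply/setP => e; rewrite !inE unzip1_cat mem_cat rev_walk_edges mem_rev.
apply/and5P; split.
- by case: (p1) v1 => // /esym/eqP; rewrite -size_eq0 size_rcons.
- by rewrite walk_cat w1 l1 -l2 rev_walkP.
- by rewrite unzip2_cat last_cat l1 -l2 rev_walk_last.
- have := enum_uniq E; rewrite -(perm_uniq pe) catA cat_uniq => /andP[+ _].
  by rewrite unzip1_cat rev_walk_edges !cat_uniq rev_uniq
      => /and3P[-> + ->]; rewrite andbT /= has_rev.
have := enum_uniq V; rewrite -(perm_uniq pv) (catA (internal_vertices u p1)).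
rewrite -[u :: v :: _]/([:: u; v] ++ _) catA cat_uniq => /andP[+ _].
rewrite unzip2_cat rev_walk_vertices v1 b2 rev_cons -cats1 -[rcons (rev _) _]cats1.
move=> un; rewrite -(perm_uniq (s1 := [:: u; v] ++ internal_vertices u p1 ++ internal_vertices u p2)) 1?catA //.
by apply/permP => a; rewrite !(count_cat, count_rev) /=; clear -a; lia.
Qed.

Lemma theta_paths_uniq u v p1 p2 p3 : theta_paths u v p1 p2 p3 ->
  uniq (u :: unzip2 p1) /\
  (forall z, z \in internal_vertices u p1 -> z \notin u :: unzip2 p2 /\ z \notin u :: unzip2 p3).
Proof.
move=> [uv [h1 h2 h3] pv pe].
have [v2 _] := path_between_vertices uv h2; have [v3 _] := path_between_vertices uv h3.
split; first by case/and3P: h1.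
have := enum_uniq V; rewrite -(perm_uniq pv) => un z z1.
move: un => /= /andP[un0 /andP[vn]]; rewrite cat_uniq => /and3P[_ /hasPn dis _].
have zu : z != u.
  by apply: contraNneq un0 => eq_z; move: z1; rewrite eq_z inE mem_cat => ->; rewrite orbT.
have zv : z != v by apply: contraNneq vn => <-; rewrite mem_cat z1.
have zi q : {subset q <= internal_vertices u p2 ++ internal_vertices u p3} -> z \notin q.
  by move=> sub; apply/negP => /sub/dis; rewrite z1.
rewrite !inE v2 v3 !mem_rcons !inE (negbTE zu) (negbTE zv) /=.
by split; apply: zi => y; rewrite mem_cat => ->; rewrite ?orbT.
Qed.

Lemma degree_parity_sum u v p1 p2 p3 F z : theta_paths u v p1 p2 p3 ->
  \big[addb/false]_(e in F) incident e z =
  degree_parity F z p1 (+) degree_parity F z p2 (+) degree_parity F z p3.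
Proof.
move=> [_ _ _ pe]; rewrite -addbA /degree_parity -!big_cat (perm_big _ pe) /= big_enum /=.
rewrite big_mkcond; apply: eq_bigr => e _; by case: (e \in F).
Qed.

(** The inner vertices of [p1] meet neither of the other paths, so evenness makes [F] contain all or
    none of [p1]; the same Boolean is the contribution of [p1] at [u]. *)
Lemma path_side u v p1 p2 p3 F : theta_paths u v p1 p2 p3 ->
  (forall z, \big[addb/false]_(e in F) incident e z = false) ->
  exists b, (forall e, e \in unzip1 p1 -> (e \in F) = b) /\ degree_parity F u p1 = b.
Proof.
move=> tp even; have [un int1] := theta_paths_uniq tp.
have [uv [h1 h2 h3] pv pe] := tp.
have [w1 [w2 w3]] : walk G u p1 /\ walk G u p2 /\ walk G u p3.
  by move: h1 h2 h3 => /and3P[-> _ _] /and3P[-> _ _] /and3P[-> _ _].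
case: p1 w1 un int1 h1 tp pv pe => [|[e y] p] w1 un int1 h1 tp pv pe.
  by have := path_between_vertices uv h1; case=> /esym/eqP; rewrite -size_eq0 size_rcons.
exists (e \in F); split; last exact: degree_parity_start w1 un.
apply: (path_all_or_none w1 un) => z zp.
have [z2 z3] := int1 z zp.
have := even z; rewrite (degree_parity_sum _ _ tp).
by rewrite (degree_parity_avoid F w2 z2) (degree_parity_avoid F w3 z3) !addbF.
Qed.

Lemma cycle_even F : is_cycle_set F -> F != set0 /\ forall z, \big[addb/false]_(e in F) incident e z = false.
Proof.
case=> x [p [/and5P[p0 wp /eqP lp u1 _] ->]]; split.
  by case: (p) p0 => [|[e y] q] // _; apply/set0Pn; exists e; rewrite !inE eqxx.
move=> z; rewrite (eq_bigl (mem (unzip1 p))); last by move=> e; rewrite inE.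
by rewrite -big_uniq //= (walk_incident z wp) lp addbb.
Qed.

Lemma theta_edges u v p1 p2 p3 : theta_paths u v p1 p2 p3 ->
  [/\ edge_set p1 != set0, [disjoint edge_set p1 & edge_set p2], [disjoint edge_set p1 & edge_set p3]
    & forall e, [|| e \in edge_set p1, e \in edge_set p2 | e \in edge_set p3]].
Proof.
move=> [uv [h1 h2 h3] pv pe]; split.
- have [+ _] := path_between_vertices uv h1.
  case: (p1) => [/esym/eqP|[e y] p _]; first by rewrite -size_eq0 size_rcons.
  by apply/set0Pn; exists e; rewrite !inE eqxx.
- have := enum_uniq E; rewrite -(perm_uniq pe) cat_uniq => /and3P[_ /hasPn dis _].
  rewrite -setI_eq0; apply/negPn/negP => /set0Pn[e]; rewrite !inE => /andP[e1 e2].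
  by have := dis e; rewrite mem_cat e2 e1 => /(_ isT).
- have := enum_uniq E; rewrite -(perm_uniq pe) cat_uniq => /and3P[_ /hasPn dis _].
  rewrite -setI_eq0; apply/negPn/negP => /set0Pn[e]; rewrite !inE => /andP[e1 e2].
  by have := dis e; rewrite mem_cat e2 e1 orbT => /(_ isT).
by move=> e; rewrite !inE -!mem_cat (perm_mem pe) mem_enum.
Qed.

(** A cycle is even at every vertex, so it takes each path entirely or not at all. Evenness at [u]
    leaves none or two of the paths, and a cycle is nonempty. *)
Lemma theta_cycles u v p1 p2 p3 : theta_paths u v p1 p2 p3 ->
  let P := [set edge_set p1; edge_set p2; edge_set p3] in
  [/\ partition P [set: E], #|P| = 3 & forall F, is_cycle_set F <-> ~: F \in P].
Proof.
move=> tp P.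
have tp2 := theta_paths_rot tp; have tp3 := theta_paths_rot tp2.
have [n1 d12 d13 cov] := theta_edges tp.
have [n2 d23 _ _] := theta_edges tp2; have [n3 _ _ _] := theta_edges tp3.
have neq (A B : {set E}) : A != set0 -> [disjoint A & B] -> A != B.
  move=> A0 dAB; apply: contraNneq A0 => AB.
  by move: dAB; rewrite -AB -setI_eq0 setIid.
have [e12 e13 e23] := And3 (neq _ _ n1 d12) (neq _ _ n1 d13) (neq _ _ n2 d23).
have P3 : #|P| = 3 by rewrite /P cards3.
have pP : partition P [set: E].
  apply/and3P; split.
  - apply/eqP/setP => e; rewrite [RHS]inE; case/or3P: (cov e) => h; apply/bigcupP.
    + by exists (edge_set p1); rewrite // !inE eqxx.
    + by exists (edge_set p2); rewrite // !inE eqxx orbT.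
    + by exists (edge_set p3); rewrite // !inE eqxx orbT.
  - apply/trivIsetP => A B; rewrite !inE => /orP[/orP[]|] /eqP-> /orP[/orP[]|] /eqP->;
      rewrite ?eqxx // => _ //; by rewrite disjoint_sym.
  - by rewrite !inE ![set0 == _]eq_sym !negb_or n1 n2 n3.
split=> // F; split=> [cF|].
  have [F0 ev] := cycle_even cF.
  have [b1 [in1 par1]] := path_side tp ev.
  have [b2 [in2 par2]] := path_side tp2 ev.
  have [b3 [in3 par3]] := path_side tp3 ev.
  have := ev u; rewrite (degree_parity_sum _ _ tp) par1 par2 par3.
  have FE e : (e \in F) =
      [|| (e \in edge_set p1) && b1, (e \in edge_set p2) && b2 | (e \in edge_set p3) && b3].
    move: (cov e) (disjointFr d12 (x := e)) (disjointFr d13 (x := e)) (disjointFr d23 (x := e)).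
    rewrite !inE => /or3P[] h; rewrite ?(in1 e h) ?(in2 e h) ?(in3 e h) h /=.
    + by move=> /(_ isT)-> /(_ isT)-> _; rewrite !orbF.
    + by case: (e \in unzip1 p1) => [/(_ isT)//|] _ _ /(_ isT)->; rewrite orbF.
    + case: (e \in unzip1 p1) => [_ /(_ isT)//|] _ _.
      by case: (e \in unzip1 p2) => [/(_ isT)//|] _.
  have PE A : A \in P -> (forall e, (e \in A) = (e \notin F)) -> ~: F \in P.
    by move=> AP h; suff -> : ~: F = A by []; apply/setP => e; rewrite inE h.
  have tri e : [/\ (e \in edge_set p1) && (e \in edge_set p2) = false,
      (e \in edge_set p1) && (e \in edge_set p3) = false & (e \in edge_set p2) && (e \in edge_set p3) = false].
    by split; apply/negP => /andP[h]; rewrite ?(disjointFr d12 h) ?(disjointFr d13 h) ?(disjointFr d23 h).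
  move: b1 b2 b3 FE {in1 in2 in3 par1 par2 par3} => [] [] [] FE //= _.
  - apply: (PE (edge_set p3)) => [|e]; first by rewrite !inE eqxx !orbT.
    by rewrite FE; move: (cov e) (tri e); case: (e \in edge_set p1); case: (e \in edge_set p2);
      case: (e \in edge_set p3) => // _ [].
  - apply: (PE (edge_set p2)) => [|e]; first by rewrite !inE eqxx !orbT.
    by rewrite FE; move: (cov e) (tri e); case: (e \in edge_set p1); case: (e \in edge_set p2);
      case: (e \in edge_set p3) => // _ [].
  - apply: (PE (edge_set p1)) => [|e]; first by rewrite !inE eqxx.
    by rewrite FE; move: (cov e) (tri e); case: (e \in edge_set p1); case: (e \in edge_set p2);
      case: (e \in edge_set p3) => // _ [].
  - by case/set0Pn: F0 => e; rewrite FE !andbF.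
have FE A : ~: F = A -> F = ~: A by move=> <-; rewrite setCK.
have cy (A B C : {set E}) : [disjoint A & B] -> [disjoint B & C] -> [disjoint A & C] ->
    (forall e, [|| e \in A, e \in B | e \in C]) -> ~: C = A :|: B.
  move=> dAB dBC dAC cv; apply/setP => e; rewrite !inE; move: (cv e).
  have hAC : (e \in A) && (e \in C) = false by apply/negP => /andP[h]; rewrite (disjointFr dAC h).
  have hBC : (e \in B) && (e \in C) = false by apply/negP => /andP[h]; rewrite (disjointFr dBC h).
  by move: hAC hBC; case: (e \in A); case: (e \in B); case: (e \in C).
have d21 : [disjoint edge_set p2 & edge_set p1] by rewrite disjoint_sym.
have d31 : [disjoint edge_set p3 & edge_set p1] by rewrite disjoint_sym.
have d32 : [disjoint edge_set p3 & edge_set p2] by rewrite disjoint_sym.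
rewrite !inE => /orP[/orP[]|] /eqP/FE ->.
- rewrite (cy (edge_set p2) (edge_set p3)) //; first exact: theta_cycle_mem tp2.
  by move=> e; move: (cov e); do 3 case: (e \in _).
- rewrite (cy (edge_set p3) (edge_set p1)) //; first exact: theta_cycle_mem tp3.
  by move=> e; move: (cov e); do 3 case: (e \in _).
rewrite (cy (edge_set p1) (edge_set p2)) //; exact: theta_cycle_mem tp.
Qed.

End ThetaGraphs.

(** * Theta-graphs in matroids *)

Section ThetaConstruction.
Variables (E : finType) (m1 m2 m3 : seq E) (z1 z2 z3 : E).
Local Notation l1 := (rcons m1 z1).
Local Notation l2 := (rcons m2 z2).
Local Notation l3 := (rcons m3 z3).
Hypothesis edges : perm_eq (l1 ++ l2 ++ l3) (enum E).

(* An internal vertex is named after the edge preceding it on its path; the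
   last edge of each path ends in [Some None]. *)
Local Notation inner := (m1 ++ m2 ++ m3).
Local Notation V := (option (option {e : E | e \in inner})).

Definition edge_target (e : E) : V := Some (insub e).
(** The vertices along [l] are the start [None] followed by the targets of its edges, so position
    [index e l] is the vertex just before [e]. *)
Definition edge_source (l : seq E) (e : E) : V :=
  nth None (None :: map edge_target l) (index e l).
Definition theta_of_arcs := Multigraph (fun e =>
  (edge_source (if e \in l1 then l1 else if e \in l2 then l2 else l3) e, edge_target e)).
Definition arc_path (l : seq E) : seq (E * V) := [seq (e, edge_target e) | e <- l].

Lemma arc_path_edges l : unzip1 (arc_path l) = l.
Proof. by rewrite /unzip1 -map_comp map_id. Qed.

Lemma arc_path_vertices l : unzip2 (arc_path l) = map edge_target l.
Proof. by rewrite /unzip2 -map_comp. Qed.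

Lemma arc_walk l : uniq l -> {in l, forall e, (ends theta_of_arcs e).1 = edge_source l e} ->
  walk theta_of_arcs None (arc_path l).
Proof.
move=> ul el.
suff h b a : l = a ++ b -> walk theta_of_arcs (last None (map edge_target a)) (arc_path b).
  by apply: (h l [::]).
elim: b a => [|e b IHb] a // El /=; apply/andP; split; last first.
  by have := IHb (rcons a e); rewrite map_rcons last_rcons cat_rcons; apply.
have el' : e \in l by rewrite El mem_cat mem_head orbT.
have := el e el'; rewrite /joins /= => ->; apply/orP; left; apply/eqP; congr (_, _).
have ea : e \notin a.
  by move: ul; rewrite El cat_uniq => /and3P[_ /hasPn h _]; apply: h; apply: mem_head.
rewrite /edge_source El index_cat (negbTE ea) /= eqxx addn0 map_cat.
by rewrite -cat_cons nth_cat /= size_map ltnSn (last_nth None) size_map.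
Qed.

Lemma theta_of_arcsP : theta_paths theta_of_arcs None (Some None)
  (arc_path l1) (arc_path l2) (arc_path l3).
Proof.
have un := enum_uniq E; rewrite -(perm_uniq edges) in un.
have unl : uniq (l1 ++ l2 ++ l3) := un.
move: un; rewrite cat_uniq => /and3P[u1 /hasPn d1]; rewrite cat_uniq => /and3P[u2 /hasPn d2 u3].
have tgt_last z : z \notin inner -> edge_target z = Some None.
  by move=> zi; rewrite /edge_target insubN.
have tgt_inner e : e \in inner -> edge_target e \notin [:: None; Some None].
  by move=> ei; rewrite /edge_target insubT.
have tgt_inj : {in inner &, injective edge_target}.
  by move=> e e' ei ei'; rewrite /edge_target !insubT => -[].
have perm_last : perm_eq (l1 ++ l2 ++ l3) ([:: z1; z2; z3] ++ inner).
  apply/permP => a; rewrite -!cats1 !count_cat /=.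
  by rewrite !addn0; clear; lia.
move: unl; rewrite (perm_uniq perm_last) cat_uniq => /and3P[_ /hasPn dl ui].
have [li1 [li2 li3]] : z1 \notin inner /\ z2 \notin inner /\ z3 \notin inner.
  split; [|split]; by apply/negP => /dl; rewrite !inE eqxx ?orbT.
have internal m z : internal_vertices None (arc_path (rcons m z)) = map edge_target m.
  by rewrite /internal_vertices arc_path_vertices map_rcons belast_rcons.
have mapun m : uniq m -> {subset m <= inner} -> uniq (map edge_target m).
  by move=> um sub; rewrite map_inj_in_uniq // => e e' /sub ei /sub ei'; apply: tgt_inj.
have notin m v : v \in [:: None; Some None] -> {subset m <= inner} -> v \notin map edge_target m.
  by move=> vi sub; apply/negP => /mapP[e /sub/tgt_inner + ve]; rewrite -ve vi.
have pb m z : uniq (rcons m z) -> {subset m <= inner} -> z \notin inner ->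
   {in rcons m z, forall e, (ends theta_of_arcs e).1 = edge_source (rcons m z) e} ->
   path_between theta_of_arcs None (Some None) (arc_path (rcons m z)).
  move=> um sub zi src; apply/and3P; split; first exact: arc_walk.
    by rewrite arc_path_vertices map_rcons last_rcons tgt_last.
  move: um; rewrite rcons_uniq => /andP[_ um].
  rewrite arc_path_vertices map_rcons /= rcons_uniq mem_rcons inE negb_or.
  by rewrite tgt_last // !notin // ?mapun // !inE.
have sub1 : {subset m1 <= inner} by move=> e; rewrite !mem_cat => ->.
have sub2 : {subset m2 <= inner} by move=> e; rewrite !mem_cat => ->; rewrite orbT.
have sub3 : {subset m3 <= inner} by move=> e; rewrite !mem_cat => ->; rewrite !orbT.
have d12 e : e \in l2 -> e \notin l1 by move=> h; apply: d1; rewrite mem_cat h.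
have d13 e : e \in l3 -> e \notin l1 by move=> h; apply: d1; rewrite mem_cat h orbT.
split=> //.
- split; apply: pb => // e el /=.
  + by rewrite el.
  + by rewrite (negbTE (d12 e el)) el.
  + by rewrite (negbTE (d13 e el)) (negbTE (d2 e el)).
- rewrite !internal -!map_cat; apply: uniq_perm; rewrite ?enum_uniq //.
    by rewrite /= !inE negb_or !notin ?mapun // !inE.
  move=> x; rewrite mem_enum !inE; case: x => [[s|]|] //.
  apply/mapP; exists (val s); first exact: (valP s).
  by rewrite /edge_target valK.
by rewrite !arc_path_edges.
Qed.

End ThetaConstruction.

(** * Transport of sets and circuits along an isomorphism *)

Section IsoSets.
Variables (T T' : finType) (M : matroid T) (N : matroid T').
Variable f : {x : T | x \in ground M} -> {y : T' | y \in ground N}.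
Hypothesis f_bij : bijective f.
Hypothesis f_indep : forall X : {set {x : T | x \in ground M}},
  ([set val x | x in X] \in indep M) = ([set val (f x) | x in X] \in indep N).

Definition iso_image (X : {set T}) : {set T'} := [set val (f x) | x in [set x | val x \in X]].
Definition iso_preimage (Y : {set T'}) : {set T} := [set val x | x in [set x | val (f x) \in Y]].

Lemma mem_iso_image X x : (val (f x) \in iso_image X) = (val x \in X).
Proof.
apply/imsetP/idP => [[x' + /val_inj/(bij_inj f_bij)->]|xX]; first by rewrite inE.
by exists x; rewrite ?inE.
Qed.

Lemma mem_iso_preimage Y x : (val x \in iso_preimage Y) = (val (f x) \in Y).
Proof.
apply/imsetP/idP => [[x' + /val_inj->]|xX]; first by rewrite inE.
by exists x; rewrite ?inE.
Qed.

Lemma iso_image_ground X : iso_image X \subset ground N.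
Proof. by apply/subsetP => _ /imsetP[x _ ->]; apply: valP. Qed.

Lemma iso_preimage_ground Y : iso_preimage Y \subset ground M.
Proof. by apply/subsetP => _ /imsetP[x _ ->]; apply: valP. Qed.

Lemma iso_surj y : y \in ground N -> exists x, y = val (f x).
Proof.
by case: f_bij => g fK gK yN; exists (g (Sub y yN)); rewrite gK.
Qed.

Lemma iso_set_eq (Y Y' : {set T'}) : Y \subset ground N -> Y' \subset ground N ->
  (forall x, (val (f x) \in Y) = (val (f x) \in Y')) -> Y = Y'.
Proof.
move=> YN Y'N h; apply/setP => y; have [/iso_surj[x ->]|yN] := boolP (y \in ground N).
  exact: h.
by rewrite (contraNF (subsetP YN y)) // (contraNF (subsetP Y'N y)).
Qed.

Lemma ground_set_eq (Y Y' : {set T}) : Y \subset ground M -> Y' \subset ground M ->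
  (forall x : {x | x \in ground M}, (val x \in Y) = (val x \in Y')) -> Y = Y'.
Proof.
move=> YN Y'N h; apply/setP => y; have [yM|yM] := boolP (y \in ground M).
  exact: (h (Sub y yM)).
by rewrite (contraNF (subsetP YN y)) // (contraNF (subsetP Y'N y)).
Qed.

Lemma iso_preimageK (X : {set T}) : X \subset ground M -> iso_preimage (iso_image X) = X.
Proof.
move=> XM; apply: ground_set_eq => // [|x]; first exact: iso_preimage_ground.
by rewrite mem_iso_preimage mem_iso_image.
Qed.

Lemma iso_imageK (Y : {set T'}) : Y \subset ground N -> iso_image (iso_preimage Y) = Y.
Proof.
move=> YN; apply: iso_set_eq => // [|x]; first exact: iso_image_ground.
by rewrite mem_iso_image mem_iso_preimage.
Qed.

Lemma iso_imageS (X Y : {set T}) : X \subset Y -> iso_image X \subset iso_image Y.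
Proof.
move=> /subsetP XY; apply/subsetP => _ /imsetP[x + ->]; rewrite inE => /XY xY.
by rewrite mem_iso_image.
Qed.

Lemma iso_preimageS (X Y : {set T'}) : X \subset Y -> iso_preimage X \subset iso_preimage Y.
Proof.
move=> /subsetP XY; apply/subsetP => _ /imsetP[x + ->]; rewrite inE => /XY xY.
by rewrite mem_iso_preimage.
Qed.

Lemma iso_indep (X : {set T}) : X \subset ground M -> (X \in indep M) = (iso_image X \in indep N).
Proof.
move=> XM; rewrite -f_indep.
suff <- : X = [set val x | x in [set x : {x : T | x \in ground M} | val x \in X]] by [].
apply: ground_set_eq => //; first by apply/subsetP => _ /imsetP[x _ ->]; apply: valP.
by move=> x; rewrite (mem_imset _ _ val_inj) inE.
Qed.

Lemma iso_imageD (X Y : {set T}) : iso_image (X :\: Y) = iso_image X :\: iso_image Y.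
Proof.
apply: iso_set_eq => [||x]; first exact: iso_image_ground.
  exact: subset_trans (subsetDl _ _) (iso_image_ground _).
by rewrite inE !mem_iso_image inE.
Qed.

Lemma iso_image_inj (X Y : {set T}) : X \subset ground M -> Y \subset ground M ->
  iso_image X = iso_image Y -> X = Y.
Proof. by move=> XM YM E; rewrite -(iso_preimageK XM) E iso_preimageK. Qed.

Lemma iso_circ (C : {set T}) : C \subset ground M -> circ M C = circ N (iso_image C).
Proof.
move=> CM; apply/minsetP/minsetP => -[dep min]; split.
- by rewrite -iso_indep.
- move=> B BI BC; have BN := subset_trans BC (iso_image_ground C).
  rewrite -[B]iso_imageK //; congr iso_image; apply: min.
    by rewrite iso_indep ?iso_preimage_ground ?iso_imageK.
  by rewrite -[C]iso_preimageK // iso_preimageS.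
- by rewrite iso_indep.
- move=> B BI BC; have BM := subset_trans BC CM.
  by apply: iso_image_inj => //; apply: min; rewrite -?iso_indep // iso_imageS.
Qed.

Lemma iso_image_mem (P : {set {set T}}) (A : {set T}) : A \subset ground M ->
  (forall B, B \in P -> B \subset ground M) ->
  (iso_image A \in iso_image @: P) = (A \in P).
Proof.
move=> AM PM; apply/imsetP/idP => [[B BP /iso_image_inj->//]|AP]; first exact: PM.
by exists A.
Qed.

Lemma iso_partition (P : {set {set T}}) : partition P (ground M) ->
  partition (iso_image @: P) (ground N) /\ #|iso_image @: P| = #|P|.
Proof.
move=> pP; have [cP tP P0] := and3P pP.
have sub A : A \in P -> A \subset ground M by rewrite -(eqP cP); apply: sub_cover.
split; last by rewrite card_in_imset // => A B /sub AM /sub BM; apply: iso_image_inj.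
apply/and3P; split.
- apply/eqP/setP => y; apply/bigcupP/idP => [[_ /imsetP[A AP ->]]|/iso_surj[x ->]].
    by apply: subsetP; apply: iso_image_ground.
  have : val x \in cover P by rewrite (eqP cP) (valP x).
  case/bigcupP => A AP xA; exists (iso_image A); first exact: imset_f.
  by rewrite mem_iso_image.
- apply/trivIsetP => _ _ /imsetP[A AP ->] /imsetP[B BP ->] ne.
  have AB : A != B by apply: contraNneq ne => ->.
  rewrite -setI_eq0; apply/negPn/negP => /set0Pn[y]; rewrite inE => /andP[yA yB].
  have [x E] := iso_surj (subsetP (iso_image_ground A) y yA); subst y.
  move: yA yB; rewrite !mem_iso_image => xA xB.
  by rewrite (trivIset_in tP AP BP xA xB) eqxx in AB.
apply/negP => /imsetP[A AP E]; case/negP: P0.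
suff <- : A = set0 by [].
apply: iso_image_inj; rewrite ?sub0set ?sub //.
rewrite -E; apply: iso_set_eq; rewrite ?sub0set ?iso_image_ground // => x.
by rewrite mem_iso_image !inE.
Qed.

End IsoSets.

Lemma matroid_iso_sym (T T' : finType) (M : matroid T) (N : matroid T') :
  matroid_iso M N -> matroid_iso N M.
Proof.
case=> f [[g fK gK] h]; exists g; split; first by exists f.
move=> Y; have := h [set g y | y in Y]; rewrite -!imset_comp => E.
rewrite (_ : [set val (g y) | y in Y] = (val \o g) @: Y) // E.
by rewrite (_ : [set val y | y in Y] = ((fun x => val (f x)) \o g) @: Y) //; apply: eq_imset => y /=; rewrite gK.
Qed.

Section Restriction.
Variables (T : finType) (M : matroid T) (X : {set T}).
Implicit Types (I C Y S A : {set T}) (P : {set {set T}}).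

Lemma indep_restrict I : (I \in indep (restrict M X)) = (I \in indep M) && (I \subset X).
Proof. by rewrite inE. Qed.

Lemma circ_restrict C : C \subset X -> circ (restrict M X) C = circ M C.
Proof.
move=> CX; apply/minsetP/minsetP => -[dep min]; split.
- by move: dep; rewrite indep_restrict CX andbT.
- move=> B BI BC; apply: min BC; rewrite indep_restrict negb_and BI. by [].
- by rewrite indep_restrict CX andbT.
- by move=> B + BC; rewrite indep_restrict (subset_trans BC CX) andbT => BI; apply: min BC.
Qed.

End Restriction.

Section SubMatroid.
Variables (T : finType) (M : matroid T).
Local Notation E := {x : T | x \in ground M}.

Lemma sub_matroid_axiom : matroid_axiom [set: E] [set Y : {set E} | val @: Y \in indep M].
Proof.
apply/matroid_axiomP; have [_ _ _ m4] := matroidP M; split.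
- by move=> Y _; apply: subsetT.
- by rewrite inE imset0 indep0.
- by move=> Y Y'; rewrite !inE => YI Y'Y; apply: indepS YI _; apply: imsetS.
move=> Y Y'; rewrite !inE => YI Y'I lt.
have [|y] := m4 _ _ YI Y'I; first by rewrite !card_imset //; exact: val_inj.
rewrite inE => /andP[yY /imsetP[y' y'Y' E']] yI; exists y'.
  by rewrite inE y'Y' andbT; apply: contraNN yY => y'Y; rewrite E' imset_f.
by rewrite inE imsetU1 -E'.
Qed.

(** A cycle matroid has the whole edge type as ground set, whereas a restriction lives on a subset
    of its carrier. This copy on the subtype of ground elements bridges the two. *)
Definition sub_matroid : matroid E := @Matroid E (_, _) sub_matroid_axiom.

Lemma sub_matroid_iso : matroid_iso M sub_matroid.
Proof.
exists (fun x => exist (fun y : E => y \in ground sub_matroid) x (in_setT x)); split.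
  by exists val => [x|[x h]] //; apply: val_inj.
move=> X; rewrite [RHS]inE.
by rewrite (_ : [set _ | x in X] = X) // -[RHS]imset_id; apply: eq_imset.
Qed.

End SubMatroid.

(** * Series pairs through the dual *)

Section Duality.
Variables (T : finType) (M : matroid T).
Implicit Types (X Y C B : {set T}).
Local Notation W := (ground M).

Lemma coindepP X : reflect (X \subset W /\ exists2 B, basis M B & [disjoint X & B])
  (X \in indep (dual M)).
Proof.
rewrite inE powersetE; apply: (iffP andP) => -[XW h]; split=> //.
  by case/existsP: h => B /andP[]; exists B.
by case: h => B bB dB; apply/existsP; exists B; rewrite bB.
Qed.

Lemma circ_not_coloop C x : circ M C -> C \subset W -> x \in C -> [set x] \in indep (dual M).
Proof.
move=> cC CW xC; apply/coindepP; split; first by rewrite sub1set (subsetP CW).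
have [B bB CB] := indep_sub_basis (circ_D1 cC xC); exists B => //.
rewrite disjoints1; apply: contraNN (circ_sub cC (basis_indep bB)) => xB.
by rewrite -(setD1K xC) subUset sub1set xB.
Qed.

Lemma in_seriesP x y : x != y -> x \in W -> y \in W ->
  [set x] \in indep (dual M) -> [set y] \in indep (dual M) ->
  in_series M x y = ([set x; y] \notin indep (dual M)).
Proof.
move=> xy xW yW xI yI; rewrite /in_series /parallel xy circuitE subUset !sub1set.
have -> : ground (dual M) = W by [].
rewrite xW yW /=; apply/idP/idP => [/circ_dep //|dep].
apply/minsetP; split=> // B BI Bef; apply/eqP; rewrite eqEsubset Bef subUset !sub1set /=.
apply/andP; split; apply: contraR BI => nB.
  apply: indepS yI _; apply/subsetP => z zB; move: (subsetP Bef z zB).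
  by rewrite !inE => /orP[/eqP E|//]; rewrite -E zB in nB.
apply: indepS xI _; apply/subsetP => z zB; move: (subsetP Bef z zB).
by rewrite !inE => /orP[//|/eqP E]; rewrite -E zB in nB.
Qed.

(** A circuit does not meet a two-element cocircuit in a single element. If [y] were missing from
    [C], then [C :\ x] could be completed from a basis avoiding [y] to a basis avoiding both [x] and
    [y]. *)
Lemma in_series_circ x y C : in_series M x y -> circ M C -> x \in C -> y \in C.
Proof.
case/andP=> xy; rewrite circuitE => /andP[sub cxy] cC xC; apply/negPn/negP => yC.
have yI : [set y] \in indep (dual M).
  apply: (indepS (circ_D1 cxy (set21 x y))); rewrite sub1set !inE eqxx orbT andbT.
  by rewrite eq_sym.
have [_ [B bB]] := coindepP _ yI; rewrite disjoints1 => yB.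
have CxI := circ_D1 cC xC.
have [Z [ZI CZ ZC cZ]] := indep_extend CxI (basis_indep bB) (indep_le_basis bB CxI).
have xZ : x \notin Z.
  apply: contraNN (circ_sub cC ZI) => xZ.
  by rewrite -(setD1K xC) subUset sub1set xZ.
have yZ : y \notin Z.
  by apply/negP => /(subsetP ZC); rewrite !inE (negbTE yC) (negbTE yB) andbF.
case/negP: (circ_dep cxy); apply/coindepP; split=> //.
exists Z; first exact: basis_card bB ZI cZ.
by rewrite -setI_eq0 setIUl setU_eq0 !setI_eq0 !disjoints1 xZ.
Qed.

End Duality.

(** * Theta-graphs and theta-arcs in terms of circuit complements *)

Section ThetaParts.
Variables (T : finType) (M : matroid T) (X : {set T}).
Implicit Types (I C Y S A : {set T}) (P : {set {set T}}).
Hypothesis XG : X \subset ground M.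

Lemma ground_restrict : ground (restrict M X) = X.
Proof. by rewrite /ground /=; apply/setIidPr. Qed.

Lemma theta_in_parts : theta_in M X -> exists P, circuit_complements M X P /\ #|P| = 3.
Proof.
case=> _ [V [E [G [N [[u [v [p1 [p2 [p3 tp]]]]] [gN cN] /matroid_iso_sym[f [fb fi]]]]]]].
have [pP P3 cyP] := theta_cycles (tp : theta_paths G u v p1 p2 p3).
set P0 := [set _; _; _] in pP P3 cyP; rewrite -gN in pP.
have [pP' cP'] := iso_partition fb pP; rewrite ground_restrict in pP'.
exists (iso_image f @: P0); rewrite cP'; split=> //; split=> // C CX.
have CR : C \subset ground (restrict M X) by rewrite ground_restrict.
rewrite -(@circ_restrict _ M X C CX) -{1}(iso_imageK fb CR) -(iso_circ fb fi) ?iso_preimage_ground //.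
set D := iso_preimage f C; have DN : D \subset ground N by apply: iso_preimage_ground.
have -> : circ N D = (~: D \in P0).
  have -> : circ N D = circuit N D by rewrite circuitE gN subsetT.
  by apply/idP/idP => [/cN/cyP|/cyP/cN].
have [cP0 _ _] := and3P pP.
have -> : X :\: C = iso_image f (~: D).
  have -> : ~: D = ground N :\: D by rewrite gN setTD.
  rewrite iso_imageD // (iso_imageK fb CR); congr (_ :\: _).
  apply: (iso_set_eq fb); rewrite ?iso_image_ground ?ground_restrict // => x.
  rewrite mem_iso_image // (valP x).
  exact: (subsetP (subsetIr (ground M) X) _ (valP (f x))).
by rewrite iso_image_mem ?gN ?subsetT // => B _; rewrite gN subsetT.
Qed.

(** Cycles of a theta-graph see only whole arcs, so the elements of each part may be listed in any
    order to form a path. *)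
Lemma theta_in_of_parts P : circuit_complements M X P -> #|P| = 3 -> theta_in M X.
Proof.
move=> [pP inP] P3; split=> //.
set R := restrict M X.
have gR : ground R = X := ground_restrict.
have [f [fb fi]] := sub_matroid_iso R; set N := sub_matroid R in f fb fi *.
have gN : ground N = [set: {x : T | x \in ground R}] by [].
rewrite -gR in pP; have [pQ cQ] := iso_partition fb pP; rewrite P3 in cQ.
set Q := iso_image f @: P in pQ cQ.
have [A1 [A2 [A3 [A1Q A2Q A3Q A12 [A13 A23]]]]] := pick3 cQ.
have [cQ' tQ Q0] := and3P pQ.
have QE := set3_eq cQ A1Q A2Q A3Q A12 A13 A23.
have rc (A : {set {x : T | x \in ground R}}) : A \in Q -> exists m z, enum A = rcons m z.
  move=> AQ; move EA: (enum A) => s; case/lastP: s EA => [E0|m z _]; last by exists m, z.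
  case/negP: Q0; suff <- : A = set0 by [].
  by apply/eqP; rewrite -cards_eq0 cardE E0.
have [m1 [z1 E1]] := rc _ A1Q; have [m2 [z2 E2]] := rc _ A2Q; have [m3 [z3 E3]] := rc _ A3Q.
have pe : perm_eq (rcons m1 z1 ++ rcons m2 z2 ++ rcons m3 z3) (enum {: {x : T | x \in ground R}}).
  rewrite -E1 -E2 -E3; apply: uniq_perm; rewrite ?enum_uniq //.
    rewrite !cat_uniq !enum_uniq /= has_cat negb_or andbT -andbA.
    have dis (A B : {set {x : T | x \in ground R}}) : A \in Q -> B \in Q -> A != B -> ~~ has (mem (enum A)) (enum B).
      move=> AQ BQ AB; apply/hasPn => z; rewrite /= !mem_enum => zB.
      by apply: contraNN AB => zA; rewrite (trivIset_in tQ AQ BQ zA zB).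
    by rewrite !dis.
  move=> e; rewrite !mem_cat !mem_enum.
  have : e \in cover Q by rewrite (eqP cQ') gN inE.
  rewrite QE => /bigcupP[A]; rewrite !inE => /orP[/orP[]|] /eqP-> ->; by rewrite ?orbT.
have tp := theta_of_arcsP pe.
have [_ _ cy] := theta_cycles tp.
have es m z (A : {set {x : T | x \in ground R}}) : enum A = rcons m z ->
    edge_set (arc_path m1 m2 m3 (rcons m z)) = A.
  by move=> EA; apply/setP => e; rewrite inE arc_path_edges -EA mem_enum.
rewrite (es _ _ _ E1) (es _ _ _ E2) (es _ _ _ E3) -QE in cy.
exists _, {: {x : T | x \in ground R}}, (theta_of_arcs m1 m2 m3 z1 z2 z3), N; split.
- exists None, (Some None); do 3 eexists; exact: tp.
- split=> // C; apply: iff_trans (iff_sym (cy C)).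
  have -> : circuit N C = circ N C by rewrite circuitE gN subsetT.
  have CN : C \subset ground N by rewrite gN subsetT.
  rewrite -(iso_imageK fb CN) -(iso_circ fb fi) ?iso_preimage_ground //.
  set D := iso_preimage f C; have DR : D \subset ground R by apply: iso_preimage_ground.
  rewrite gR in DR; rewrite circ_restrict // inP //.
  have -> : ~: iso_image f D = iso_image f (X :\: D).
    rewrite -setTD -gN iso_imageD //; congr (_ :\: _).
    apply: (iso_set_eq fb); rewrite ?iso_image_ground // => x.
    rewrite mem_iso_image //; transitivity true; first exact: (valP (f x)).
    exact/esym/(subsetP (subsetIr (ground M) X) _ (valP x)).
  rewrite iso_image_mem ?gR ?subsetDl // => B BP.
  by have [cP _ _] := and3P pP; rewrite -gR -(eqP cP); apply: sub_cover.
exact: sub_matroid_iso.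
Qed.

Section SeriesClasses.
Variable P : {set {set T}}.
Hypothesis ccP : circuit_complements M X P.
Hypothesis P2 : 1 < #|P|.
Local Notation R := (restrict M X).

Lemma indep_complements I : I \subset X ->
  (I \in indep R) = [forall S in P, ~~ (X :\: S \subset I)].
Proof.
have [pP inP] := ccP; have [cP tP P0] := and3P pP.
move=> IX; rewrite indep_restrict IX andbT; apply/idP/forall_inP => [II S SP|h].
  apply: circ_sub II; rewrite inP ?subsetDl // setDDr setDv set0U (setIidPr _) //.
  by rewrite -(eqP cP) sub_cover.
apply/negPn/indepPn => -[C cC CI]; have CX := subset_trans CI IX.
have := h (X :\: C); rewrite -inP // => /(_ cC).
by rewrite setDDr setDv set0U (setIidPr CX) CI.
Qed.

Definition same_part e f := pblock P e == pblock P f.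

Lemma part_facts e : e \in X -> [/\ pblock P e \in P, e \in pblock P e & e \in cover P].
Proof.
have [pP _] := ccP; have [cP tP P0] := and3P pP.
by move=> eX; rewrite pblock_mem ?mem_pblock (eqP cP).
Qed.

Lemma part_pblock S e : S \in P -> e \in S -> pblock P e = S.
Proof. by have [/and3P[_ tP _] _] := ccP; apply: def_pblock. Qed.

(** The complement of the pair is a basis. It contains no circuit, as no part contains both
    elements; putting one of them back completes the circuit that misses the part of the other. *)
Lemma coindep_pair e f : e \in X -> f \in X -> ~~ same_part e f -> [set e; f] \in indep (dual R).
Proof.
move=> eX fX nef; rewrite inE powersetE ground_restrict subUset !sub1set eX fX /=.
have BX : X :\: [set e; f] \subset X by apply: subsetDl.
apply/existsP; exists (X :\: [set e; f]); rewrite -setI_eq0 setIDA setD_eq0 subsetIl andbT.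
apply/maxsetP; split.
  rewrite inE indep_complements //; apply/forall_inP => S SP; apply/negP => sub.
  have inS z : z \in X -> z \in [set e; f] -> z \in S.
    move=> zX zef; apply/negPn/negP => zS.
    by have := subsetP sub z; rewrite !inE zS zX in zef *; rewrite zef => /(_ isT).
  case/negP: nef; rewrite /same_part !(part_pblock SP) // inS // !inE eqxx ?orbT //.
move=> I; rewrite inE => II sub.
have IX : I \subset X by move: II; rewrite indep_restrict => /andP[].
have no z z' : z \in X -> z' \in X -> z \in I -> [set e; f] = [set z; z'] -> False.
  move=> zX z'X zI E; move: II; rewrite indep_complements // => /forall_inP.
  have [SP zS _] := part_facts z'X; move=> /(_ _ SP)/negP; apply.
  apply/subsetP => y; rewrite inE => /andP[yS yX].
  have [->//|yz] := eqVneq y z.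
  apply: (subsetP sub); rewrite E !inE yX (negbTE yz) andbT /=.
  by apply: contraNneq yS => ->.
apply/eqP; rewrite eqEsubset sub andbT; apply/subsetP => y yI.
rewrite inE (subsetP IX) // andbT !inE negb_or; apply/andP; split.
  by apply/eqP => E; rewrite E in yI; apply: (no e f eX fX yI).
by apply/eqP => E; rewrite E in yI; apply: (no f e fX eX yI); rewrite setUC.
Qed.

Lemma other_part e : e \in X -> exists2 f, f \in X & ~~ same_part e f.
Proof.
have [pP inP] := ccP; have [cP tP P0] := and3P pP.
move=> eX; have [|S SP] := @pick_other _ P [set pblock P e]; first by rewrite cards1.
rewrite inE => Se; have /set0Pn[f fS] : S != set0 by apply: contraNneq P0 => <-.
exists f; first by rewrite -(eqP cP); apply: (subsetP (sub_cover SP)).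
by rewrite /same_part (part_pblock SP fS) eq_sym.
Qed.

Lemma coindep_single e : e \in X -> [set e] \in indep (dual R).
Proof.
move=> eX; have [f fX nef] := other_part eX.
by apply: indepS (coindep_pair eX fX nef) _; rewrite sub1set !inE eqxx.
Qed.

(** If a basis avoided both, adding [f] would create a circuit through [f] that misses [e]; its
    complementary part contains [e], hence also [f]. *)
Lemma codep_pair e f : e \in X -> f \in X -> e != f -> same_part e f -> [set e; f] \notin indep (dual R).
Proof.
move=> eX fX ef sef; rewrite inE /= negb_and -implybE; apply/implyP => _.
apply/existsPn => B; rewrite negb_and -implybE; apply/implyP => bB.
apply/negP => dis; have [BI maxB] := maxsetP bB; rewrite inE in BI.
have BX : B \subset X by move: BI; rewrite indep_restrict => /andP[].
have fB : f \notin B by rewrite (disjointFr dis) // !inE eqxx orbT.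
have eB : e \notin B by rewrite (disjointFr dis) // !inE eqxx.
have fBX : f |: B \subset X by rewrite subUset sub1set fX.
suff fBI : f |: B \in indep R.
  by have := setU11 f B; rewrite (maxB (f |: B) fBI (subsetUr _ _)) (negbTE fB).
rewrite indep_complements //; apply/forall_inP => S SP; apply/negP => sub.
have eS : e \in S.
  by apply/negPn/negP => eS; have := subsetP sub e; rewrite !inE eS eX (negbTE ef) (negbTE eB) => /(_ isT).
have fS : f \in S by rewrite -(part_pblock SP eS) (eqP sef); case: (part_facts fX).
move: BI; rewrite indep_complements // => /forall_inP/(_ S SP)/negP; apply.
apply/subsetP => y yS; move: (subsetP sub y yS); rewrite !inE => /orP[/eqP E|//].
by move: yS; rewrite E inE fS.
Qed.

Lemma series_pair e f : e \in X -> f \in X -> e != f -> parallel (dual R) e f = same_part e f.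
Proof.
move=> eX fX ef; rewrite -/(in_series R e f) in_seriesP ?ground_restrict ?coindep_single //.
apply/idP/idP => [|sef]; last exact: codep_pair.
by apply: contraR => nef; apply: coindep_pair.
Qed.

Lemma no_coloop e : e \in X -> ~~ is_loop (dual R) e.
Proof.
move=> eX; rewrite /is_loop circuitE negb_and; apply/orP; right.
by apply/negP => /circ_dep; rewrite coindep_single.
Qed.

Lemma theta_arcP A : theta_arc M X A = (A \in P).
Proof.
have [pP inP] := ccP; have [cP tP P0] := and3P pP.
have sub S : S \in P -> S \subset X by rewrite -(eqP cP); apply: sub_cover.
have gD : ground (dual R) = X by rewrite /ground /= ground_restrict.
set pr := fun Y : {set T} => [&& Y \subset ground (dual R), [forall e in Y, ~~ is_loop (dual R) e]
  & [forall e in Y, forall f in Y, (e != f) ==> parallel (dual R) e f]].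
have prS S : S \in P -> pr S.
  move=> SP; have SX := sub S SP; rewrite /pr gD SX /=; apply/andP; split.
    by apply/forall_inP => e eS; apply: no_coloop; apply: (subsetP SX).
  apply/forall_inP => e eS; apply/forall_inP => f fS; apply/implyP => ef.
  by rewrite series_pair ?(subsetP SX) // /same_part !(part_pblock SP).
have prE Y a y : pr Y -> a \in Y -> y \in Y -> y \in pblock P a.
  move=> /and3P[]; rewrite gD => YX _ /forall_inP h aY yY.
  have [aX yX] := (subsetP YX _ aY, subsetP YX _ yY).
  have [<-|ay] := eqVneq a y; first by case: (part_facts aX).
  have /forall_inP/(_ y yY)/implyP/(_ ay) := h a aY.
  by rewrite series_pair // /same_part => /eqP->; case: (part_facts yX).
apply/idP/idP => [/maxsetP[prA maxA]|AP].
  (* The empty set satisfies [pr] too, but it lies below any part and is not maximal. *)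
  have [a aA] : exists a, a \in A.
    apply/set0Pn/negP => /eqP A0.
    have /card_pick[S SP] : 0 < #|P| by apply: ltnW.
    case/negP: P0; rewrite -A0 -(maxA S (prS S SP)) // A0 sub0set //.
  have aX : a \in X by move: prA => /and3P[+ _ _]; rewrite gD => /subsetP; apply.
  have [SP aS _] := part_facts aX.
  rewrite -(maxA _ (prS _ SP)) //; apply/subsetP => y; exact: prE.
apply/maxsetP; split; first exact: prS.
move=> Y prY AY; apply/eqP; rewrite eqEsubset AY andbT; apply/subsetP => y yY.
have /set0Pn[a aA] : A != set0 by apply: contraNneq P0 => <-.
by rewrite -(part_pblock AP aA); apply: prE (subsetP AY _ aA) yY.
Qed.

End SeriesClasses.
End ThetaParts.

(** * The adjacency graph of a theta-ordering *)

Section CyclicOrders.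
Variable T : finType.
Implicit Types (s : seq T) (x y : T).

Lemma adjacent_sym s : symmetric (adjacent s).
Proof. by move=> x y; rewrite /adjacent eq_sym orbC. Qed.

Lemma next_neq s x : uniq s -> x \in s -> 1 < size s -> next s x != x.
Proof.
move=> us xs; case: (rot_to xs) => i s' E.
rewrite -(next_rot i us) -(size_rot i s) E.
have : uniq (x :: s') by rewrite -E rot_uniq.
case: s' {E} => //= y s' /andP[xs' _] _; rewrite eqxx.
by apply: contraNneq xs' => ->; apply: mem_head.
Qed.

(** Separates successor from predecessor, which gives degree exactly two in cycles of length at
    least three. *)
Lemma next2_neq s x : uniq s -> x \in s -> 2 < size s -> next s (next s x) != x.
Proof.
move=> us xs; case: (rot_to xs) => i s' E.
rewrite -!(next_rot i us) -(size_rot i s) E.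
have : uniq (x :: s') by rewrite -E rot_uniq.
case: s' {E} => [|y [|z s']] //= /and3P[xs' _ _] _; rewrite eqxx.
have yx : (y == x) = false.
  by apply: contraNF xs' => /eqP->; apply: mem_head.
rewrite yx eqxx; apply: contraNneq xs' => ->; by rewrite !inE eqxx orbT.
Qed.

Lemma next_closed s (B : {set T}) x : uniq s -> x \in s -> x \in B ->
  (forall y, y \in B -> y \in s -> next s y \in B) -> {subset s <= B}.
Proof.
move=> us xs xB clB y ys.
have : fconnect (next s) x y.
  by have h := fconnect_cycle (cycle_next us) xs y; rewrite ys in h.
move=> /iter_findex <-; elim: (findex _ _ _) => [|n IHn] //=; apply: clB => //.
by elim: n {IHn} => [|n IHn] //=; rewrite mem_next.
Qed.

End CyclicOrders.

Section OrderingGraph.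
Variables (T : finType) (M : matroid T) (w : {set T} -> seq T).
Hypothesis w_theta : theta_ordering M w.
Local Notation W := (ground M).

Definition ordering_graph : rel T := fun x y =>
  [exists C : {set T}, [&& circuit M C, x \in C, y \in C & adjacent (w C) x y]].
Local Notation G := ordering_graph.

Lemma order_uniq C : circuit M C -> uniq (w C) /\ w C =i C.
Proof.
move=> cC; have [mo _ _] := w_theta; have pe := mo C cC.
by split; [rewrite (perm_uniq pe) enum_uniq | move=> x; rewrite (perm_mem pe) mem_enum].
Qed.

Lemma order_size C : circuit M C -> size (w C) = #|C|.
Proof. by move=> cC; have [mo _ _] := w_theta; rewrite (perm_size (mo C cC)) -cardE. Qed.

Lemma ordering_graphE C x y : circuit M C -> x \in C -> y \in C ->
  G x y = adjacent (w C) x y.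
Proof.
have [_ co _] := w_theta.
move=> cC xC yC; apply/existsP/idP => [[C' /and4P[cC' xC' yC' a]]|a].
  have xy : x != y by case/andP: a.
  by apply: (co x y C' C xy cC' cC _ a); rewrite subUset !sub1set !inE xC xC' yC yC'.
by exists C; rewrite cC xC yC.
Qed.

Lemma ordering_graph_sym : symmetric G.
Proof.
by move=> x y; apply: eq_existsb => C; rewrite adjacent_sym; do 3 case: (_ \in C); rewrite ?andbF // andbA [_ && (x \in C)]andbC.
Qed.

Lemma ordering_graph_irr : irreflexive G.
Proof. by move=> x; apply/existsP => -[C /and4P[_ _ _]]; rewrite /adjacent eqxx. Qed.

Lemma circW C : circ M C -> C \subset W -> circuit M C.
Proof. by move=> cC CW; rewrite circuitE CW. Qed.

Lemma ordering_graph_deg (C : {set T}) v : circ M C -> C \subset W -> 2 < #|C| -> v \in C ->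
  degree_in G v C = 2.
Proof.
move=> /circW h /h cC C3 vC; have [us ms] := order_uniq cC.
have sz := order_size cC; rewrite -sz in C3.
have vs : v \in w C by rewrite ms.
have nC : next (w C) v \in C by rewrite -ms mem_next.
have pC : prev (w C) v \in C by rewrite -ms mem_prev.
have nv := next_neq us vs (ltnW C3).
have pv : prev (w C) v != v.
  have ps : prev (w C) v \in w C by rewrite mem_prev.
  by have := next_neq us ps (ltnW C3); rewrite next_prev // eq_sym.
have np : next (w C) v != prev (w C) v.
  have := next2_neq us vs C3; apply: contraNneq => ->.
  by rewrite next_prev.
have E u : u \in C -> G v u = (u == next (w C) v) || (u == prev (w C) v).
  move=> uC; rewrite (ordering_graphE cC vC uC) /adjacent.
  have -> : (next (w C) u == v) = (u == prev (w C) v).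
    by apply/eqP/eqP => [<-|->]; rewrite ?next_prev ?prev_next.
  rewrite [next _ v == u]eq_sym; case: (v =P u) => [<-|_] //=.
  by rewrite ![v == _]eq_sym (negbTE nv) (negbTE pv).
rewrite /degree_in (@bigD1 _ _ _ T (next (w C) v)) //= (@bigD1 _ _ _ T (prev (w C) v)) /= ?pC 1?eq_sym ?np //.
rewrite !E // !eqxx orbT big1 // => u /andP[/andP[uC un] up].
by rewrite E // (negbTE un) (negbTE up).
Qed.

Lemma ordering_graph_conn C (B : {set T}) : circ M C -> C \subset W -> 2 < #|C| -> B \subset C -> B != set0 ->
  (forall v u, v \in B -> u \in C -> G v u -> u \in B) -> B = C.
Proof.
move=> /circW h /h cC C3 BC /set0Pn[x xB] clB; have [us ms] := order_uniq cC.
apply/eqP; rewrite eqEsubset BC; apply/subsetP => y; rewrite -ms; move: y.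
apply: (next_closed us _ xB); first by rewrite ms (subsetP BC).
move=> y yB ys; have nC : next (w C) y \in C by rewrite -ms mem_next.
apply: (clB y) => //; rewrite (ordering_graphE cC (subsetP BC _ yB) nC) /adjacent eqxx.
by rewrite eq_sym next_neq // order_size // ltnW.
Qed.

(** With three parts, [A] is a theta-arc and thus a block in a circuit containing it. In the listing
    of a block of at least two elements, every entry has an adjacent entry. *)
Lemma ordering_graph_arc (X : {set T}) (P : {set {set T}}) (A : {set T}) v :
  X \subset W -> circuit_complements M X P -> #|P| = 3 ->
  A \in P -> 1 < #|A| -> v \in A -> exists2 u, u \in A & G v u.
Proof.
move=> XW ccP P3 AP A2 vA.
have [_ _ blk] := w_theta.
have ti := theta_in_of_parts XW ccP P3.
have ta : theta_arc M X A by rewrite (theta_arcP XW ccP) ?P3.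
have [pP inP] := ccP; have [cP tP P0] := and3P pP.
have [B BP] : exists2 B, B \in P & B \notin [set A] by apply: pick_other; rewrite P3 cards1.
rewrite inE => BA; have cC := complements_circ ccP BP.
have CW : X :\: B \subset W by apply: subset_trans (subsetDl _ _) XW.
have AC : A \subset X :\: B.
  rewrite subsetD -(eqP cP) sub_cover //=; apply: (trivIsetP tP) => //; by rewrite eq_sym.
have cC' := circW cC CW.
have [b pb sb] := blk X A ti ta _ cC' AC.
have mb : b =i A by move=> x; rewrite (perm_mem pb) mem_enum.
have sz : size b = #|A| by rewrite (perm_size pb) -cardE.
have vb : v \in b by rewrite mb.
have AG u : u \in b -> adjacent (w (X :\: B)) v u -> G v u.
  rewrite mb => uA; by rewrite (ordering_graphE cC') // (subsetP AC).
have : exists2 u, u \in b & adjacent (w (X :\: B)) v u.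
  case/splitPr: {mb AG} vb sb sz => b1 b2; case: b2 => [|u b2].
    case/lastP: b1 => [|b1 u]; first by move=> _ /= A1; rewrite -A1 in A2.
    rewrite cat_rcons; case: b1 => [|y b1] /=.
      by move=> /andP[uv _] _; exists u; rewrite ?inE ?eqxx // adjacent_sym.
    rewrite cat_path /= => /and3P[_ _ /andP[uv _]] _; exists u; last by rewrite adjacent_sym.
    by rewrite inE mem_cat inE eqxx !orbT.
  move=> sb _; exists u; first by rewrite mem_cat !inE eqxx !orbT.
  case: b1 sb => [|y b1] /=; first by case/andP.
  by rewrite cat_path /= => /and3P[_ _ /andP[]].
by case=> u ub a; exists u; [rewrite -mb | apply: AG].
Qed.

Theorem theta_ordering_structure : connected M -> ~ binary M ->
  exists Q : {set {set T}}, [/\ utype M Q, 4 <= #|Q|, forall A B, A \in Q -> B \in Q -> #|A| = #|B| &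
    forall e, e \in W -> e \notin cover Q -> exists2 z, z \in cover Q & circ M [set e; z]].
Proof.
move=> conn /nonbinary_part[X [P [XW pP P4 inP]]].
have [|Q [uQ Q4 mQ par]] := maximal_utype ordering_graph_sym ordering_graph_irr ordering_graph_deg
  ordering_graph_conn ordering_graph_arc conn XW _ P4; first by split.
exists Q; split => // A B AQ BQ.
exact: (matched_card ordering_graph_sym mQ AQ BQ).
Qed.

End OrderingGraph.

(** * Duality and contraction *)

Section Contraction.
Variables (T : finType) (M : matroid T).
Implicit Types (X Y C B : {set T}).
Local Notation W := (ground M).

Lemma ground_contract Y : Y \subset W -> ground (contract M Y) = W :\: Y.
Proof. by move=> YW; rewrite /ground /=; apply/setIidPr/subsetDl. Qed.

(** [contract] passes through the dual twice. The bases of the intermediate matroid are the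
    complements of the bases of [M] that contain [Y], and such bases exist because [Y] is
    independent. *)
Lemma indep_contract Y X : Y \in indep M ->
  (X \in indep (contract M Y)) = (X \subset W :\: Y) && (X :|: Y \in indep M).
Proof.
move=> YI; have YW := indep_ground YI.
have cobasis B : basis M B -> Y \subset B -> basis (delete (dual M) Y) (W :\: B).
  move=> bB YB; apply/maxsetP; split.
    rewrite /= indep_restrict /= (_ : ground (dual M) = W) // setDS // andbT.
    by apply/coindepP; split; [apply: subsetDl | exists B => //; rewrite -setI_eq0 setIC setIDA setD_eq0 subsetIl].
  move=> I; rewrite /= indep_restrict => /andP[/coindepP[IW [B' bB' dB']] IY] sub.
  apply/eqP; rewrite eq_sym eqEcard sub /=.
  have BW := indep_ground (basis_indep bB); have B'W := indep_ground (basis_indep bB').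
  have cB : #|B| = #|B'|.
    by apply/eqP; rewrite eqn_leq (indep_le_basis bB' (basis_indep bB)) (indep_le_basis bB (basis_indep bB')).
  apply: (@leq_trans #|W :\: B'|).
    by apply/subset_leq_card; rewrite subsetD IW.
  by rewrite !cardsD (setIidPr BW) (setIidPr B'W) cB.
rewrite /contract; apply/idP/andP => [|[XW XYI]].
  case/coindepP.
  rewrite (_ : ground (delete _ _) = W :\: Y); last exact: ground_contract.
  move=> XW [B' bB' dXB']; split=> //.
  have [/= B'I maxB'] := maxsetP bB'.
  move: B'I; rewrite indep_restrict => /andP[/coindepP[B'W [B bB dB]] B'Y].
  have BW := indep_ground (basis_indep bB).
  have [Z [ZI YZ ZYB cZ]] := indep_extend YI (basis_indep bB) (indep_le_basis bB YI).
  have bZ := basis_card bB ZI cZ.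
  have ZW := indep_ground ZI.
  have B'WZ : B' = W :\: Z.
    apply/esym; apply: maxB'; last first.
      rewrite subsetD B'W /=; apply: disjointWr ZYB _.
      rewrite -setI_eq0 setIUr setU_eq0 !setI_eq0 dB andbT.
      by move: B'Y; rewrite subsetD => /andP[].
    by have [/= ] := maxsetP (cobasis Z bZ YZ).
  apply: indepS ZI _; rewrite subUset YZ andbT; apply/subsetP => x xX.
  apply/negPn/negP => xZ; have : x \in B'.
    by rewrite B'WZ inE xZ (subsetP (subset_trans XW (subsetDl _ _))).
  by rewrite (disjointFr dXB' xX).
have [B bB XYB] := indep_sub_basis XYI.
apply/coindepP; split; first by rewrite (_ : ground (delete _ _) = W :\: Y) //; apply: ground_contract.
exists (W :\: B).
  by apply: cobasis => //; apply: subset_trans XYB; apply: subsetUr.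
rewrite disjoint_sym -setI_eq0 setIDAC setD_eq0; apply: subset_trans (subsetIr _ _) _.
by apply: subset_trans XYB; apply: subsetUl.
Qed.

End Contraction.

Lemma matroid_iso_refl (T : finType) (M : matroid T) : matroid_iso M M.
Proof. by exists id; split; [exists id | move=> X]. Qed.

(** * Equal series classes as a balanced series extension of a uniform matroid *)

Section UniformCore.
Variables (T : finType) (M : matroid T) (Q : {set {set T}}).
Hypothesis uQ : utype M Q.
Hypothesis Q4 : 4 <= #|Q|.
Variable k : nat.
Hypothesis cardQ : forall A, A \in Q -> #|A| = k.
Local Notation Z := (cover Q).
Local Notation N := (restrict M Z).

Lemma utype_indep (I : {set T}) : I \subset Z ->
  (I \in indep N) = (#|[set S in Q | S \subset I]| <= 2).
Proof.
have [tP P0 PW cP] := uQ.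
move=> IZ; rewrite indep_restrict IZ andbT; apply/idP/idP => [II|le].
  rewrite leqNgt; apply/negP => gt.
  have [|||R [_ RS R3]] := @card_between _ set0 [set S in Q | S \subset I] 3 => //.
  - exact: sub0set.
  - by rewrite cards0.
  have RQ : R \subset Q by apply: subset_trans RS _; apply/subsetP => S; rewrite inE => /andP[].
  apply: (negP (circ_sub (utype_circ uQ RQ R3) II)).
  by apply/bigcupsP => S /(subsetP RS); rewrite inE => /andP[].
apply/negPn/indepPn => -[C cC CI].
have [R [RQ R3 E]] := (cP C (subset_trans CI IZ)).1 cC.
suff : 2 < 2 by [].
apply: leq_trans le; rewrite -R3; apply: subset_leq_card; apply/subsetP => S SR.
by rewrite inE (subsetP RQ) //= (subset_trans _ CI) // E sub_cover.
Qed.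

(** All elements of a class pick the same element; the default concerns elements off the core
    only. *)
Definition representative (x : T) := odflt x [pick y in pblock Q x].
Local Notation p := representative.
Local Notation R := (p @: Z).

Lemma representative_in S x : S \in Q -> x \in S -> p x \in S /\ forall y, y \in S -> p y = p x.
Proof.
have [tP P0 PW cP] := uQ; move=> SQ xS.
have E y : y \in S -> pblock Q y = S by apply: def_pblock.
split; first by rewrite /p E //; case: pickP => //= /(_ x); rewrite xS.
by move=> y yS; rewrite /p !E //; case: pickP => //= /(_ x); rewrite xS.
Qed.

Lemma representativeK S x y : S \in Q -> x \in S -> y \in R -> y \in S -> y = p x.
Proof.
have [tP P0 PW cP] := uQ.
move=> SQ xS /imsetP[z zZ ->] pzS.
have /bigcupP[S' S'Q zS'] := zZ.
have [pzS' _] := representative_in S'Q zS'.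
have ES := trivIset_in tP S'Q SQ pzS' pzS; rewrite ES in zS'.
by have [_ h] := representative_in SQ xS; apply: h.
Qed.

Lemma reps_sub : R \subset Z.
Proof.
apply/subsetP => _ /imsetP[x /bigcupP[S SQ xS] ->].
by apply/bigcupP; exists S => //; have [] := representative_in SQ xS.
Qed.

(** [Z :\: R] lacks exactly one element of each class, so adding the representative is what
    completes the class. Contracting [Z :\: R] therefore turns the bound on full classes into a
    bound on size. *)
Lemma card_reps (X : {set T}) : X \subset R ->
  #|[set S in Q | S \subset X :|: (Z :\: R)]| = #|X|.
Proof.
have [tP P0 PW cP] := uQ => XR.
have inZ x : x \in X -> pblock Q x \in Q /\ x \in pblock Q x.
  by move=> xX; have xZ := subsetP reps_sub _ (subsetP XR _ xX); rewrite pblock_mem ?mem_pblock.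
have -> : [set S in Q | S \subset X :|: (Z :\: R)] = pblock Q @: X.
  apply/setP => S; rewrite inE; apply/andP/imsetP => [[SQ sub]|[x xX ->]].
    have /set0Pn[x xS] : S != set0 by apply: contraNneq P0 => <-.
    have [pS _] := representative_in SQ xS.
    have pR : p x \in R by apply: imset_f; apply: (subsetP (sub_cover SQ)).
    exists (p x); last by rewrite (def_pblock tP SQ pS).
    by have := subsetP sub _ pS; rewrite inE in_setD pR orbF.
  have [SQ xS] := inZ x xX; split=> //; apply/subsetP => y yS; rewrite inE in_setD.
  have [yR|yR] := boolP (y \in R); last by rewrite (subsetP (sub_cover SQ)) ?orbT.
  rewrite orbF (representativeK SQ xS yR yS) -(representativeK SQ xS (subsetP XR _ xX) xS) //.
rewrite card_in_imset // => x y xX yX E.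
have [SQ xS] := inZ x xX; have [_ yS] := inZ y yX; rewrite -E in yS.
by rewrite (representativeK SQ xS (subsetP XR _ xX) xS) -(representativeK SQ xS (subsetP XR _ yX) yS).
Qed.

Lemma ground_core : ground N = Z.
Proof. by have [_ _ ZW _] := uQ; apply: ground_restrict. Qed.

Local Notation U := (contract N (Z :\: R)).

Lemma ground_reps : ground U = R.
Proof.
rewrite ground_contract ?ground_core ?subsetDl // setDDr setDv set0U.
by apply/setIidPr/reps_sub.
Qed.

Lemma indep_reps (X : {set T}) : (X \in indep U) = (X \subset R) && (#|X| <= 2).
Proof.
have ZN : Z :\: R \in indep N.
  rewrite utype_indep ?subsetDl //.
  by have := card_reps (sub0set R); rewrite set0U cards0 => ->.
rewrite indep_contract // ground_core setDDr setDv set0U (setIidPr reps_sub).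
have [XR|//] := boolP (X \subset R); rewrite utype_indep ?card_reps //=.
by rewrite subUset (subset_trans XR reps_sub) subsetDl.
Qed.

Lemma card_all_reps : #|R| = #|Q|.
Proof.
rewrite -(card_reps (subxx _)); apply: eq_card => S; rewrite inE.
have [SQ|//] := boolP (S \in Q); rewrite /=; apply: subset_trans (sub_cover SQ) _.
by rewrite -{1}(setID Z R) setSU // subsetIr.
Qed.

Lemma reps_iso : matroid_iso U (uniform 2 [set: 'I_#|R|]).
Proof.
have [x0 x0R] : exists x, x \in R.
  by apply: card_pick; rewrite card_all_reps; apply: leq_trans Q4.
have UR : ground U \subset R by rewrite ground_reps.
have inR (x : {x | x \in ground U}) : val x \in R := subsetP UR _ (valP x).
have outR (i : {i : 'I_#|R| | i \in ground (uniform 2 [set: 'I_#|R|])}) :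
    enum_val (val i) \in ground U by rewrite ground_reps enum_valP.
pose f (x : {x | x \in ground U}) : {i | i \in ground (uniform 2 [set: 'I_#|R|])} :=
  exist _ (enum_rank_in x0R (val x)) (in_setT _).
have f_bij : bijective f.
  exists (fun i => Sub (enum_val (val i)) (outR i)) => [x|i]; apply: val_inj => /=.
    exact: enum_rankK_in (inR x).
  exact: enum_valK_in.
exists f; split=> // X.
have c1 : #|[set val x | x in X]| = #|X| by apply: card_imset; exact: val_inj.
have c2 : #|[set val (f x) | x in X]| = #|X|.
  by apply: card_imset; exact: inj_comp val_inj (bij_inj f_bij).
rewrite indep_reps c1 [RHS]inE powersetE subsetT c2 andb_idl // => _.
by apply/subsetP => _ /imsetP[x _ ->]; exact: inR.
Qed.

Lemma utype_not_coloop x : x \in Z -> [set x] \in indep (dual N).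
Proof.
have [tP P0 PW cP] := uQ => /bigcupP[S SQ xS].
have [|||R' [SR' R'Q R'3]] := @card_between _ [set S] Q 3.
- by rewrite sub1set.
- by rewrite cards1.
- exact: ltnW.
have CZ := coverS R'Q.
apply: (@circ_not_coloop _ N (cover R')); rewrite ?ground_core //.
  by rewrite circ_restrict // (utype_circ uQ).
by apply: (subsetP (sub_cover _)) xS; rewrite -sub1set.
Qed.

Lemma core_balanced : balanced_series_ext U N.
Proof.
have [tP P0 PW cP] := uQ.
have RZ := reps_sub; have pS := representative_in.
split.
- move=> e; rewrite /is_loop circuitE; apply/negP => /andP[eU /circ_dep/negP]; apply.
  rewrite sub1set in eU; have eR : e \in R by rewrite -ground_reps.
  apply/coindepP; split; first by rewrite sub1set.
  have [||B [_ BR B2]] := @card_between _ set0 (R :\ e) 2 (sub0set _); first by rewrite cards0.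
    have Re : #|R| = #|R :\ e|.+1 by rewrite (cardsD1 e R) eR.
    by rewrite -ltnS -Re card_all_reps ltnW.
  move: BR; rewrite subsetD1 => /andP[BR eB]; exists B; last by rewrite disjoints1.
  apply/maxsetP; split; first by rewrite /= indep_reps BR B2.
  move=> I; rewrite /= indep_reps => /andP[IR I2] BI.
  by apply/eqP; rewrite eq_sym eqEcard BI B2.
- by rewrite ground_reps ground_core.
- by rewrite ground_core ground_reps.
exists k, p; split.
- have /card_pick[A AQ] : 0 < #|Q| by apply: leq_trans Q4.
  by rewrite -(cardQ AQ) card_gt0; apply: contraNneq P0 => <-.
- by move=> x; rewrite ground_core ground_reps; apply: imset_f.
- move=> e; rewrite ground_reps ground_core => eR.
  have /bigcupP[S SQ eS] := subsetP RZ _ eR.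
  have pe : p e = e by apply/esym; apply: (representativeK SQ eS).
  split=> //; rewrite -(cardQ SQ); apply: eq_card => x; rewrite inE; apply/andP/idP.
    case=> /bigcupP[S' S'Q xS'] /eqP pxe; have [h _] := pS _ _ S'Q xS'.
    by rewrite pxe in h; rewrite (trivIset_in tP SQ S'Q eS h).
  move=> xS; split; first exact: (subsetP (sub_cover SQ)).
  by have [_ h] := pS _ _ SQ eS; rewrite h // pe.
move=> x y; rewrite ground_core => xZ yZ xy pxy.
rewrite in_seriesP ?ground_core ?utype_not_coloop //.
have /bigcupP[S SQ xS] := xZ; have /bigcupP[S' S'Q yS'] := yZ.
have SS' : S = S'.
  have [h _] := pS _ _ SQ xS; have [h' _] := pS _ _ S'Q yS'.
  by rewrite -pxy in h'; exact: trivIset_in tP SQ S'Q h h'.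
(* If a basis missed both [x] and [y], adding [x] would complete no class, since the class of [x]
   still lacks [y]; the larger set would be independent. *)
subst S'; apply/negP => /coindepP[_ [B bB dB]].
have BI := basis_indep bB; have BZ := indep_ground BI; rewrite ground_core in BZ.
have xB : x \notin B by rewrite (disjointFr dB) // !inE eqxx.
have yB : y \notin B by rewrite (disjointFr dB) // !inE eqxx orbT.
have xBZ : x |: B \subset Z by rewrite subUset sub1set xZ.
have := indep_le_basis bB (_ : x |: B \in indep N).
rewrite cardsU1 xB ltnn => h; suff : false by []; apply: h.
move: BI; rewrite !utype_indep // => /(leq_trans _); apply.
apply: subset_leq_card; apply/subsetP => S1; rewrite !inE => /andP[S1Q S1B]; rewrite S1Q /=.
apply/subsetP => z zS; move: (subsetP S1B z zS); rewrite !inE => /orP[/eqP E|//].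
have : y \in S1 by rewrite (trivIset_in tP S1Q SQ zS) // E.
by move=> /(subsetP S1B); rewrite !inE (negbTE yB) eq_sym (negbTE xy).
Qed.

(** Elements off the core are added one at a time, each parallel to an element of the core, which is
    present from the start. *)
Lemma core_parallel_ext :
  (forall e, e \in ground M -> e \notin Z -> exists2 z, z \in Z & circ M [set e; z]) ->
  parallel_ext N M.
Proof.
have [tP P0 PW cP] := uQ; move=> par.
suff h n (X : {set T}) : Z \subset X -> X \subset ground M -> #|X :\: Z| = n -> parallel_ext N (restrict M X).
  have E : restrict M (ground M) = M.
    apply: matroid_ext; first by rewrite ground_restrict.
    by apply/setP => I; rewrite indep_restrict andb_idr //; apply: indep_ground.
  by have := h _ _ PW (subxx _) erefl; rewrite E.
elim: n X => [|n IHn] X ZX XG Xn.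
  have -> : X = Z by apply/eqP; rewrite eqEsubset ZX -setD_eq0 -cards_eq0 Xn eqxx.
  exact: rt_refl.
have /set0Pn[e] : X :\: Z != set0 by rewrite -cards_eq0 Xn.
rewrite inE => /andP[eZ eX].
have ZXe : Z \subset X :\ e by rewrite subsetD1 ZX.
apply: (@rt_trans _ _ _ (restrict M (X :\ e))).
  apply: IHn => //; first exact: subset_trans (subD1set _ _) XG.
  have -> : X :\ e :\: Z = (X :\: Z) :\ e by rewrite !setDDl setUC.
  by apply: card_setD1 Xn; rewrite inE eZ.
have [z zZ cez] := par e (subsetP XG _ eX) eZ.
have ez : e != z by apply: contraNneq eZ => ->.
apply: rt_step; exists e, z; split.
  have sub : [set e; z] \subset X by rewrite subUset !sub1set eX (subsetP ZX).
  by rewrite /parallel ez circuitE ground_restrict // sub circ_restrict.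
have gE : ground (delete (restrict M X) [set e]) = ground (restrict M (X :\ e)).
  rewrite /delete /ground /= -/(ground M).
  by apply/setP => x; rewrite !inE; case: (x \in X); case: (x \in ground M); rewrite ?andbF ?andbT.
apply: matroid_ext => //.
apply/setP => I; rewrite !indep_restrict ground_restrict // -andbA; congr (_ && _).
by rewrite andb_idl // => h; apply: subset_trans h (subD1set _ _).
Qed.

Theorem utype_realizes : (forall e, e \in ground M -> e \notin Z -> exists2 z, z \in Z & circ M [set e; z]) ->
  exists (n : nat) (T' : finType) (U N P : matroid T'),
    [/\ 4 <= n, matroid_iso U (uniform 2 [set: 'I_n]), balanced_series_ext U N,
        parallel_ext N P & matroid_iso M P].
Proof.
move=> par; exists #|R|, T, U, N, M; split.
- by rewrite card_all_reps.
- exact: reps_iso.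
- exact: core_balanced.
- exact: core_parallel_ext.
- exact: matroid_iso_refl.
Qed.

End UniformCore.

(** * Parallel extensions of balanced series extensions *)

Section Blowups.
Variables (T : finType) (n k : nat).
Implicit Types (phi : T -> 'I_n * 'I_k.+1) (X : {set T}).

Definition full_fibres phi X := [set i | [forall t, (i, t) \in phi @: X]].

(** The condition mentions neither the uniform matroid nor the order of the extensions, so it can be
    carried along one parallel element at a time. Positions are taken in ['I_k.+1] to have a cyclic
    successor on them. *)
Definition blowup_map (M : matroid T) phi :=
  (forall q, exists2 x, x \in ground M & phi x = q) /\
  forall X, X \subset ground M ->
    (X \in indep M) = (#|phi @: X| == #|X|) && (#|full_fibres phi X| <= 2).

End Blowups.

(* [M] is a parallel extension of a [k.+1]-fold balanced series extension of
   U_{2,n}: [phi x] names the line of U_{2,n} and the position in its series class. *)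
Definition blowup (T : finType) (M : matroid T) :=
  exists (n k : nat) (phi : T -> 'I_n * 'I_k.+1), 4 <= n /\ blowup_map M phi.

(** * Coordinates on a balanced series extension *)

Section BalancedBlowup.
Variables (T : finType) (U N : matroid T) (n : nat).
Hypothesis n4 : 4 <= n.
Hypothesis isoU : matroid_iso U (uniform 2 [set: 'I_n]).
Hypothesis balUN : balanced_series_ext U N.
Implicit Types (X Y C J : {set T}).

(** The elements of a fibre are in series, so a circuit of [N] is a union of fibres. Hence [X] is
    independent exactly when [J :|: Y] is, where [J] marks the fibres contained in [X]; and this
    means that [J] is independent in the contraction [U]. *)
Lemma balanced_blowup : blowup N.
Proof.
have [_ UN conU [k [p [k0 pU pk ser]]]] := balUN.
have [f [fb fi]] := isoU.
set Y := ground N :\: ground U in conU.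
case: k k0 pk => // k _ pk.
pose F e := [set x in ground N | p x == e].
have pp x : x \in ground N -> p (p x) = p x by move=> xN; have [] := pk _ (pU _ xN).
have fibre C x y : circ N C -> x \in C -> x \in ground N -> y \in ground N -> p x = p y -> y \in C.
  move=> cC xC xN yN pxy; have [<- //|xy] := eqVneq x y.
  exact: in_series_circ (ser x y xN yN xy pxy) cC xC.
have YI : Y \in indep N.
  apply/negPn/indepPn => -[C cC CY]; have /set0Pn[x xC] := circ_neq0 cC.
  have xN : x \in ground N by have := subsetP CY _ xC; rewrite inE => /andP[].
  have pxN : p x \in ground N by apply: (subsetP UN); apply: pU.
  have := fibre C x (p x) cC xC xN pxN (esym (pp x xN)).
  by move=> /(subsetP CY); rewrite inE pU.
have gY : ground N :\: Y = ground U by rewrite /Y setDDr setDv set0U; apply/setIidPr.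
pose i0 := Ordinal (leq_trans (isT : 0 < 4) n4).
pose g (e : T) : 'I_n := if insub e is Some e' then val (f e') else i0.
have gE (x : {x | x \in ground U}) : g (val x) = val (f x) by rewrite /g valK.
have gsub e (eU : e \in ground U) : g e = val (f (Sub e eU)) by rewrite -gE.
have g_inj : {in ground U &, injective g}.
  move=> x y xU yU; rewrite (gsub x xU) (gsub y yU) => /val_inj/(bij_inj fb) E.
  exact: (congr1 val E).
have g_surj i : exists2 e, e \in ground U & g e = i.
  have [h fK hK] := fb.
  have iG : i \in ground (uniform 2 [set: 'I_n]) by rewrite inE.
  by exists (val (h (Sub i iG))); [apply: valP | rewrite gE hK].
have indepU J : J \subset ground U -> (J \in indep U) = (#|J| <= 2).
  move=> JU; rewrite (iso_indep fi) // inE powersetE subsetT /=.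
  suff -> : iso_image f J = g @: J.
    by rewrite card_in_imset // => x y /(subsetP JU) xU /(subsetP JU) yU; apply: g_inj.
  apply/setP => i; apply/imsetP/imsetP => [[x + ->]|[x xJ ->]].
    by rewrite inE => xJ; exists (val x); rewrite // gE.
  have xU := subsetP JU _ xJ; exists (Sub x xU); last by rewrite gsub.
  by rewrite inE.
have indepJ J : J \subset ground U -> (J :|: Y \in indep N) = (#|J| <= 2).
  by move=> JU; rewrite -indepU // -conU indep_contract // gY JU.
pose phi x : 'I_n * 'I_k.+1 := (g (p x), inord (index x (enum (F (p x))))).
have xF x : x \in ground N -> x \in enum (F (p x)).
  by move=> xN; rewrite mem_enum inE xN eqxx.
have szF e : e \in ground U -> size (enum (F e)) = k.+1.
  by move=> eU; rewrite -cardE; have [] := pk e eU.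
have ltF x : x \in ground N -> index x (enum (F (p x))) < k.+1.
  by move=> xN; rewrite -(szF (p x) (pU x xN)) index_mem xF.
have phi_inj : {in ground N &, injective phi}.
  move=> x y xN yN [/g_inj E /(congr1 val)]; have {}E := E (pU x xN) (pU y yN).
  rewrite /= !inordK ?ltF // -E => Ei.
  have yFx : y \in enum (F (p x)) by rewrite E xF.
  by rewrite -(nth_index x (xF x xN)) Ei nth_index.
have phi_surj q : exists2 x, x \in ground N & phi x = q.
  case: q => i t; have [e eU <-] := g_surj i.
  have tF : t < size (enum (F e)) by rewrite szF.
  have xFe := mem_nth e tF; set x := nth e _ t in xFe.
  have := xFe; rewrite mem_enum inE => /andP[xN /eqP px].
  exists x => //; rewrite /phi px; congr (_, _); apply: val_inj.
  by rewrite /= inordK /x index_uniq ?enum_uniq // -(szF e eU).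
exists n, k, phi; split=> //; split=> // X XN.
have phi_injX : #|phi @: X| == #|X|.
  by apply/imset_injP => x y /(subsetP XN) xN /(subsetP XN) yN; apply: phi_inj.
rewrite phi_injX /=; pose J := [set e in ground U | F e \subset X].
have JU : J \subset ground U by apply/subsetP => e; rewrite inE => /andP[].
have -> : full_fibres phi X = g @: J.
  apply/setP => i; rewrite inE; apply/forallP/imsetP => [full|[e]].
    have [e eU ei] := g_surj i; exists e => //; rewrite inE eU /=.
    apply/subsetP => x; rewrite inE => /andP[xN /eqP px].
    have /imsetP[x' x'X E] := full (phi x).2.
    rewrite (phi_inj x x') // ?(subsetP XN) // -E.
    by rewrite -ei -px.
  rewrite inE => /andP[eU FX] -> t; have [x xN E] := phi_surj (g e, t).
  rewrite -E; apply: imset_f; apply: (subsetP FX); rewrite inE xN.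
  by case: E => Eg _; apply/eqP; apply: g_inj (pU x xN) eU Eg.
rewrite card_in_imset; last by move=> x y /(subsetP JU) xU /(subsetP JU) yU; apply: g_inj.
(* In both directions the same circuit works, because it contains the whole fibre of each of its
   elements. *)
rewrite -indepJ //; apply/idP/idP; apply: contraTT => /indepPn[C cC sub]; apply/indepPn; exists C => //.
  have CN : C \subset ground N.
    by apply: subset_trans sub _; rewrite subUset (subset_trans JU UN) subsetDl.
  apply/subsetP => y yC; have yN := subsetP CN _ yC.
  have pyN : p y \in ground N := subsetP UN _ (pU y yN).
  have pyC := fibre C y (p y) cC yC yN pyN (esym (pp y yN)).
  have : p y \in J.
    by have := subsetP sub _ pyC; rewrite inE [_ \in Y]inE pU //= orbF.
  by rewrite inE => /andP[_ /subsetP]; apply; rewrite inE yN eqxx.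
have CN := subset_trans sub XN.
apply/subsetP => y yC; have yN := subsetP CN _ yC; rewrite inE [y \in Y]inE yN andbT.
have [yU|yU] := boolP (y \in ground U); rewrite ?orbT //= orbF inE yU /=.
apply/subsetP => x; rewrite inE => /andP[xN /eqP px]; apply: (subsetP sub).
by apply: (fibre C y) => //; rewrite px; have [] := pk y yU.
Qed.

End BalancedBlowup.

(** A circuit of the new set that uses [f] can be eliminated at [f] against the parallel pair, which
    leaves a circuit inside [X]. *)
Lemma parallel_swap (T : finType) (M : matroid T) (X : {set T}) e f :
  circ M [set e; f] -> e \in X -> f \notin X ->
  X \in indep M -> f |: X :\ e \in indep M.
Proof.
move=> cef eX fX; have fe : f != e by apply: contraNneq fX => ->.
apply: contraTT => /indepPn[C cC sub]; apply/indepPn.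
have [fC|fC] := boolP (f \in C); last first.
  by exists C => //; clear -sub fC; set_solve.
have ne : C != [set e; f].
  by apply: contraTneq sub => ->; rewrite subUset !sub1set !inE eqxx eq_sym (negbTE fe).
have [C3 c3 s3] := circ_elim_weak cC cef ne fC (set22 e f).
by exists C3 => //; clear -s3 sub eX; set_solve.
Qed.

(** The new element [e] takes the coordinates of its partner [f], and independence is compared by
    swapping the two. *)
Lemma blowup_parallel_ext1 (T : finType) (N M : matroid T) :
  parallel_ext1 N M -> blowup N -> blowup M.
Proof.
case=> e [f [/andP[ef cef'] NE]] [n [k [phi [n4 [surj ind]]]]].
move: cef'; rewrite circuitE subUset !sub1set => /andP[/andP[eM fM] cef].
have gN : ground N = ground M :\ e.
  by rewrite -NE ground_restrict // subsetDl.
have iN (X : {set T}) : X \subset ground M :\ e -> (X \in indep N) = (X \in indep M).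
  by move=> XM; rewrite -NE indep_restrict XM andbT.
pose psi x := if x == e then phi f else phi x.
have psiE x : x != e -> psi x = phi x by rewrite /psi => /negbTE->.
exists n, k, psi; split=> //; split=> [q|X XM].
  have [x xN <-] := surj q; move: xN; rewrite gN !inE => /andP[xe xM].
  by exists x => //; rewrite psiE.
have [eX|eX] := boolP (e \in X); last first.
  have XN : X \subset ground M :\ e by rewrite subsetD1 XM.
  have E : psi @: X = phi @: X.
    by apply: eq_in_imset => x xX; apply: psiE; apply: contraNneq eX => <-.
  by rewrite /full_fibres E -iN // ind ?gN.
have [fX|fX] := boolP (f \in X).
  have -> : (X \in indep M) = false.
    by apply/negbTE/indepPn; exists [set e; f]; rewrite // subUset !sub1set eX.
  rewrite (_ : _ == _ = false) //; apply/negP => /imset_injP/(_ e f eX fX).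
  by rewrite /psi eqxx eq_sym (negbTE ef) => /(_ erefl) E; rewrite E eqxx in ef.
set X' := f |: X :\ e.
have X'N : X' \subset ground M :\ e.
  by rewrite subUset sub1set !inE fM eq_sym ef setSD.
have E : psi @: X = phi @: X'.
  rewrite -{1}(setD1K eX) !imsetU !imset_set1 {1}/psi eqxx; congr (_ :|: _).
  by apply: eq_in_imset => x; rewrite !inE => /andP[xe _]; apply: psiE.
have cX : #|X'| = #|X|.
  by rewrite /X' cardsU1 !inE (negbTE fX) andbF (cardsD1 e X) eX.
rewrite /full_fibres E -cX -ind ?gN // iN //.
apply/idP/idP; first exact: parallel_swap.
have XE : X = e |: X' :\ f.
  by rewrite /X' setU1K ?setD1K // !inE (negbTE fX) andbF.
rewrite {1}XE; apply: parallel_swap; first by rewrite setUC.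
  exact: setU11.
by rewrite !inE eqxx (negbTE ef).
Qed.

Lemma blowup_parallel_ext (T : finType) (N M : matroid T) :
  parallel_ext N M -> blowup N -> blowup M.
Proof.
elim=> [N' M'|//|A B C _ IH1 _ IH2 /IH1/IH2 //]; exact: blowup_parallel_ext1.
Qed.

Lemma blowup_iso (T T' : finType) (M : matroid T) (P : matroid T') :
  matroid_iso M P -> blowup P -> blowup M.
Proof.
case=> f [fb fi] [n [k [phi [n4 [surj ind]]]]].
pose q0 : 'I_n * 'I_k.+1 := (Ordinal (leq_trans (isT : 0 < 4) n4), ord0).
pose psi (x : T) := if insub x is Some x' then phi (val (f x')) else q0.
have psiE (x : {x | x \in ground M}) : psi (val x) = phi (val (f x)) by rewrite /psi valK.
exists n, k, psi; split=> //; split=> [q|X XM].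
  have [y yP <-] := surj q; have [x ->] := iso_surj fb yP.
  by exists (val x); [apply: valP | rewrite psiE].
have E : psi @: X = phi @: iso_image f X.
  apply/setP => q; apply/imsetP/imsetP => [[x xX ->]|[y /imsetP[x + ->] ->]].
    have xM := subsetP XM _ xX; exists (val (f (Sub x xM))).
      by rewrite mem_iso_image.
    by rewrite -psiE.
  by rewrite inE => xX; exists (val x); rewrite ?psiE.
have c : #|iso_image f X| = #|X|.
  rewrite card_imset; last exact: inj_comp val_inj (bij_inj fb).
  rewrite -(card_imset _ (@val_inj _ _ {x | x \in ground M})); apply: eq_card => x.
  apply/imsetP/idP => [[x' + ->]|xX]; first by rewrite inE.
  by exists (Sub x (subsetP XM _ xX)); rewrite ?inE.
by rewrite (iso_indep fi) // ind ?iso_image_ground // /full_fibres E c.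
Qed.

(** * A consistent ordering *)

Lemma block1 (T : finType) (s : seq T) x : block s [set x].
Proof. by exists [:: x]; rewrite ?enum_set1. Qed.

(** Cutting the cycle at [c] leaves a path through the other elements. *)
Lemma block_setD1 (T : finType) (s : seq T) (A : {set T}) c : uniq s -> c \in s -> 1 < size s ->
  s =i c |: A -> c \notin A -> block s A.
Proof.
move=> us cs s2 sE cA; have [i s' E] := rot_to cs.
have us' : uniq (c :: s') by rewrite -E rot_uniq.
have mem' x : (x \in s') = (x \in A).
  have : (x \in c :: s') = (x \in c |: A) by rewrite -E mem_rot sE.
  rewrite in_setU1 inE; have [->|//] := eqVneq x c.
  by rewrite (negbTE cA); case/andP: us' => /negbTE->.
exists s'.
  apply: uniq_perm; rewrite ?enum_uniq //; first by case/andP: us'.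
  by move=> x; rewrite mem' mem_enum.
have := cycle_next us; rewrite -(rot_cycle i) E /= rcons_path => /andP[+ _].
have : all (mem s) (c :: s').
  by apply/allP => x; rewrite -E mem_rot.
case: s' {E us' mem'} => [//|y s'] /= /andP[_ ally] /andP[_ py].
apply: (@sub_in_path _ (mem s) (frel (next s)) (adjacent s)) py => // u v us_ _ /eqP uv.
by rewrite /adjacent -{1}uv eq_sym next_neq //= uv eqxx.
Qed.

(** * The cyclic successor on three lines *)

Section FibreOrder.
Variables (n k : nat).
Implicit Types (q : 'I_n * 'I_k.+1).

(* Along a circuit with lines [i < j < l] the cyclic order runs
   (i,t), (j,t+1), (l,t+2), (i,t+1): the resulting adjacency depends only on
   the two elements, and the three shifts add up to 1, so there is one cycle. *)
Definition succ_pos (h : 'I_n * 'I_n * 'I_n) q :=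
  if q.1 == h.1.1 then (h.1.2, ordS q.2) else
  if q.1 == h.1.2 then (h.2, ordS q.2) else (h.1.1, ord_pred q.2).

Definition adjacent_pos q q' :=
  ((q.1 < q'.1) && (q'.2 == ordS q.2)) || ((q'.1 < q.1) && (q.2 == ordS q'.2)).

Definition lines (h : 'I_n * 'I_n * 'I_n) : {set 'I_n} := [set h.1.1; h.1.2; h.2].
Definition increasing (h : 'I_n * 'I_n * 'I_n) := (h.1.1 < h.1.2) && (h.1.2 < h.2).

Lemma increasing_neq h : increasing h ->
  [/\ (h.1.1 == h.1.2) = false, (h.1.1 == h.2) = false, (h.1.2 == h.2) = false,
     (h.1.2 == h.1.1) = false & (h.2 == h.1.1) = false /\ (h.2 == h.1.2) = false].
Proof.
case/andP=> ij jl; have il := ltn_trans ij jl.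
have neq (a b : 'I_n) : a < b -> (a == b) = false /\ (b == a) = false.
  by move=> ab; rewrite eq_sym -(inj_eq val_inj) gtn_eqF.
by have [-> ->] := neq _ _ ij; have [-> ->] := neq _ _ jl; have [-> ->] := neq _ _ il.
Qed.

Lemma succ_pos_lines h q : (succ_pos h q).1 \in lines h.
Proof.
by rewrite /succ_pos /lines; case: ifP => _ /=; [|case: ifP => _ /=]; rewrite !inE eqxx ?orbT.
Qed.

(** The right-hand side no longer mentions [h]: this independence of the three lines is what makes
    the ordering consistent. *)
Lemma succ_pos_adjacent h q q' : increasing h -> q.1 \in lines h -> q'.1 \in lines h ->
  (succ_pos h q == q') || (succ_pos h q' == q) = adjacent_pos q q'.
Proof.
move=> inc; have [ij il jl ji [li lj]] := increasing_neq inc.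
case/andP: inc => lij ljl; have lil := ltn_trans lij ljl.
case: h ij il jl ji li lj lij ljl lil => [[i j] l] /= ij il jl ji li lj lij ljl lil.
have nS (a b : 'I_k.+1) : (ord_pred a == b) = (a == ordS b).
  by apply/eqP/eqP => [<-|->]; rewrite ?ord_predK ?ordSK.
have gt (a b : 'I_n) : a < b -> (b < a) = false by move=> h; apply/negbTE; rewrite -leqNgt ltnW.
case: q q' => [a t] [b u]; rewrite !inE /succ_pos /adjacent_pos /=.
by case/orP => [/orP[]|] /eqP-> /orP[/orP[]|] /eqP->;
  rewrite ?eqxx ?ij ?il ?jl ?ji ?li ?lj !xpair_eqE ?eqxx ?ij ?il ?jl ?ji ?li ?lj ?ltnn
    ?lij ?ljl ?lil ?(gt _ _ lij) ?(gt _ _ ljl) ?(gt _ _ lil) ?nS //= ?orbF // 1?eq_sym.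
Qed.

Lemma succ_pos_inj h : increasing h -> {in [pred q | q.1 \in lines h] &, injective (succ_pos h)}.
Proof.
move=> inc; have [ij il jl ji [li lj]] := increasing_neq inc.
case: h ij il jl ji li lj {inc} => [[i j] l] /= ij il jl ji li lj.
case=> [a t] [b u]; rewrite !inE /succ_pos /=.
case/orP => [/orP[]|] /eqP-> /orP[/orP[]|] /eqP->;
  rewrite ?eqxx ?ij ?il ?jl ?ji ?li ?lj => E;
  have /= /eqP := congr1 fst E; have /= := congr1 snd E; rewrite ?ij ?il ?jl ?ji ?li ?lj //.
- by move=> /(can_inj (@ordSK _))->.
- by move=> /(can_inj (@ordSK _))->.
- by move=> /(can_inj (@ord_predK _))->.
Qed.

End FibreOrder.

(** * The ordering of the circuits and its thetas *)

Section BlowupOrder.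
Variables (T : finType) (M : matroid T) (n k : nat) (phi : T -> 'I_n * 'I_k.+1).
Hypothesis phiM : blowup_map M phi.
Local Notation W := (ground M).
Implicit Types (C X A J : {set T}).

(** Two elements with equal coordinates are already dependent, and so are the elements over three
    full lines; minimality of the circuit gives equality in either case. *)
Lemma blowup_circ_cases C : circuit M C ->
  (exists e f, [/\ e != f, C = [set e; f] & phi e = phi f]) \/
  {in C &, injective phi} /\ exists L : {set 'I_n}, #|L| = 3 /\ phi @: C = [set q | q.1 \in L].
Proof.
rewrite circuitE => /andP[CW cC]; have [_ ind] := phiM.
have [inj|ninj] := boolP (#|phi @: C| == #|C|); last first.
  left; have : ~~ dinjectiveb phi (mem C).
    by apply: contra ninj => /dinjectiveP inj; apply/imset_injP.
  case/dinjectivePn => e eC [f]; rewrite inE => /andP[fe fC] E.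
  have ef : e != f by rewrite eq_sym.
  exists e, f; split=> //; apply/esym.
  have sub : [set e; f] \subset C by rewrite subUset !sub1set eC.
  case/minsetP: cC => _; apply=> //; rewrite ind ?(subset_trans sub) //.
  by rewrite imsetU !imset_set1 E setUid cards1 cards2 ef.
right; split; first exact/imset_injP.
have := circ_dep cC; rewrite ind // inj /= -ltnNge => gt2.
have [|||L [_ sub L3]] := @card_between _ set0 (full_fibres phi C) 3 => //.
- exact: sub0set.
- by rewrite cards0.
exists L; split=> //; pose C0 := [set x in C | (phi x).1 \in L].
have C0C : C0 \subset C by apply/subsetP => x; rewrite inE => /andP[].
have fullL i t : i \in L -> (i, t) \in phi @: C.
  by move=> /(subsetP sub); rewrite inE => /forallP.
have C0E : C0 = C.
  case/minsetP: cC => _; apply=> //; rewrite ind ?(subset_trans C0C) // negb_and; apply/orP; right.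
  rewrite -ltnNge -L3; apply/subset_leq_card/subsetP => i iL; rewrite inE; apply/forallP => t.
  have /imsetP[x xC E] := fullL i t iL; rewrite E; apply: imset_f.
  by rewrite inE xC -E.
apply/setP => -[i t]; rewrite inE /=; apply/idP/idP => [/imsetP[x + E]|/fullL//].
by rewrite -C0E inE -E => /andP[].
Qed.

Lemma exists_increasing (L : {set 'I_n}) : #|L| = 3 -> exists2 h, increasing h & lines h = L.
Proof.
move=> L3.
have [a [b [c [aL bL cL ab [ac bc]]]]] := pick3 L3.
have LE := set3_eq L3 aL bL cL ab ac bc.
have lt (x y : 'I_n) : x != y -> (x < y) || (y < x) by rewrite -neq_ltn.
have E (x y z : 'I_n) : [set x; y; z] = [set y; x; z] by rewrite (setUC [set x]).
have E' (x y z : 'I_n) : [set x; y; z] = [set x; z; y] by rewrite -!setUA (setUC [set y]).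
rewrite LE; case/orP: (lt _ _ ab) => h1; case/orP: (lt _ _ ac) => h2; case/orP: (lt _ _ bc) => h3.
- by exists (a, b, c); rewrite // /increasing h1.
- by exists (a, c, b); rewrite /lines /= 1?E' // /increasing h2.
- by have := ltn_trans h2 (ltn_trans h1 h3); rewrite ltnn.
- by exists (c, a, b); rewrite /lines /= ?(E c a) ?(E' a c) // /increasing h2.
- by exists (b, a, c); rewrite /lines /= 1?E // /increasing h1.
- by have := ltn_trans h1 (ltn_trans h2 h3); rewrite ltnn.
- by exists (b, c, a); rewrite /lines /= ?(E' b c) ?(E b a) // /increasing h3.
- by exists (c, b, a); rewrite /lines /= ?(E c b) ?(E' b c) ?(E b a) // /increasing h3.
Qed.

Definition large_circuit C h :=
  [&& increasing h, #|phi @: C| == #|C| & phi @: C == [set q | q.1 \in lines h]].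

(** Lifts [succ_pos] to a large circuit through the injective [phi]; on its elements a preimage
    always exists and the default is not taken. *)
Definition next_on C h x := odflt x [pick y in C | phi y == succ_pos h (phi x)].

(** Any admissible [h] and any starting point will do, since the adjacencies do not depend on them.
    A parallel pair is listed by [enum]. *)
Definition blowup_order C : seq T :=
  if [pick h | large_circuit C h] is Some h then
    if [pick x in C] is Some x then orbit (next_on C h) x else [::]
  else enum C.

Lemma next_onP C h x : large_circuit C h -> x \in C ->
  next_on C h x \in C /\ phi (next_on C h x) = succ_pos h (phi x).
Proof.
case/and3P=> inc inj /eqP im xC; rewrite /next_on; case: pickP => [y /andP[yC /eqP]//|no].
have : succ_pos h (phi x) \in phi @: C by rewrite im inE succ_pos_lines.
by case/imsetP => y yC E; have := no y; rewrite yC E eqxx.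
Qed.

(** The orbit is all of [C]: three steps lead from the lowest line back to it with the position
    advanced by one, so all positions on this line are reached, and every element arrives there
    within two steps. *)
Lemma large_orderP C h : large_circuit C h -> C != set0 -> exists h',
  [/\ large_circuit C h', uniq (blowup_order C), blowup_order C =i C &
    forall x, x \in C -> next (blowup_order C) x = next_on C h' x].
Proof.
move=> lh C0; rewrite /blowup_order.
case: pickP => [h' lh'|/(_ h)]; last by rewrite lh.
case: pickP => [x0 x0C|no]; last first.
  by case/set0Pn: C0 => x xC; have := no x; rewrite xC.
have [inc inj /eqP im] := and3P lh'; move/imset_injP: inj => inj.
have inL x : x \in C -> (phi x).1 \in lines h'.
  by move=> xC; have : phi x \in phi @: C by [apply: imset_f]; rewrite im inE.
pose g := next_on C h'.
have gC : {in C, forall x, g x \in C} by move=> x xC; have [] := next_onP lh' xC.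
have gphi x : x \in C -> phi (g x) = succ_pos h' (phi x) by move=> xC; have [] := next_onP lh' xC.
have ginj : {in C &, injective g}.
  move=> x y xC yC E; apply: inj => //; apply: (succ_pos_inj inc); [exact: inL | exact: inL |].
  by rewrite -!gphi ?E.
have fc : fcycle g (orbit g x0) by apply: (cycle_orbit_in gC ginj).
have memo : orbit g x0 =i C.
  move=> y; apply/idP/idP => [/trajectP[m _ ->]|yC].
    by elim: m => [|m IHm] //=; apply: gC.
  rewrite -fconnect_orbit.
  (* An injective map on a finite set has cyclic orbits, so reachability is symmetric. *)
  have csym x z : x \in C -> fconnect g x z -> fconnect g z x.
    move=> xC; rewrite fconnect_orbit => zo.
    by rewrite (fconnect_cycle (cycle_orbit_in gC ginj xC) zo) -fconnect_orbit connect0.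
  have step x : x \in C -> fconnect g x (g x) by move=> _; apply: fconnect1.
  have [ij il jl ji [li lj]] := increasing_neq inc.
  have triple x : x \in C -> exists z, [/\ z \in C, fconnect g x z, (phi z).1 = h'.1.1 & True].
    move=> xC; have := inL x xC; rewrite !inE => /orP[/orP[]|] /eqP E.
    - by exists x.
    - exists (g (g x)); split; rewrite ?gC //.
        exact: connect_trans (fconnect1 _ _) (fconnect1 _ _).
      by rewrite !gphi ?gC // /succ_pos E ji eqxx /= li lj.
    - exists (g x); split; rewrite ?gC ?fconnect1 //.
      by rewrite gphi // /succ_pos E li lj.
  have shift m x : x \in C -> (phi x).1 = h'.1.1 -> exists z, [/\ z \in C, fconnect g x z,
      (phi z).1 = h'.1.1 & (phi z).2 = iter m (@ordS k.+1) (phi x).2].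
    elim: m => [|m IHm] xC E; first by exists x.
    have [z [zC xz z1 z2]] := IHm xC E.
    exists (g (g (g z))); split; rewrite ?gC //.
    - apply: connect_trans xz _; apply: connect_trans (fconnect1 _ _) _.
      exact: connect_trans (fconnect1 _ _) (fconnect1 _ _).
    - by rewrite !gphi ?gC // /succ_pos z1 eqxx /= ji eqxx /= li lj.
    - by rewrite !gphi ?gC // /succ_pos z1 eqxx /= ji eqxx /= li lj /= ordSK -z2.
  have [z0 [z0C x0z0 z01 _]] := triple x0 x0C.
  have [z1 [z1C yz1 z11 _]] := triple y yC.
  (* The number of shifts is the difference of the two positions modulo [k.+1], with [k.+1] added to
     stay in the natural numbers. *)
  have [z [zC z0z zz1 zz2]] := shift ((phi z1).2 + (k.+1 - (phi z0).2)) z0 z0C z01.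
  apply: connect_trans x0z0 _; apply: connect_trans z0z _.
  suff -> : z = z1 by apply: csym.
  apply: inj => //; rewrite [LHS]surjective_pairing [RHS]surjective_pairing zz1 z11; congr (_, _).
  apply: val_inj; rewrite zz2.
  have iterS m (a : 'I_k.+1) : val (iter m (@ordS k.+1) a) = (a + m) %% k.+1.
    elim: m => [|m IHm] /=; first by rewrite addn0 modn_small.
    by rewrite IHm -addn1 modnDml addn1 addnS.
  rewrite iterS addnCA subnKC ?modnDr ?modn_small //; exact: ltnW.
exists h'; split=> //.
by move=> x; rewrite -memo => xo; have /eqP := next_cycle fc xo.
Qed.

Lemma blowup_adjacent C h x y : large_circuit C h -> x \in C -> y \in C ->
  adjacent (blowup_order C) x y = adjacent_pos (phi x) (phi y).
Proof.
move=> lh xC yC; have C0 : C != set0 by apply/set0Pn; exists x.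
have [h' [lh' _ _ nx]] := large_orderP lh C0.
have [inc inj /eqP im] := and3P lh'; move/imset_injP: inj => inj.
have inL z : z \in C -> (phi z).1 \in lines h'.
  by move=> zC; have : phi z \in phi @: C by [apply: imset_f]; rewrite im inE.
have eqg u v : u \in C -> v \in C -> (next_on C h' u == v) = (succ_pos h' (phi u) == phi v).
  move=> uC vC; have [gC <-] := next_onP lh' uC.
  by apply/eqP/eqP => [->|/inj->].
rewrite /adjacent !nx // !eqg // succ_pos_adjacent ?inL //.
have [->|//] := eqVneq x y.
by rewrite /adjacent_pos ltnn.
Qed.

Lemma blowup_circ_large C : circuit M C ->
  (exists e f, [/\ e != f, C = [set e; f] & phi e = phi f]) \/ exists h, large_circuit C h.
Proof.
case/blowup_circ_cases => [|[inj [L [L3 im]]]]; [by left | right].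
have [h inc hL] := exists_increasing L3; exists h.
by rewrite /large_circuit inc im hL eqxx -im andbT; apply/imset_injP.
Qed.

Lemma card_large_circuit C h : large_circuit C h -> #|C| = 3 * k.+1.
Proof.
case/and3P=> inc /eqP <- /eqP ->.
have -> : [set q | q.1 \in lines h] = setX (lines h) [set: 'I_k.+1].
  by apply/setP => -[i t]; rewrite in_setX in_setT andbT inE.
rewrite cardsX cardsT card_ord; congr (_ * _).
have [ij il jl ji [li lj]] := increasing_neq inc.
by rewrite /lines cards3 ?ij ?il ?jl.
Qed.

Lemma blowup_order_perm C : circuit M C -> perm_eq (blowup_order C) (enum C).
Proof.
rewrite circuitE => /andP[_ /circ_neq0 C0].
have [/existsP[h lh]|/existsPn no] := boolP [exists h, large_circuit C h].
  have [h' [_ us ms _]] := large_orderP lh C0.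
  by apply: uniq_perm; rewrite ?enum_uniq // => x; rewrite ms mem_enum.
by rewrite /blowup_order; case: pickP => // h lh; have := no h; rewrite lh.
Qed.

(** A parallel pair shares two elements with no other circuit. Two distinct circuits with two common
    elements are therefore both large, and [adjacent_pos] refers to neither. *)
Lemma blowup_order_consistent : consistent M blowup_order.
Proof.
move=> e f C C' ef cC cC' sub.
have [eCC fCC] : e \in C :&: C' /\ f \in C :&: C' by move: sub; rewrite subUset !sub1set => /andP.
move: eCC fCC; rewrite !inE => /andP[eC eC'] /andP[fC fC'].
have small D D' a b : D = [set a; b] -> circuit M D -> circuit M D' -> e \in D -> f \in D ->
    e \in D' -> f \in D' -> D = D'.
  move=> E; rewrite !circuitE => /andP[_ cD] /andP[_ cD'] eD fD eD' fD'.
  apply: (circ_inj cD cD'); suff -> : D = [set e; f] by rewrite subUset !sub1set eD'.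
  apply/eqP; rewrite eq_sym eqEcard subUset !sub1set eD fD /=.
  by rewrite E !cards2 ef; case: (a != b).
case: (blowup_circ_large cC) => [[a [b [_ E _]]]|[h lh]].
  by rewrite (small C C' a b).
case: (blowup_circ_large cC') => [[a [b [_ E _]]]|[h' lh']].
  by rewrite (small C' C a b).
by rewrite (blowup_adjacent lh eC fC) (blowup_adjacent lh' eC' fC').
Qed.

(* In a theta without a parallel pair every line of U_{2,n} would lie in zero
   or two of the three circuits, which together use 9 lines. *)
Lemma theta_parallel_pair X P : X \subset W -> circuit_complements M X P -> #|P| = 3 ->
  exists2 S, S \in P & #|X :\: S| = 2.
Proof.
move=> XW ccP P3; have [pP inP] := ccP; have [cP tP P0] := and3P pP.
have [S1 [S2 [S3 [S1P S2P S3P n12 [n13 n23]]]]] := pick3 P3.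
have cS S : S \in P -> circuit M (X :\: S).
  move=> SP; rewrite circuitE (complements_circ ccP SP) andbT.
  exact: subset_trans (subsetDl _ _) XW.
have cases S : S \in P -> #|X :\: S| = 2 \/ exists h, large_circuit (X :\: S) h.
  move=> SP; case: (blowup_circ_large (cS S SP)) => [[e [f [ef -> _]]]|]; last by right.
  by left; rewrite cards2 ef.
case: (cases _ S1P) => [c|[h1 l1]]; first by exists S1.
case: (cases _ S2P) => [c|[h2 l2]]; first by exists S2.
case: (cases _ S3P) => [c|[h3 l3]]; first by exists S3.
exfalso.
(* The presence of line [i] in a large circuit is tested at the single position [ord0]; this turns
   lines into element counts, which add up over the parts. *)
pose c (S : {set T}) i := \sum_(x in S) (phi x == (i, ord0)).
have count C h i : large_circuit C h -> c C i = (i \in lines h).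
  case/and3P=> _ /imset_injP inj /eqP im; rewrite /c.
  have [il|il] := boolP (i \in lines h).
    have : (i, ord0) \in phi @: C by rewrite im inE.
    case/imsetP => x xC E; rewrite E (bigD1 x) //= eqxx big1 // => y /andP[yC yx].
    by rewrite (inj_in_eq inj) // (negbTE yx).
  rewrite big1 // => y yC; case: eqP => // E; case/negP: il.
  have : phi y \in phi @: C by apply: imset_f.
  by rewrite im inE E.
have sub S : S \in P -> S \subset X by rewrite -(eqP cP); apply: sub_cover.
have dis S S' : S \in P -> S' \in P -> S != S' -> [disjoint S & S'] by move=> *; apply: (trivIsetP tP).
have XE : X = S1 :|: S2 :|: S3.
  by rewrite -(eqP cP) (set3_eq P3 S1P S2P S3P n12 n13 n23) cover3.
have cU (A B : {set T}) i : [disjoint A & B] -> c (A :|: B) i = c A i + c B i.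
  move=> d; rewrite /c (@big_setID _ _ _ _ (A :|: B) A) (setIidPr (subsetUl A B)) /=.
  by have -> : (A :|: B) :\: A = B by clear -d; set_solve.
have d12 := dis _ _ S1P S2P n12; have d13 := dis _ _ S1P S3P n13; have d23 := dis _ _ S2P S3P n23.
have E1 : X :\: S1 = S2 :|: S3 by rewrite XE; clear -d12 d13; set_solve.
have E2 : X :\: S2 = S1 :|: S3 by rewrite XE; clear -d12 d23; set_solve.
have E3 : X :\: S3 = S1 :|: S2 by rewrite XE; clear -d13 d23; set_solve.
have cl h : increasing h -> \sum_i (i \in lines h : nat) = 3.
  move=> inc; rewrite -big_mkcond /= sum1_card.
  have [ij il jl ji [li lj]] := increasing_neq inc.
  by rewrite /lines cards3 ?ij ?il ?jl.
have : \sum_i ((i \in lines h1) + (i \in lines h2) + (i \in lines h3)) = 9.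
  rewrite !big_split /= !cl //; first by case/and3P: l3.
    by case/and3P: l2.
  by case/and3P: l1.
(* Each part lies in two of the three circuits, so the total is even. *)
rewrite (eq_bigr (fun i => 2 * (c S1 i + c S2 i + c S3 i))); last first.
  move=> i _; rewrite -(count _ _ i l1) -(count _ _ i l2) -(count _ _ i l3) E1 E2 E3 !cU //.
  move: (c S1 i) (c S2 i) (c S3 i) => a b d; clear; lia.
by rewrite -big_distrr /= => /(congr1 odd); rewrite oddM.
Qed.

(** One circuit of a theta is a parallel pair, whose elements are singleton arcs. The third arc [S],
    if it has at least two elements, is a large circuit minus one element. As all large circuits
    have the same size, every circuit containing [S] has exactly one more element, and a cycle minus
    one element is a block. *)
Lemma blowup_order_theta : theta_ordering M blowup_order.
Proof.
split; [exact: blowup_order_perm | exact: blowup_order_consistent |].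
move=> X A tX tA C cC AC; have [XW _] := tX.
have [P [ccP P3]] := theta_in_parts XW tX.
move: tA; rewrite (theta_arcP XW ccP) ?P3 // => AP.
have [pP inP] := ccP; have [cP tP P0] := and3P pP.
have [S SP S2] := theta_parallel_pair XW ccP P3.
have ne0 B : B \in P -> 0 < #|B| by move=> BP; rewrite card_gt0; apply: contraNneq P0 => <-.
have single : #|A| <= 1 -> block (blowup_order C) A.
  move=> A1; have /eqP/cards1P[a ->] : #|A| = 1 by apply/eqP; rewrite eqn_leq A1 ne0.
  exact: block1.
have [/single//|A2] := leqP #|A| 1.
have sub B : B \in P -> B \subset X by rewrite -(eqP cP); apply: sub_cover.
have [Q [QP Q2 XSE]] : exists Q : {set {set T}}, [/\ Q = P :\ S, #|Q| = 2 & X :\: S = cover Q].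
  by exists (P :\ S); rewrite cover_setD1 // (eqP cP) (card_setD1 SP P3).
have sumQ : \sum_(B in Q) #|B| = 2.
  by rewrite -S2 XSE; apply/eqP; have := trivIsetS (subD1set P S) tP; rewrite QP.
have one B : B \in Q -> #|B| = 1.
  move=> BQ; have [B' B'Q] : exists B', B' \in Q :\ B by apply: card_pick; rewrite (card_setD1 BQ Q2).
  have Q1 := card_setD1 BQ Q2; move/eqP/cards1P: Q1 => [D QD].
  have DQ : D \in Q by have := set11 D; rewrite -QD inE => /andP[].
  have BP : B \in P by move: BQ; rewrite QP inE => /andP[].
  have DP : D \in P by move: DQ; rewrite QP inE => /andP[].
  move: sumQ; rewrite (bigD1 B) //= (eq_bigl (mem [set D])); last first.
    by move=> Y; rewrite -QD !inE andbC.
  rewrite big_set1; have := ne0 B BP; have := ne0 D DP; clear.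
  by case: #|B| => [|[|b]] //; case: #|D| => [|d] //; rewrite !addSn addnS.
have AS : A = S.
  apply/eqP/negPn/negP => AS; have AQ : A \in Q by rewrite QP !inE AS.
  by move: A2; rewrite one.
subst A.
have [B BQ] : exists B, B \in Q by apply: card_pick; rewrite Q2.
have BP : B \in P by move: BQ; rewrite QP inE => /andP[].
have BS : B != S by move: BQ; rewrite QP !inE => /andP[].
have QB1 := card_setD1 BQ Q2.
have [B' B'QB] : exists B', B' \in Q :\ B by apply: card_pick; rewrite QB1.
move: B'QB; rewrite inE in_set1 => /andP[B'B B'Q].
have B'P : B' \in P by move: B'Q; rewrite QP inE => /andP[].
have B'S : B' != S by move: B'Q; rewrite QP !inE => /andP[].
pose D := X :\: B'.
have cD : circuit M D.
  rewrite circuitE (complements_circ ccP B'P) andbT.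
  exact: subset_trans (subsetDl _ _) XW.
have SD : S \subset D.
  rewrite subsetD sub //=; apply: (trivIsetP tP) => //; by rewrite eq_sym.
have DE : #|D| = #|S|.+1.
  have : #|X| = #|S| + 2 by rewrite -(cardsID S X) (setIidPr (sub S SP)) S2.
  rewrite -(cardsID B' X) (setIidPr (sub B' B'P)) one // -/D; clear; lia.
have D3 : 2 < #|D| by rewrite DE.
have large E : circuit M E -> 2 < #|E| -> exists h, large_circuit E h.
  move=> cE E3; case: (blowup_circ_large cE) => // -[e [f [_ EE _]]].
  by move: E3; rewrite EE cards2; case: (e != f).
have [hD lD] := large D cD D3.
(* [C] is not a parallel pair: it would equal [S] and be properly contained in the circuit [D]. *)
have C3 : 2 < #|C|.
  case: (blowup_circ_large cC) => [[e [f [ef EC _]]]|[h lh]]; last first.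
    by rewrite (card_large_circuit lh) -(card_large_circuit lD).
  have SC : S = C by apply/eqP; rewrite eqEcard AC EC cards2 ef.
  move: cC cD; rewrite !circuitE -SC => /andP[_ cS] /andP[_ cD].
  by move: DE; rewrite -(circ_inj cS cD SD) => /eqP; rewrite eqn_leq ltnn andbF.
have [hC lC] := large C cC C3.
have CS : #|C :\: S| = 1.
  have : #|C| = #|S| + 1 by rewrite (card_large_circuit lC) -(card_large_circuit lD) DE addn1.
  rewrite -(cardsID S C) (setIidPr AC); clear; lia.
move/eqP/cards1P: CS => [x CSx].
have xCS : x \in C :\: S by rewrite CSx set11.
move: xCS; rewrite inE => /andP[xS xC].
have pe := blowup_order_perm cC.
apply: (@block_setD1 _ _ _ x) => //.
- by rewrite (perm_uniq pe) enum_uniq.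
- by rewrite (perm_mem pe) mem_enum.
- by rewrite (perm_size pe) -cardE ltnW.
move=> y; rewrite (perm_mem pe) mem_enum -CSx.
by rewrite !inE; have := subsetP AC y; case: (y \in S); case: (y \in C) => // /(_ isT).
Qed.

End BlowupOrder.

Theorem theorem7 (T : finType) (M : matroid T) (Mconn : connected M)
    (Mnonbin : ~ binary M) :
  theta_orderable M <->
  exists (n : nat) (T' : finType) (U N P : matroid T'),
    [/\ 4 <= n,
        matroid_iso U (uniform 2 [set: 'I_n]),
        balanced_series_ext U N,
        parallel_ext N P
      & matroid_iso M P].
Proof.
split=> [[w w_theta]|[n [T' [U [N [P [n4 isoU balN parP isoM]]]]]]].
  have [Q [uQ Q4 cardQ par]] := theta_ordering_structure w_theta Mconn Mnonbin.
  have /card_pick[A AQ] : 0 < #|Q| by apply: leq_trans Q4.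
  exact: (@utype_realizes _ _ _ uQ Q4 #|A| (fun B BQ => cardQ B A BQ AQ) par).
have bM := blowup_iso isoM (blowup_parallel_ext parP (balanced_blowup n4 isoU balN)).
have [m [k [phi [_ phiM]]]] := bM.
by exists (blowup_order phi); exact: blowup_order_theta phiM.
Qed.
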